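(* There is a deterministic LOCAL algorithm solving $(\text{edge-degree}+1)$-edge coloring in $O(\log^{12/13} n)$ rounds on $n$-node trees, and in $O(a+\log^{12/13} n)$ rounds on $n$-node graphs of arboricity at most $a$, for any $a\le 2^{\log^{1/13} n}$ (with $a$ known to the nodes).
   Context: For an edge $e$ of a graph, $\mathrm{edge\text{-}degree}(e)$ is the number of edges sharing an endpoint with $e$. An $(\text{edge-degree}+1)$-edge coloring assigns to each edge $e$ a color in $\{1,\dots,\mathrm{edge\text{-}degree}(e)+1\}$ such that any two edges sharing an endpoint receive different colors. The arboricity of a graph is the minimum number of forests into which its edge set can be partitioned. LOCAL model: nodes have unique IDs from $\{1,\dots,n^c\}$, know $n$, have unbounded computation, and communicate with neighbors in synchronous rounds with unbounded messages; each edge's color must be output by its endpoints. *)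

(* Defs.v *)
From Stdlib Require Import Reals.
From mathcomp Require Import all_boot.

Set Implicit Arguments.
Unset Strict Implicit.
Unset Printing Implicit Defensive.

Definition simple_graph (T : finType) (e : rel T) : Prop :=
  symmetric e /\ irreflexive e.

Definition deg (T : finType) (e : rel T) (v : T) : nat := #|[pred w | e v w]|.

Definition acyclic (T : finType) (f : rel T) : Prop :=
  forall s : seq T, ~~ [&& cycle f s, uniq s & 2 < size s].

Definition connected (T : finType) (e : rel T) : Prop :=
  forall x y : T, connect e x y.

Definition is_tree (T : finType) (e : rel T) : Prop :=
  connected e /\ acyclic e.

Definition arboricity_le (T : finType) (e : rel T) (a : nat) : Prop :=
  exists f : T -> T -> nat,
    (forall u v, e u v -> f u v = f v u /\ f u v < a) /\
    (forall i, i < a -> acyclic [rel x y | e x y && (f x y == i)]).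

(* (edge-degree+1)-edge colouring, given as a colour per (endpoint, other endpoint):
   col u v is the colour of edge uv output by u.  Both endpoints must agree;
   edge-degree(uv) = deg u + deg v - 2, so colours lie in {1,...,deg u + deg v - 1}. *)
Definition valid_ed1_coloring (T : finType) (e : rel T) (col : T -> T -> nat) : Prop :=
  (forall u v, e u v ->
     col u v = col v u /\ 1 <= col u v <= deg e u + deg e v - 1) /\
  (forall u v w, e u v -> e u w -> v != w -> col u v <> col u w).

(* LOCAL model (full-information, unbounded messages and computation):
   the state of a node after r rounds is its view, the tree of IDs it
   can learn; neighbours are listed in increasing ID order (canonical since
   IDs are unique).  A deterministic r-round LOCAL algorithm is a function of
   (the globally known parameters and) the node's r-round view. *)
Inductive view : Type := VNode : nat -> seq view -> view.

Fixpoint local_view (T : finType) (e : rel T) (id : T -> nat) (r : nat) (v : T)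
  : view :=
  match r with
  | 0 => VNode (id v) [::]
  | r'.+1 =>
      VNode (id v)
        [seq local_view e id r' u |
           u <- sort (fun x y => id x <= id y) [seq w <- enum T | e v w]]
  end.

Definition valid_ids (T : finType) (c : nat) (id : T -> nat) : Prop :=
  injective id /\ forall v, 1 <= id v <= #|T| ^ c.

Definition log2 (x : R) : R := Rdiv (ln x) (ln (INR 2)).

Definition logpow (n : nat) (p q : nat) : R := Rpower (log2 (INR n)) (Rdiv (INR p) (INR q)).

(* Main.v *)
Require Import Defs.
From Stdlib Require Import Reals Lra.
From mathcomp Require Import all_boot all_order all_algebra all_field zify.
From Stdlib Require Import FunctionalExtensionality ClassicalEpsilon.

Set Implicit Arguments.
Unset Strict Implicit.
Unset Printing Implicit Defensive.

(** The graph is peeled in layers, with [L] about [log^(1/13) n]: a node leaves as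
    soon as its degree is at most [k = 2^(2L+2)] and at most [2a] of its neighbours
    have larger degree.  By sparsity each step shrinks the rest of the graph by a
    factor [2^L], so [L^12 + 1] steps suffice.  The edges whose endpoints both have
    degree at most [k] when the first one leaves form a graph of maximum degree [k],
    which is coloured first.  The other edges are oriented acyclically with
    outdegree at most [2a]; they split into [2a] forests of depth at most the number
    of layers, which are coloured star by star in [O(a)] rounds.

    A graph of maximum degree [2^O(L)] is coloured in [O(L^12)] rounds as follows
    (after Balliu, Brandt, Kuhn and Olivetti).  One step of colour reduction yields
    node colours of [O(L)] bits, and the edges whose endpoints differ in a given bit
    form a bipartite graph.  There, classes of edges are coloured whose lists are four
    times larger than their degree within the class.  To do so, the colour space is
    halved bit by bit.  An edge picks its half so that the ratio of its degree to its
    list size hardly grows; since the number of competitors of an edge in a half is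
    the difference of the loads of its endpoints in a suitable orientation, this
    amounts to an approximately stable orientation.  That one is computed by orienting
    a few edges per node at a time and rebalancing with a token dropping game. *)

(** * Locality *)

(** The exponent comes from balancing two costs. For [n <= 2 ^ (L ^ 13)], shrinking by [2 ^ L] per
    layer takes about [L ^ 13 / L = L ^ 12] layers. The low-degree part costs [O(L)] bits of the
    node colours, times [O(L)] halvings of the uncoloured degree, times [O(L ^ 10)] for one list
    colouring, which itself is [O(L)] halvings of the colour space with an [O(L ^ 9)]-round
    orientation each.

    The delicate point is the error of that orientation. The ratio of degree to list size may rise
    only from 1/4 to 1/2 over all halvings, so a single halving may add about [1 / (4 * h)]. The
    error therefore has to be a small fraction of the degrees at the edge itself, not of the maximum
    degree.

    Algorithms are functions of the whole graph on the fixed set of possible identifiers. Locality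
    is a separate invariance statement, composed by adding radii; views enter only at the end. *)

Definition agr (W X : Type) (Q : W -> Prop) (I J : W -> X) : Prop :=
  forall v, Q v -> I v = J v.

(* [ball Q e f s v]: the graphs [e] and [f] look the same up to distance [s]
   from [v], and everything there satisfies [Q].  Inputs agreeing on [Q] lead an
   [s]-round algorithm to outputs agreeing on [ball Q e f s]. *)
Fixpoint ball (W : Type) (Q : W -> Prop) (e f : rel W) (s : nat) (v : W) : Prop :=
  if s is s'.+1 then
    [/\ ball Q e f s' v, e v = f v & forall w, e v w -> ball Q e f s' w]
  else Q v.

(** Algorithms read other nodes only through [nb], so that [agr_nb] charges each such read one
    round. *)
Definition nb (W X : Type) (e : rel W) (I : W -> X) (v w : W) : option X :=
  if e v w then Some (I w) else None.

Section Locality.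
Variables (W : Type) (e f : rel W).
Implicit Types Q : W -> Prop.

Lemma ballD Q s t v : ball (ball Q e f s) e f t v <-> ball Q e f (s + t) v.
Proof.
elim: t v => [|t IH] v; first by rewrite addn0.
rewrite addnS /=; split=> -[/IH H1 H2 H3]; split=> // w /H3 /IH //.
Qed.

Lemma ball_le Q s t v : s <= t -> ball Q e f t v -> ball Q e f s v.
Proof. by move/subnKC <-; elim: (t - s) => [|k IH]; rewrite ?addn0 // addnS => -[/IH]. Qed.

Lemma agr_sub (X : Type) Q Q' (I J : W -> X) :
  agr Q I J -> (forall v, Q' v -> Q v) -> agr Q' I J.
Proof. by move=> H S v /S /H. Qed.

Lemma agr_le (X : Type) Q s t (I J : W -> X) :
  s <= t -> agr (ball Q e f s) I J -> agr (ball Q e f t) I J.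
Proof. by move=> le H; apply: agr_sub H _ => v; apply: ball_le. Qed.

Lemma agr_base (X : Type) Q t (I J : W -> X) : agr Q I J -> agr (ball Q e f t) I J.
Proof. exact: (@agr_le _ Q 0 t). Qed.

Lemma agrD (X : Type) Q s t (I J : W -> X) :
  agr (ball (ball Q e f s) e f t) I J -> agr (ball Q e f (s + t)) I J.
Proof. by move=> H v /ballD /H. Qed.

Lemma agr_row Q : agr (ball Q e f 1) (e : W -> W -> bool) f.
Proof. by move=> v []. Qed.

Lemma agr_nb (X : Type) Q (I J : W -> X) :
  agr Q I J -> agr (ball Q e f 1) (nb e I) (nb f J).
Proof.
move=> H v [_ E S]; apply: functional_extensionality => w.
by rewrite /nb -E; case: (boolP (e v w)) => // /S /H ->.
Qed.

Lemma agr_iter (X : Type) s (F G : nat -> (W -> X) -> W -> X) n Q S S' :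
  (forall i t T T', agr (ball Q e f t) T T' ->
     agr (ball Q e f (t + s)) (F i T) (G i T')) ->
  agr Q S S' -> agr (ball Q e f (n * s)) (iteri n F S) (iteri n G S').
Proof. by move=> H H0; elim: n => [|n IH] //; rewrite mulSnr; apply: H. Qed.

Lemma nbE (X : Type) (I : W -> X) v w : e v w -> nb e I v w = Some (I w).
Proof. by rewrite /nb => ->. Qed.

(* Running an algorithm on a graph [g] whose nodes [z] are simulated by the
   nodes [p z] of the communication graph [e]. *)
Lemma ball_sim (Z : Type) (p : Z -> W) (g g' : rel Z) Q s z :
  (forall z w, g z w -> e (p z) (p w)) ->
  (forall z, Q (p z) -> g z = g' z) ->
  ball Q e f s (p z) -> ball (fun z => Q (p z)) g g' s z.
Proof.
move=> sub eqg; elim: s z => [|s IH] z //= [b E S]; split; first exact: IH.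
  by apply: eqg; exact: (@ball_le Q 0 s).
by move=> w gzw; apply/IH/S/sub.
Qed.

End Locality.

(** * Counting, truncated choice and ranks *)

Definition num (W : finType) (P : W -> bool) : nat := #|[pred w | P w]|.

Section Num.
Variable W : finType.
Implicit Types P Q : W -> bool.

Lemma num_sum P : num P = \sum_w P w.
Proof.
by rewrite /num -sum1_card [LHS]big_mkcond; apply: eq_bigr => w _; rewrite inE; case: (P w).
Qed.

Lemma eq_num P Q : P =1 Q -> num P = num Q.
Proof. by move=> E; apply: eq_card => w; rewrite !inE. Qed.

Lemma num_sub P Q : (forall w, P w -> Q w) -> num P <= num Q.
Proof. by move=> S; apply: subset_leq_card; apply/subsetP => w; rewrite !inE => /S. Qed.

Lemma num0 P : (forall w, ~~ P w) -> num P = 0.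
Proof. by move=> H; apply: eq_card0 => w; rewrite inE; apply: negbTE. Qed.

Lemma numP P w : P w -> 0 < num P.
Proof. by move=> Pw; apply/card_gt0P; exists w; rewrite inE. Qed.

Lemma num_ex P : 0 < num P -> exists w, P w.
Proof. by case/card_gt0P => w; rewrite inE; exists w. Qed.

Lemma numU P Q : num (fun w => P w || Q w) <= num P + num Q.
Proof. by rewrite !num_sum -big_split; apply: leq_sum => w _; case: (P w); case: (Q w). Qed.

Lemma numU_disj P Q : (forall w, P w -> ~~ Q w) ->
  num (fun w => P w || Q w) = num P + num Q.
Proof.
move=> D; rewrite !num_sum -big_split; apply: eq_bigr => w _.
by case: (boolP (P w)) => [/D /negbTE ->|_] //=; case: (Q w).
Qed.

Lemma numID P Q : num P = num (fun w => P w && Q w) + num (fun w => P w && ~~ Q w).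
Proof.
by rewrite !num_sum -big_split; apply: eq_bigr => w _; case: (P w); case: (Q w).
Qed.

Lemma numD1 P w : P w -> num P = (num (fun y => P y && (y != w))).+1.
Proof.
move=> Pw; rewrite (numID P (eq_op^~ w)) -add1n; congr (_ + _).
by rewrite -(card1 w); apply: eq_card => y; rewrite !inE; case: eqP => [->|]; rewrite ?Pw ?andbF.
Qed.

Lemma num_inj (Z : finType) (P : W -> bool) (Q : Z -> bool) (g : W -> Z) :
  (forall x y, P x -> P y -> g x = g y -> x = y) ->
  (forall x, P x -> Q (g x)) -> num P <= num Q.
Proof.
move=> inj PQ; rewrite /num -(card_in_imset (f := g)).
  by apply: subset_leq_card; apply/subsetP => z /imsetP[x]; rewrite !inE => Px ->; apply: PQ.
by move=> x y; rewrite !inE; apply: inj.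
Qed.

Definition rk P w := index w (enum [pred w | P w]).
Definition pick k P w : bool := P w && (rk P w < k).

Lemma rk_lt P w : P w -> rk P w < num P.
Proof. by move=> Pw; rewrite /num cardE index_mem mem_enum. Qed.

Lemma rk_inj P w y : P w -> P y -> rk P w = rk P y -> w = y.
Proof.
move=> Pw Py E; have := nth_index w (_ : w \in enum [pred w | P w]).
rewrite mem_enum => /(_ Pw) <-; rewrite -/(rk P w) E nth_index // mem_enum //.
Qed.

Lemma pick_sub k P w : pick k P w -> P w.
Proof. by case/andP. Qed.

Lemma pick_num k P : num (pick k P) = minn k (num P).
Proof.
have -> : num (pick k P) = #|[pred w in take k (enum [pred w | P w])]|.
  apply: eq_card => w; rewrite !inE /pick /rk /=.
  have [wP|wP] := boolP (P w); last first.
    by symmetry; apply/negP => /mem_take; rewrite mem_enum => /(negP wP).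
  by rewrite in_take ?mem_enum.
rewrite (card_uniqP _) ?take_uniq ?enum_uniq // size_take -cardE -/(num P) /minn.
by case: ltnP => //; case: ltnP => // *; lia.
Qed.

Lemma pick_num_le k P : num (pick k P) <= k.
Proof. by rewrite pick_num geq_minl. Qed.

Lemma pick_full k P w : P w -> ~~ pick k P w -> num (pick k P) = k.
Proof.
move=> Pw; rewrite /pick Pw /= -leqNgt => kl; rewrite pick_num.
by apply/minn_idPl; apply: leq_trans kl (ltnW (rk_lt Pw)).
Qed.

(** Within a residue class the quotient [rk P w %/ m] determines [w]. The predecessors absorb the
    rounding; they fit the later use, where an edge counts its competitors without itself. *)
Lemma rk_mod_num m P (i : nat) : 0 < m ->
  m * (num (fun w => P w && (rk P w %% m == i))).-1 <= (num P).-1.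
Proof.
move=> m0; set S := fun w => _ && _; case: (posnP (num S)) => [->|S0]; first by rewrite muln0.
have [w0 /andP[Pw0 _]] := num_ex S0.
have P0 : 0 < num P by apply: numP Pw0.
have lt w : P w -> rk P w %/ m < ((num P).-1 %/ m).+1.
  by move=> /rk_lt; rewrite ltnS => ?; apply: leq_div2r; lia.
pose f w : 'I_((num P).-1 %/ m).+1 := inord (rk P w %/ m).
have le : num S <= num (fun _ : 'I_((num P).-1 %/ m).+1 => true).
  apply: (@num_inj _ _ _ f) => // x y /andP[Px /eqP mx] /andP[Py /eqP my] /(congr1 val).
  rewrite /f /= !inordK ?lt // => E; apply: (@rk_inj P) => //.
  by rewrite (divn_eq (rk P x) m) (divn_eq (rk P y) m) E mx my.
have {}le : num S <= ((num P).-1 %/ m).+1.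
  by apply: leq_trans le _; rewrite -[X in _ <= X]card_ord; apply: max_card.
have := leq_trunc_div (num P).-1 m; nia.
Qed.

End Num.

(** * Token dropping *)

Definition dg (W : finType) (B : rel W) (w : W) := num (B w).

(* [tin] and [tout] record the edges over which a token was received or sent,
   [trho] counts the rounds in which the node was rich, [tsat] those in which it
   accepted as many tokens as it may, [tofs] those in which it made as many
   offers as it may, and [toc w] counts the offers made to [w]. *)
Record tst (W : Type) := Tst {
  ta : nat; trho : nat; tsat : nat; tofs : nat;
  toc : W -> nat; tin : W -> bool; tout : W -> bool }.

Section Token.
Variables (W : finType) (B : rel W).
(* A token may travel over the edge [y w], from [y] to [w], if [Fd y w]. *)
Variables (A dl : nat) (Fd : W -> W -> bool).

(** The quota of tokens accepted or offers made in a round. It exceeds [dg B w / A], so a node can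
    fill it with fresh edges fewer than [A] times. *)
Definition al (w : W) := (dg B w %/ A).+1.

Section Round.
Variable S : W -> tst W.

Definition rich w := al w + dl <= ta (S w).
Definition off v : pred W :=
  pick (al v) [pred w | [&& Fd v w, ~~ tout (S v) w, rich v
                          & nb B rich v w == Some false]].
Definition acc v : pred W :=
  pick (al v) [pred y | oapp (fun o : pred W => o v) false (nb B off v y)].
Definition mv v : pred W :=
  fun w => oapp (fun a : pred W => a v) false (nb B acc v w).

(** A rich node retires [dl] tokens per round. Retired tokens stay with it for good, which limits
    how long a node can be rich and makes [trho] a measure of its final load. *)
Definition tround v : tst W :=
  let s := S v in
  if rich v then
    Tst (ta s - dl - num (mv v)) (trho s).+1 (tsat s)
        (tofs s + (num (off v) == al v)) (fun w => toc s w + off v w)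
        (tin s) (fun w => tout s w || mv v w)
  else
    Tst (ta s + num (acc v)) (trho s) (tsat s + (num (acc v) == al v))
        (tofs s) (toc s) (fun y => tin s y || acc v y) (tout s).
End Round.

Definition tinit (t0 : W -> nat) v : tst W :=
  Tst (t0 v) 0 0 0 (fun=> 0) (fun=> false) (fun=> false).
Definition trun (R : nat) (t0 : W -> nat) : W -> tst W := iter R tround (tinit t0).

Hypothesis B_sym : symmetric B.
Hypothesis FdB : forall y w, Fd y w -> B y w.
Variables (t0 : W -> nat) (k : nat).
Hypothesis t0k : forall w, t0 w <= k.

Definition tinv (S : W -> tst W) r : Prop :=
  [/\ (forall y w, tin (S w) y = tout (S y) w) /\ (forall y w, tout (S y) w -> Fd y w),
      (forall w, al w * tsat (S w) <= num (tin (S w))) /\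
      (forall y, al y * tofs (S y) <= \sum_w toc (S y) w),
      forall y w, toc (S y) w <= if Fd y w then tsat (S w) + tout (S y) w else 0,
      forall y w, Fd y w -> ~~ tout (S y) w ->
        trho (S y) <= trho (S w) + tsat (S w) + tofs (S y) &
      forall w, [/\ ta (S w) + dl * trho (S w) + num (tout (S w)) = t0 w + num (tin (S w)),
        trho (S w) <= r &
        (trho (S w) = r /\ ta (S w) + dl * r <= k) \/ ta (S w) < 2 * al w + dl]].

Section Step.
Variable S : W -> tst W.

Lemma offP y w : off S y w ->
  [/\ Fd y w, ~~ tout (S y) w, rich S y & ~~ rich S w].
Proof.
move/pick_sub => /= /and4P[F t r]; rewrite nbE ?FdB // => /eqP[n].
by split=> //; rewrite n.
Qed.

Lemma accP w y : acc S w y -> off S y w.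
Proof.
move/pick_sub => /=; rewrite /nb; case: (B w y) => //=.
Qed.

Lemma mvE y w : mv S y w = acc S w y.
Proof.
rewrite /mv /nb; case: (boolP (B y w)) => //= nB; symmetry; apply/negP.
by case/accP/offP => /FdB; rewrite (negbTE nB).
Qed.

Lemma off_not_acc y w : off S y w -> ~~ acc S w y -> num (acc S w) = al w.
Proof.
move=> o; apply: pick_full => /=; rewrite nbE //=.
by rewrite B_sym; case/offP: o => /FdB.
Qed.

Lemma cand_not_off y w : Fd y w -> ~~ tout (S y) w -> rich S y -> ~~ rich S w ->
  ~~ off S y w -> num (off S y) = al y.
Proof.
by move=> F t r n; apply: pick_full; rewrite /= F t r nbE ?FdB // (negbTE n).
Qed.

Lemma tinv_round r : tinv S r -> tinv (tround S) r.+1.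
Proof.
case=> -[io oF] [i1 i2] i3 i4 i5.
have accn w y : acc S w y -> ~~ tin (S w) y.
  by case/accP/offP => _ + _ _; rewrite io.
have mvn y w : mv S y w -> ~~ tout (S y) w.
  by rewrite mvE => /accP/offP[].
split.
- split=> y w; rewrite /tround.
    case: (boolP (rich S w)) => rw; case: (boolP (rich S y)) => ry /=; rewrite ?io //.
    + rewrite mvE; case: (boolP (acc S w y)); rewrite ?orbF // => /accP/offP[_ _ _].
      by rewrite rw.
    + by rewrite mvE.
    + case: (boolP (acc S w y)); rewrite ?orbF // => /accP/offP[_ _].
      by rewrite (negbTE ry).
  case: (rich S y) => /= [/orP[/oF //|]|/oF //].
  by rewrite mvE => /accP/offP[].
- split=> w; rewrite /tround; case: (boolP (rich S w)) => rw /=; try exact: i1; try exact: i2.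
    rewrite numU_disj ?mulnDr ?leq_add ?i1 //.
      by case: eqP => [->|_]; rewrite ?muln1 ?muln0.
    by move=> y ty; apply: contraL ty; apply: accn.
  rewrite big_split /= mulnDr leq_add ?i2 //.
  rewrite -num_sum.
  by case: eqP => [->|_]; rewrite ?muln1 ?muln0.
- move=> y w; have := i3 y w; rewrite /tround.
  case: (boolP (Fd y w)) => F; last first.
    rewrite leqn0 => /eqP t; case: (rich S y) => /=; rewrite t //.
    by case: (boolP (off S y w)) => // /offP[]; rewrite (negbTE F).
  case: (boolP (rich S w)) => rw; case: (boolP (rich S y)) => ry //=.
  + case: (boolP (off S y w)) => [/offP[_ _ _]|_]; first by rewrite rw.
    by move=> ?; case: (mv S y w); lia.
  + case: (boolP (off S y w)) => [o|_]; last by case: (mv S y w); lia.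
    rewrite mvE; case: (boolP (acc S w y)) => a; case/offP: (o) => _ /negbTE -> _ _ /=; first lia.
    by rewrite (off_not_acc o a) eqxx; lia.
  + by lia.
- move=> y w F nt'.
  have nt : ~~ tout (S y) w.
    by apply: contra nt'; rewrite /tround; case: (rich S y) => //= ->.
  have := i4 y w F nt; move: nt'; rewrite /tround.
  case: (boolP (rich S w)) => rw; case: (boolP (rich S y)) => ry /=; try by lia.
  rewrite negb_or mvE nt /= => na; case: (boolP (off S y w)) => o.
    by rewrite (off_not_acc o na) eqxx; lia.
  by rewrite (cand_not_off F nt ry rw o) eqxx; lia.
- move=> w; have [e5 lr e6] := i5 w; rewrite /tround.
  case: (boolP (rich S w)) => rw /=.
    rewrite numU_disj; last by move=> y ty; apply: contraL ty; apply: mvn.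
    have le : num (mv S w) <= al w.
      apply: (@leq_trans (num (off S w))); last exact: pick_num_le.
      by apply: num_sub => y; rewrite mvE => /accP.
    move: rw; rewrite /rich => rw; split; [lia|by []|].
    case: e6 => [[e6 e6']|e6]; [left|right]; last by lia.
    by rewrite e6 mulnS; split=> //; lia.
  have le : num (acc S w) <= al w by apply: pick_num_le.
  rewrite numU_disj; last by move=> y ty; apply: contraL ty; apply: accn.
  by move: rw; rewrite /rich -ltnNge => rw; split; [lia|lia|right; lia].
Qed.

End Step.

Lemma tinv_run R : tinv (trun R t0) R.
Proof.
elim: R => [|R IH]; last by rewrite /trun iterS; apply: tinv_round.
have c0 : num (fun _ : W => false) = 0 by apply: num0.
split=> //=; first by split=> w; rewrite ?muln0.
by move=> w; rewrite c0; split=> //; [lia|left; rewrite muln0 addn0 t0k].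
Qed.

(** All tokens that end at [w], those left over and those retired. *)
Definition tau R w := ta (trun R t0 w) + dl * trho (trun R t0 w).

(** A node rich in all [R] rounds would retire more than the [k] tokens it can start with. Once
    poor, a node never again reaches [2 * al w + dl]. *)
Lemma tau_le R w : k < dl * R -> tau R w <= 2 * al w + dl + dl * R.
Proof.
move=> kR; case: (tinv_run R) => _ _ _ _ /(_ w)[_ le [[E]|]]; rewrite /tau; first by lia.
by have := leq_mul (leqnn dl) le; lia.
Qed.

(** The rich rounds of [y] exceed those of [w] by at most [tsat w + tofs y]. Here [tsat w < A] by
    the choice of the quota. An edge receives at most [A] offers, one successful and the others in
    rounds in which the receiver is saturated, whence [tofs y < A * A]. *)
Lemma tau_edge R y w : 0 < A -> k < dl * R -> Fd y w -> ~~ tout (trun R t0 y) w ->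
  tau R y <= tau R w + 2 * al y + dl + dl * (A * A + A).
Proof.
move=> A0 kR F nt; case: (tinv_run R) => -[io oF] [i1 i2] i3 i4 i5.
have dgA v : dg B v < al v * A by rewrite /al; apply: ltn_ceil.
have satA v : tsat (trun R t0 v) < A.
  rewrite -(ltn_pmul2l (ltn0Sn _ : 0 < al v)); apply: leq_ltn_trans (dgA v).
  apply: leq_trans (i1 v) _; apply: num_sub => z.
  by rewrite io => /oF /FdB; rewrite B_sym.
have ofsA : tofs (trun R t0 y) < A * A.
  rewrite -(ltn_pmul2l (ltn0Sn _ : 0 < al y)) mulnA.
  apply: leq_ltn_trans (i2 y) _; apply: (@leq_ltn_trans (dg B y * A)); last first.
    by rewrite ltn_pmul2r // dgA.
  rewrite /dg num_sum big_distrl /=; apply: leq_sum => z _.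
  apply: leq_trans (i3 y z) _; case: (boolP (Fd y z)) => [/FdB ->|_] //.
  by rewrite mul1n; have := satA z; case: (tout _ _); lia.
have := i4 y w F nt; have := satA w; case: (i5 y) => _ le [[E a]|a] sA r4; first by lia.
by rewrite /tau; have := leq_mul (leqnn dl) (_ : trho (trun R t0 y) <= trho (trun R t0 w) + (A * A + A)); lia.
Qed.

End Token.

Section TokenLocal.
Variables (W : finType) (e f : rel W) (A dl : nat).

Lemma tround_local Q Fd Fd' S S' : agr Q Fd Fd' -> agr Q S S' ->
  agr (ball Q e f 5) (tround e A dl Fd S) (tround f A dl Fd' S').
Proof.
move=> aF aS.
have aal : agr (ball Q e f 1) (al e A) (al f A).
  by move=> v b; rewrite /al /dg (agr_row b).
have ari : agr (ball Q e f 1) (rich e A dl S) (rich f A dl S').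
  by move=> v b; rewrite /rich (aal v b) (agr_base aS b).
have aoff : agr (ball Q e f 2) (off e A dl Fd S) (off f A dl Fd' S').
  move=> v b; have b1 := ball_le (isT : 1 <= 2) b.
  by rewrite /off (aal v b1) (ari v b1) (agr_base aS b) (agr_base aF b) (agr_nb ari b).
have aacc : agr (ball Q e f 3) (acc e A dl Fd S) (acc f A dl Fd' S').
  move=> v b; have b1 := ball_le (isT : 1 <= 3) b.
  by rewrite /acc (aal v b1) (agr_nb aoff b).
have amv : agr (ball Q e f 4) (mv e A dl Fd S) (mv f A dl Fd' S').
  by move=> v b; rewrite /mv (agr_nb aacc b).
move=> v b; rewrite /tround.
rewrite (agr_base aS b) (amv v (ball_le _ b)) // (aacc v (ball_le _ b)) //.
by rewrite (aoff v (ball_le _ b)) // (ari v (ball_le _ b)) // (aal v (ball_le _ b)).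
Qed.

Lemma trun_local Q Fd Fd' t0 t0' R : agr Q Fd Fd' -> agr Q t0 t0' ->
  agr (ball Q e f (R * 5)) (trun e A dl Fd R t0) (trun f A dl Fd' R t0').
Proof.
move=> aF at0.
have iterE (X : Type) (g : X -> X) x : iter R g x = iteri R (fun=> g) x.
  by elim: R => //= n ->.
rewrite /trun !iterE; apply: agr_iter.
  move=> _ t T T' aT; apply: agrD; apply: tround_local => //; exact: agr_base.
by move=> v q; rewrite /tinit at0.
Qed.

End TokenLocal.

(** * Approximately stable orientations *)

Section Phase.
Variables (W : finType) (B : rel W).
(* [O w y] says that [w] owns the edge [w y].  The owner [w] is content if its
   load exceeds that of [y] by at most [c w y]. *)
Variable c : W -> W -> int.

Definition unr (O : W -> W -> bool) w y :=
  [&& B w y, ~~ O w y & ~~ oapp (fun o : W -> bool => o w) false (nb B O w y)].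

Definition pref (x : W -> nat) w y : bool :=
  oapp (fun xy : nat => ((x w)%:Z - xy%:Z < c w y)%R ||
     (((x w)%:Z - xy%:Z == c w y)%R && (enum_rank w < enum_rank y)))
    false (nb B x w y).

Section OnePhase.
Variables (D k A dl R : nat) (O : W -> W -> bool).

Definition load w := num (O w).
Definition ud w := num (unr O w).
(** Only edges with nearly [D] unoriented edges around them are taken. An edge of small degree thus
    waits until [D] has come down to its own scale, which keeps the error relative to its degree. *)
Definition prop w y :=
  [&& unr O w y, oapp (fun uy : nat => D < ud w + uy + k) false (nb B ud w y)
    & pref load w y].
Definition Acc w := pick k (prop w).
(** A token at [y] stands for one edge newly taken in this phase. Passing it from [y] to [w] means
    handing over the edge [y w], so the load of a node grows exactly by the tokens that end there
    ([phase_load]). *)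
Definition Fd y w :=
  O y w && oapp (fun xw : nat => (c y w <= (load y)%:Z - xw%:Z)%R) false (nb B load y w).
Definition t0 w := num (Acc w).
Definition phase w : W -> bool :=
  let s := trun B A dl Fd R t0 w in
  fun y => [|| Acc w y, O w y && ~~ tout s y | tin s y].
End OnePhase.

Hypothesis B_sym : symmetric B.
Hypothesis B_irr : irreflexive B.
Hypothesis c_anti : forall w y, B w y -> c y w = (- c w y)%R.

Definition wf (O : W -> W -> bool) := forall w y, O w y -> B w y && ~~ O y w.

Lemma unrE O w y : unr O w y = [&& B w y, ~~ O w y & ~~ O y w].
Proof. by rewrite /unr /nb; case: (B w y). Qed.

Lemma unr_sym O w y : unr O w y = unr O y w.
Proof. by rewrite !unrE B_sym [~~ O w y && _]andbC. Qed.

Lemma prefN x w y : B w y -> pref x w y = ~~ pref x y w.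
Proof.
move=> b; have b' : B y w by rewrite B_sym.
rewrite /pref (nbE _ b) (nbE _ b') /= (c_anti b) negb_or negb_and.
have ne : enum_rank w != enum_rank y :> nat.
  by apply: contraTneq b => /ord_inj/enum_rank_inj ->; rewrite B_irr.
case: (ltngtP (enum_rank w) (enum_rank y)) ne => //= _ _; rewrite ?andbT ?andbF ?orbF ?orbT; lia.
Qed.

Section PhaseLemmas.
Variables (D k A dl R : nat) (O : W -> W -> bool).
Hypothesis wfO : wf O.
Let O' := phase D k A dl R O.
Let s := trun B A dl (Fd O) R (t0 D k O).
Let ta' := tau B A dl (Fd O) (t0 D k O) R.

Lemma FdB y w : Fd O y w -> B y w.
Proof. by case/andP => /wfO/andP[]. Qed.

Lemma FdE y w : B y w ->
  Fd O y w = O y w && (c y w <= (load O y)%:Z - (load O w)%:Z)%R.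
Proof. by move=> b; rewrite /Fd nbE. Qed.

Lemma propE w y : B w y ->
  prop D k O w y = [&& unr O w y, D < ud O w + ud O y + k & pref (load O) w y].
Proof. by move=> b; rewrite /prop nbE. Qed.

Lemma prop_unr w y : prop D k O w y -> unr O w y.
Proof. by case/andP. Qed.

Lemma Acc_unr w y : Acc D k O w y -> unr O w y.
Proof. by move/pick_sub/prop_unr. Qed.

Lemma Acc_anti w y : Acc D k O w y -> ~~ Acc D k O y w.
Proof.
move/pick_sub => p; have := prop_unr p; rewrite unrE => /andP[b _].
have b' : B y w by rewrite B_sym.
apply: contraTN p => /pick_sub; rewrite (propE b) (propE b') => /and3P[_ _].
by rewrite (prefN _ b') => /negbTE ->; rewrite !andbF.
Qed.

Lemma t0k w : t0 D k O w <= k.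
Proof. exact: pick_num_le. Qed.

Let inv := @tinv_run W B A dl (Fd O) B_sym FdB (t0 D k O) k t0k R.

Lemma tinE y w : tin (s w) y = tout (s y) w.
Proof. by case: inv => -[]. Qed.

Lemma tout_Fd y w : tout (s y) w -> Fd O y w.
Proof. by case: inv => -[_ +] _ _ _ _; apply. Qed.

Lemma tout_O y w : tout (s y) w -> O y w.
Proof. by move/tout_Fd/andP => []. Qed.

Lemma phaseE w y : O' w y = [|| Acc D k O w y, O w y && ~~ tout (s w) y | tout (s y) w].
Proof. by rewrite -(tinE y w). Qed.

Lemma phase_wf : wf O'.
Proof.
move=> w y; rewrite !phaseE => /or3P[a|/andP[o t]|t].
- rewrite (negbTE (Acc_anti a)); have := Acc_unr a; rewrite unrE => /and3P[-> no1 no2] /=.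
  rewrite (negbTE no2) /=; apply: contra no1; exact: tout_O.
- have /andP[b no] := wfO o; rewrite b (negbTE no) (negbTE t) orbF /= orbF.
  by apply: contraTN o => /Acc_unr; rewrite unrE => /and3P[].
- have o := tout_O t; have /andP[b no] := wfO o.
  rewrite B_sym b t andbF /= negb_or; apply/andP; split.
    by apply: contraTN o => /Acc_unr; rewrite unrE => /and3P[].
  by apply: contra no; apply: tout_O.
Qed.

Lemma phase_load w : load O' w = load O w + ta' w.
Proof.
case: inv => _ _ _ _ /(_ w)[E _ _].
have eO : load O w = num (fun y => O w y && ~~ tout (s w) y) + num (tout (s w)).
  rewrite addnC /load (numID (O w) (tout (s w))); congr (_ + _); apply: eq_num => y.
  by case: (boolP (tout (s w) y)) => [/tout_O ->|_]; rewrite ?andbF.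
have eO' : load O' w = t0 D k O w + (num (fun y => O w y && ~~ tout (s w) y) + num (tin (s w))).
  rewrite -numU_disj => [|y /andP[o _]]; last first.
    by rewrite tinE; apply: contraTN o => t; have /andP[_ ->] := wfO (tout_O t).
  rewrite /load /t0 -numU_disj // => y /Acc_unr; rewrite unrE => /and3P[_ no1 no2].
  by rewrite (negbTE no1) /= tinE; apply: contra no2; apply: tout_O.
rewrite -/s in E; rewrite eO eO' /ta' /tau -/s; lia.
Qed.

Lemma phase_unr w y : unr O' w y ->
  [/\ unr O w y, ~~ Acc D k O w y & ~~ Acc D k O y w].
Proof.
rewrite !unrE !phaseE !negb_or !negb_and !negbK => /and3P[-> /and3P[-> h1 h2] /and3P[-> h3 h4]].
split=> //; apply/and3P; split=> //; apply/negP => o.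
  by move: h1; rewrite o (negbTE h4).
by move: h3; rewrite o (negbTE h2).
Qed.

Lemma phase_ud w : ud O' w + num (Acc D k O w) <= ud O w.
Proof.
rewrite /ud -numU_disj; first by apply: num_sub => y /orP[/phase_unr[]|/Acc_unr].
by move=> y /phase_unr[].
Qed.

(** If the sum was above [D - k], the edge was proposed to its preferred endpoint. Not being taken,
    it witnesses that this endpoint took [k] other edges. *)
Lemma phase_unr_ud w y : (forall w y, unr O w y -> ud O w + ud O y <= D) ->
  unr O' w y -> ud O' w + ud O' y <= D - k.
Proof.
move=> HD /phase_unr[u a1 a2]; have := phase_ud w; have := phase_ud y.
have := HD _ _ u; case: (leqP (ud O w + ud O y + k) D); first by lia.
move=> lt; have b : B w y by move: u; rewrite unrE => /and3P[].
case: (boolP (pref (load O) w y)) => p.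
  have /pick_full -> : prop D k O w y by rewrite propE // u lt p.
    lia.
  exact: a1.
have /pick_full -> : prop D k O y w.
  have b' : B y w by rewrite B_sym.
  by rewrite (propE b') unr_sym u (addnC (ud O y)) lt (prefN _ b').
  by lia.
exact: a2.
Qed.

(** An edge that is new, flipped, or barred from flipping was no violation for its present owner
    before the phase, so only the tokens gained by the owner count. The remaining edges could have
    carried a token and did not; [tau_edge] applies to these. *)
Lemma phase_viol w y : O' w y ->
  ((load O' w)%:Z - (load O' y)%:Z <= c w y + (ta' w)%:Z)%R /\
    (unr O w y /\ D < ud O w + ud O y + k \/ O w y \/ O y w) \/
  [/\ Fd O w y, ~~ tout (s w) y & O w y].
Proof.
rewrite phaseE !phase_load => /or3P[a|/andP[o t]|t].
- left; have p := pick_sub a; have b : B w y by have := prop_unr p; rewrite unrE => /and3P[].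
  move: p; rewrite propE // => /and3P[u lt]; rewrite /pref nbE //= => p.
  split; last by left.
  by case/orP: p => [|/andP[/eqP]]; lia.
- case: (boolP (Fd O w y)) => F; first by right.
  left; split; last by right; left.
  by move: F; rewrite FdE ?o /=; [lia | case/andP: (wfO o)].
- left; have o := tout_O t; split; last by right; right.
  have := tout_Fd t; rewrite FdE ?o /=; last by case/andP: (wfO o).
  by rewrite (c_anti (w := w)) ?[B w y]B_sym; [lia | case/andP: (wfO o)].
Qed.

End PhaseLemmas.
End Phase.

Section PhaseLocal.
Variables (W : finType) (e f : rel W).

Lemma phase_local Q c c' D k A dl R O O' : agr Q c c' -> agr Q O O' ->
  agr (ball Q e f (R * 5 + 3)) (phase e c D k A dl R O) (phase f c' D k A dl R O').
Proof.
move=> ac aO.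
have al1 : agr Q (load O) (load O') by move=> v q; rewrite /load aO.
have aunr : agr (ball Q e f 1) (unr e O) (unr f O').
  move=> v b; apply: functional_extensionality => w.
  by rewrite /unr (agr_row b) (agr_nb aO b) (agr_base aO b).
have aud : agr (ball Q e f 1) (ud e O) (ud f O') by move=> v b; rewrite /ud aunr.
have apref : agr (ball Q e f 1) (pref e c (load O)) (pref f c' (load O')).
  move=> v b; apply: functional_extensionality => w.
  by rewrite /pref (agr_nb al1 b) (agr_base al1 b) (agr_base ac b).
have aAcc : agr (ball Q e f 2) (Acc e c D k O) (Acc f c' D k O').
  move=> v b; have b1 := ball_le (isT : 1 <= 2) b.
  rewrite /Acc; congr (pick _ _); apply: functional_extensionality => w.
  by rewrite /prop (agr_nb aud b) (apref v b1) (aud v b1) (aunr v b1).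
have aF : agr (ball Q e f 2) (Fd e c O) (Fd f c' O').
  move=> v b; have b1 := ball_le (isT : 1 <= 2) b; apply: functional_extensionality => w.
  by rewrite /Fd (agr_nb al1 b1) (agr_base ac b) (agr_base al1 b) (agr_base aO b).
have at0 : agr (ball Q e f 2) (t0 e c D k O) (t0 f c' D k O') by move=> v b; rewrite /t0 aAcc.
have ar := agrD (trun_local A dl aF at0 (R := R)).
move=> v b; rewrite /phase (agr_base aO b) (aAcc v (ball_le _ b)) ?ar //; last by lia.
by apply: ball_le b; lia.
Qed.

End PhaseLocal.

(** * Geometric decrease of the bound on unoriented degrees *)

Fixpoint Dsq (q m D0 i : nat) : nat :=
  if i is i'.+1 then
    let D := Dsq q m D0 i' in if q <= D then D - D %/ m else D
  else D0.

Lemma bernoulli y n : y ^ n * (y + n) <= y.+1 ^ n * y.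
Proof.
elim: n => [|n IH]; first by rewrite addn0.
rewrite !expnS; move: IH; set a := y ^ n; set b := y.+1 ^ n; nia.
Qed.

Lemma halving y : 0 < y -> 2 * y ^ y.+1 <= y.+1 ^ y.+1.
Proof. by move=> y0; rewrite -(leq_pmul2r y0); have := bernoulli y y.+1; nia. Qed.

(** As long as [D >= q >= m], rounding at most halves the quotient [D / m], so a step multiplies [D]
    by at most [1 - 1 / (2 * m)]. By [halving], [2 * m] such steps halve [D], and [h + 2] halvings
    take [2 ^ h.+1] below 1. *)
Lemma Dsq_end q m h : 0 < m -> m <= q -> Dsq q m (2 ^ h.+1) (2 * m * (h + 2)) < q.
Proof.
move=> m0 mq; set D := Dsq q m _; rewrite ltnNge; apply/negP => qD.
have mono i : D i.+1 <= D i by rewrite /D /=; case: ifP => // _; rewrite leq_subr.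
have qDi i : i <= 2 * m * (h + 2) -> q <= D i.
  move=> le; apply: leq_trans qD _; rewrite -(subnKC le); elim: (_ - i) => [|j IH].
    by rewrite addn0.
  by rewrite addnS; apply: leq_trans (mono _) IH.
set y := (2 * m).-1; have y1 : y.+1 = 2 * m by rewrite /y; lia.
have y0 : 0 < y by rewrite /y; lia.
have dec i : i <= 2 * m * (h + 2) -> y.+1 ^ i * D i <= y ^ i * 2 ^ h.+1.
  elim: i => [|i IH] le; first by rewrite !expn0 !mul1n.
  have := IH (ltnW le); have qi := qDi i (ltnW le).
  have : y.+1 * D i.+1 <= y * D i.
    rewrite {1}/D /= -/(D i) qi y1 /y; have := leq_trunc_div (D i) m; have := ltn_ceil (D i) m0.
    have : 0 < D i %/ m by rewrite divn_gt0 //; apply: leq_trans mq qi.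
    nia.
  rewrite !expnS; move: (y.+1 ^ i) (y ^ i) (2 ^ h.+1) (D i) (D i.+1) => a b z u v.
  move=> H1 H2; apply: leq_trans (_ : a * (y * u) <= _).
    by rewrite [y.+1 * a]mulnC -mulnA leq_mul2l H1 orbT.
  by rewrite mulnCA -mulnA leq_mul2l H2 orbT.
have pw j : 2 ^ j * y ^ (y.+1 * j) <= y.+1 ^ (y.+1 * j).
  by rewrite !expnM -expnMn; case: j => // j; rewrite leq_exp2r // halving.
have E : 2 * m * (h + 2) = y.+1 * h.+2 by rewrite y1 addn2.
have d := dec _ (leqnn _); have q1 := qDi _ (leqnn _); rewrite E in d q1.
have := pw h.+2; rewrite (expnS 2 h.+1) -mulnA.
have : 0 < y ^ (y.+1 * h.+2) by rewrite expn_gt0 y0.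
have : 0 < 2 ^ h.+1 by rewrite expn_gt0.
move: d q1; move: (D _) (y ^ _) (y.+1 ^ _) (2 ^ _) => u a b z d q1 z0 a0 p.
have u0 : 0 < u by lia.
have : b <= b * u by rewrite leq_pmulr.
have : 0 < a * z by rewrite muln_gt0 a0.
by move: d p; rewrite (mulnC z a); lia.
Qed.

(** * Orientation by repeated phases *)

Section Orient.
Variables (W : finType) (h m N q A s : nat).
Let G := A * A + A + 1.
Let R := 2 * s * G.
Let D := Dsq q m (2 ^ h.+1).

Definition ori_step (B : rel W) c i (O : W -> W -> bool) :=
  if q <= D i then phase B c (D i) (D i %/ m) A (D i %/ m %/ (s * G)) R O else O.

(** The closing phase has [k = D N], so it leaves no edge unoriented. It runs zero token rounds and
    raises each load by at most [D N]. *)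
Definition ori (B : rel W) c : W -> W -> bool :=
  phase B c (D N) (D N) 1 0 0 (iteri N (ori_step B c) (fun _ _ => false)).

Section Correct.
Variables (B : rel W) (c : W -> W -> int).
Hypothesis B_sym : symmetric B.
Hypothesis B_irr : irreflexive B.
Hypothesis c_anti : forall w y, B w y -> c y w = (- c w y)%R.
Hypothesis dgB : forall w, dg B w <= 2 ^ h.
Hypotheses (m2 : 1 < m) (A0 : 0 < A) (s0 : 0 < s) (qE : q = s * G * m).

Let De w y := dg B w + dg B y.
Let ale w y := (De w y %/ A).+1.
Let bs w y := 3 * (2 * De w y %/ m) + 2 * ale w y.

(** The violation of an edge is at most [bs] when it is oriented or flipped. In each later phase it
    grows by [2 * ale + dl * G], where [s * dl * G <= k = D i - D i.+1]; the term [2 * De - D i] is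
    the telescoped sum of these decreases. *)
Definition oinv i (O : W -> W -> bool) : Prop :=
  [/\ wf B O,
      forall w y, unr B O w y -> ud B O w + ud B O y <= D i &
      forall w y, O w y -> D i <= 2 * De w y /\
       (s%:Z * ((load O w)%:Z - (load O y)%:Z - c w y) <=
         (s * (bs w y + i * (2 * ale w y)) + (2 * De w y - D i))%N%:Z)%R].

Lemma ud_dg O w : ud B O w <= dg B w.
Proof. by apply: num_sub => y; rewrite unrE => /and3P[]. Qed.

Lemma oinv0 : oinv 0 (fun _ _ => false).
Proof.
split=> // w y _; have := dgB w; have := dgB y; have := ud_dg (fun _ _ => false) w.
by have := ud_dg (fun _ _ => false) y; rewrite /D /= expnS; lia.
Qed.

Lemma oinv_step i O : oinv i O -> oinv i.+1 (ori_step B c i O).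
Proof.
case=> wfO iu iv; rewrite /ori_step.
case: ifP => qD; last first.
  have ED : D i.+1 = D i by rewrite /D /= -/(D i) qD.
  split=> // w y; rewrite ED; first exact: iu.
  by case/iv => le v; split=> //; nia.
set k := D i %/ m; set dl := k %/ (s * G).
have ED : D i.+1 = D i - k by rewrite /D /= -/(D i) qD.
have m0 : 0 < m by lia.
have G0 : 0 < G by rewrite /G addn1.
have sG0 : 0 < s * G by rewrite muln_gt0 s0.
have kD : k * m <= D i by apply: leq_trunc_div.
have ksG : s * G <= k by rewrite leq_divRL // -qE.
have dlk : dl * (s * G) <= k by apply: leq_trunc_div.
have kdl : k < dl.+1 * (s * G) by apply: ltn_ceil.
have dl0 : 0 < dl by rewrite divn_gt0.
(* The factor 2 in [R] pays for the rounding in [dl], which is positive because [q <= D i]. *)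
have kR : k < dl * R.
  by rewrite /R -(mulnA 2); move: kdl dl0; move: (s * G) => z; nia.
have dlR : dl * R <= 2 * k by rewrite /R -(mulnA 2); move: dlk; move: (s * G) => z; lia.
have dllek : dl <= k by apply: leq_trans dlk; rewrite leq_pmulr.
set O' := phase _ _ _ _ _ _ _ _.
have alD w y : al B A w <= ale w y by rewrite /al /ale ltnS leq_div2r // leq_addr.
split; first exact: phase_wf.
  by move=> w y; rewrite ED; apply: phase_unr_ud.
move=> w y /(phase_viol B_sym c_anti wfO) H.
have DeC : De y w = De w y by rewrite /De addnC.
(* A newly oriented edge has passed the filter [D < ud w + ud y + k], with [k] at most half of [D]
   since [1 < m]. *)
have DDe : D i <= 2 * De w y.
  case: H => [[_]|[_ _ o]]; last by case: (iv w y o).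
  case=> [[_ lt]|[/iv[]//|/iv[]]]; last by rewrite DeC.
  have := ud_dg O w; have := ud_dg O y; rewrite /De; nia.
have kDe : k <= 2 * De w y %/ m by apply: leq_div2r.
split; first by rewrite ED; lia.
case: H => [[v _]|[F nt o]].
  have := @tau_le W B A dl (Fd B c O) B_sym (FdB wfO) (t0 B c (D i) k O) k (t0k _ _ _ _ _) R w kR.
  move: v; move: (tau _ _ _ _ _ _ _) => ta v tle.
  have {}tle : ta <= bs w y.
    by apply: leq_trans tle _; rewrite /bs; have := alD w y; lia.
  rewrite -/O' in v; have {}v : ((load O' w)%:Z - (load O' y)%:Z - c w y <= (bs w y)%:Z)%R by lia.
  have : (s%:Z * ((load O' w)%:Z - (load O' y)%:Z - c w y) <= s%:Z * (bs w y)%:Z)%R.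
    by move: v; set x := (_ - c w y)%R; nia.
  have : s * bs w y <= s * (bs w y + i.+1 * (2 * ale w y)) + (2 * De w y - D i.+1).
    by apply: leq_trans (leq_addr _ _); rewrite leq_mul2l leq_addr orbT.
  by move: (s * (_ + _) + _) => rhs; clear; lia.
have [_ vo] := iv w y o.
have := @tau_edge W B A dl (Fd B c O) B_sym (FdB wfO) (t0 B c (D i) k O) k (t0k _ _ _ _ _) R w y A0 kR F nt.
have pl v : load O' v = load O v + tau B A dl (Fd B c O) (t0 B c (D i) k O) R v.
  exact: phase_load.
rewrite !pl.
move: (tau _ _ _ _ _ _ w) (tau _ _ _ _ _ _ y) => tw ty tle.
have {}tle : tw <= ty + 2 * ale w y + dl * G.
  by apply: leq_trans tle _; have := alD w y; rewrite /G; nia.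
rewrite ED; move: vo dlk; set x := (_ - c w y)%R => vo dlk.
have -> : ((load O w + tw)%N%:Z - (load O y + ty)%N%:Z - c w y = x + tw%:Z - ty%:Z)%R.
  by rewrite /x; lia.
have : (s%:Z * (tw%:Z - ty%:Z) <= s%:Z * (2 * ale w y + dl * G)%N%:Z)%R.
  by apply: Num.Theory.ler_wpM2l => //; lia.
have : s * (dl * G) <= k by rewrite mulnCA.
have kDi : k <= D i by apply: leq_div.
move: vo DDe kDi; clear; move: (bs w y) (ale w y) (De w y) (D i) => b a d DD; lia.
Qed.

Lemma oinv_iter i : oinv i (iteri i (ori_step B c) (fun _ _ => false)).
Proof. by elim: i => [|i IH]; [exact: oinv0 | exact: oinv_step]. Qed.

Theorem ori_ok (O := ori B c) :
  [/\ wf B O,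
      forall w y, B w y -> O w y || O y w &
      forall w y, O w y ->
       (s%:Z * ((load O w)%:Z - (load O y)%:Z - c w y) <=
         (s * (bs w y + N * (2 * ale w y)) + 2 * De w y + s * D N)%N%:Z)%R].
Proof.
have [wfO iu iv] := oinv_iter N; rewrite /O /ori; move: (iteri _ _ _) wfO iu iv => P wfP iu iv.
set O' := phase _ _ _ _ _ _ _ _.
have wfO' : wf B O' by apply: phase_wf.
split=> //.
  move=> w y b; apply/negPn/negP; rewrite negb_or => no.
  have u' : unr B O' w y by rewrite unrE b.
  have := phase_unr_ud B_sym B_irr c_anti wfP iu u'; rewrite subnn leqn0 addn_eq0.
  by rewrite -leqn0 leqNgt -/O' (numP u').
move=> w y o'.
have ta w' : tau B 1 0 (Fd B c P) (t0 B c (D N) (D N) P) 0 w' <= D N.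
  by rewrite /tau /= addn0; apply: t0k.
case: (phase_viol B_sym c_anti wfP o') => [[v _]|[_ _ o]].
  have := ta w; move: v; move: (tau _ _ _ _ _ _ _) => z; rewrite -/O'; set x := (_ - _)%R.
  by move=> v le; have : (x - c w y <= (D N)%:Z)%R by [lia]; set x' := (x - _)%R; nia.
have pl v : load O' v = load P v + tau B 1 0 (Fd B c P) (t0 B c (D N) (D N) P) 0 v.
  exact: phase_load.
have [_ v] := iv w y o; rewrite !pl.
have := ta w; move: (tau _ _ _ _ _ _ w) (tau _ _ _ _ _ _ y) => z z' le.
move: v; set x := (_ - c w y)%R => v.
have : ((load P w + z)%N%:Z - (load P y + z')%N%:Z - c w y <= x + (D N)%:Z)%R by rewrite /x; lia.
set x' := (_ - c w y)%R; move=> H.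
have : (s%:Z * x' <= s%:Z * (x + (D N)%:Z))%R by nia.
by move: v; move: (s * (_ + _)); clear; lia.
Qed.

End Correct.

Lemma ori_local e f Q c c' : agr Q c c' ->
  agr (ball Q e f (N * (R * 5 + 3) + 3)) (ori e c) (ori f c').
Proof.
move=> ac; apply: agrD; apply: (@phase_local _ _ _ _ _ _ _ _ _ _ 0); first exact: agr_base.
apply: agr_iter => // i t T T' aT; rewrite /ori_step; case: ifP => _.
  by apply: agrD; apply: phase_local => //; apply: agr_base.
by apply: agr_le aT; rewrite leq_addr.
Qed.

End Orient.

(** * Polynomial bounds *)

Definition pb (d : nat) (F : nat -> nat) : Prop :=
  exists C, forall h, 0 < h -> F h <= C * h ^ d.

Lemma pb_const c : pb 0 (fun=> c).
Proof. by exists c => h _; rewrite muln1. Qed.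

Lemma pb_id : pb 1 id.
Proof. by exists 1 => h _; rewrite mul1n. Qed.

Lemma pb_le d d' F : d <= d' -> pb d F -> pb d' F.
Proof.
move=> le [C H]; exists C => h h0; apply: leq_trans (H h h0) _.
by rewrite leq_mul2l leq_pexp2l ?orbT.
Qed.

Lemma pbD d F F' : pb d F -> pb d F' -> pb d (fun h => F h + F' h).
Proof.
by move=> [C H] [C' H']; exists (C + C') => h h0; rewrite mulnDl leq_add ?H ?H'.
Qed.

Lemma pbM d d' F F' : pb d F -> pb d' F' -> pb (d + d') (fun h => F h * F' h).
Proof.
move=> [C H] [C' H']; exists (C * C') => h h0.
by rewrite expnD mulnACA leq_mul ?H ?H'.
Qed.

Lemma pbX d F F' : pb d F -> (forall h, F' h <= F h) -> pb d F'.
Proof. by move=> [C H] le; exists C => h h0; apply: leq_trans (le h) (H h h0). Qed.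

Lemma pbS d F : pb d F -> pb d (fun h => (F h).+1).
Proof.
move=> H; apply: (@pbX _ (fun h => F h + 1)) => [|h]; last by rewrite addn1.
by apply: pbD => //; apply: (@pb_le 0) => //; apply: pb_const.
Qed.

(** * Parameters of the orientation algorithm *)

(** For [s = 64 * h], the values [pm] and [pA] make each of the terms [s * 3 * (2 * De %/ m)],
    [s * (N + 1) * 2 * (De %/ A)] and [2 * De] in the bound of [ori_ok] at most [2 * De]. Their sum
    is below [8 * De], which is [De / (8 * h)] after division by [s]. [pN] is the number of steps in
    [Dsq_end], and [beta] collects what does not depend on the degrees. *)
Definition ps h := 64 * h.
Definition pm h := 3 * ps h.
Definition pN h := 2 * pm h * (h + 2).
Definition pA h := ps h * (pN h).+1.
Definition pG h := pA h * pA h + pA h + 1.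
Definition pq h := ps h * pG h * pm h.
Definition beta h := 2 * (pN h).+1 + pq h.
Definition oriT h := pN h * (2 * ps h * pG h * 5 + 3) + 3.

Definition orient (W : finType) h (B : rel W) c : W -> W -> bool :=
  ori h (pm h) (pN h) (pq h) (pA h) (ps h) B c.

Lemma pb_ps : pb 1 ps.
Proof. exact: (pbM (pb_const 64) pb_id). Qed.

Lemma pb_pm : pb 1 pm.
Proof. exact: (pbM (pb_const 3) pb_ps). Qed.

Lemma pb_pN : pb 2 pN.
Proof.
apply: (@pbM 1 1 (fun h => 2 * pm h) (fun h => h + 2)).
  exact: (pbM (pb_const 2) pb_pm).
by apply: pbD pb_id _; apply: pb_le (pb_const 2).
Qed.

Lemma pb_pA : pb 3 pA.
Proof. exact: (pbM pb_ps (pbS pb_pN)). Qed.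

Lemma pb_pG : pb 6 pG.
Proof.
apply: pbD; last by apply: pb_le (pb_const 1).
by apply: pbD (pbM pb_pA pb_pA) _; apply: pb_le pb_pA.
Qed.

Lemma pb_pq : pb 8 pq.
Proof. exact: (pbM (pbM pb_ps pb_pG) pb_pm). Qed.

Lemma pb_beta : pb 8 beta.
Proof.
apply: pbD pb_pq; apply: (@pb_le 2) => //; exact: (pbM (pb_const 2) (pbS pb_pN)).
Qed.

Lemma pb_oriT : pb 9 oriT.
Proof.
apply: pbD; last by apply: pb_le (pb_const 3).
apply: (@pbM 2 7 pN (fun h => 2 * ps h * pG h * 5 + 3) pb_pN).
apply: pbD; last by apply: pb_le (pb_const 3).
exact: (pbM (pbM (pbM (pb_const 2) pb_ps) pb_pG) (pb_const 5)).
Qed.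

Section Orient.
Variables (W : finType) (h : nat) (B : rel W) (c : W -> W -> int).
Hypothesis h0 : 0 < h.
Hypothesis B_sym : symmetric B.
Hypothesis B_irr : irreflexive B.
Hypothesis c_anti : forall w y, B w y -> c y w = (- c w y)%R.
Hypothesis dgB : forall w, dg B w <= 2 ^ h.

Theorem orient_ok (O := orient h B c) :
  [/\ wf B O,
      forall w y, B w y -> O w y || O y w &
      forall w y, O w y ->
        ((8 * h)%N%:Z * ((load O w)%:Z - (load O y)%:Z - c w y) <=
          (dg B w + dg B y + 8 * h * beta h)%N%:Z)%R].
Proof.
have s0 : 0 < ps h by rewrite muln_gt0.
have m2 : 1 < pm h by rewrite /pm; lia.
have A0 : 0 < pA h by rewrite muln_gt0 s0.
have G0 : 0 < pG h by rewrite /pG addn1.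
have [w1 w2 w3] := ori_ok (pN h) B_sym B_irr c_anti dgB m2 A0 s0 (erefl (pq h)).
split=> // w y /w3; rewrite -/O -/(orient _ _ _).
have : Dsq (pq h) (pm h) (2 ^ h.+1) (pN h) <= pq h.
  apply: ltnW; apply: Dsq_end; first by lia.
  by rewrite /pq leq_pmull // muln_gt0 s0.
move: (Dsq _ _ _ _) => D Dq; rewrite /beta; move: (pq h) Dq => q Dq.
set De := dg B w + dg B y; set x := (_ - c w y)%R.
have : ps h * (3 * (2 * De %/ pm h)) <= 2 * De.
  by rewrite mulnA [ps h * 3]mulnC -/(pm h) mulnC leq_trunc_div.
have : ps h * (2 * (De %/ pA h).+1 + pN h * (2 * (De %/ pA h).+1)) <= 2 * De + 2 * pA h.
  by have := leq_trunc_div De (pA h); set b := De %/ pA h; rewrite /pA; clear; lia.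
move: (_ %/ pm h) (_ %/ pA h) => a b; rewrite /pA /ps; move: (pN h) => N H1 H2 H3.
have : 64 * h * D <= 64 * h * q by rewrite leq_mul2l Dq orbT.
move: H1 H2 H3; clear; lia.
Qed.

Lemma orient_local (Q : W -> Prop) (f : rel W) c' : agr Q c c' ->
  agr (ball Q B f (oriT h)) (orient h B c) (orient h f c').
Proof. exact: ori_local. Qed.

End Orient.

(** * Colouring disjoint stars *)

Section SDR.
Variables (V C : finType) (S : V -> bool) (a : V -> C -> bool).

Definition meets u u' := (u' == u) || [exists c, a u c && a u' c].

Definition is_sdr (f : {ffun V -> option C}) :=
  [forall u, S u ==> oapp (a u) false (f u)] &&
  [forall u, forall u', [&& S u, S u' & f u == f u'] ==> (u == u')].

(** Greedy choice in any order: a colour of [u] that is already taken belongs to another node whose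
    list meets that of [u]. As [meets] counts [u] itself, one colour stays free. *)
Lemma sdr_exists : (forall u, S u -> num (fun u' => S u' && meets u u') <= num (a u)) ->
  exists f, is_sdr f.
Proof.
move=> H.
suff [f f1 f2] : exists2 f : V -> option C, forall u, u \in enum V -> S u -> oapp (a u) false (f u) &
    forall u u', u \in enum V -> u' \in enum V -> S u -> S u' -> f u = f u' -> u = u'.
  exists (finfun f); apply/andP; split; apply/forallP => u.
    by apply/implyP => Su; rewrite ffunE f1 ?mem_enum.
  apply/forallP => u'; apply/implyP => /and3P[Su Su']; rewrite !ffunE => /eqP E.
  by apply/eqP/f2; rewrite ?mem_enum.
elim: (enum V) (enum_uniq V) => [|u s IH] /=; first by exists (fun=> None).
case/andP => us /IH [f f1 f2].
case: (boolP (S u)) => Su; last first.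
  exists f => [v|v v']; rewrite !inE.
    by case/predU1P => [->|/f1 //]; rewrite (negbTE Su).
  by case/predU1P => [->|vs]; case/predU1P => [->|vs'] //; rewrite ?(negbTE Su) //; apply: f2.
pose bad c := a u c && [exists v, [&& v \in s, S v & f v == Some c]].
have lt : num bad < num (a u).
  apply: leq_trans (H u Su); rewrite (@numD1 _ _ u) ?Su /meets ?eqxx //.
  rewrite ltnS.
  pose g c := odflt u [pick v | [&& v \in s, S v & f v == Some c]].
  have gP c : bad c -> [/\ g c \in s, S (g c) & f (g c) = Some c].
    case/andP => ac /existsP[v vP]; rewrite /g; case: pickP => [w /and3P[? ? /eqP ?]|/(_ v)] //=.
    by rewrite vP.
  apply: (@num_inj _ _ _ _ g) => [x y /gP[_ _ fx] /gP[_ _ fy] E|c bc].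
    by apply: Some_inj; rewrite -fx -fy E.
  have [gs Sg fg] := gP c bc; rewrite Sg /= (memPn us) // andbT.
  apply/orP; right; apply/existsP; exists c; case/andP: bc => -> _.
  by have := f1 _ gs Sg; rewrite fg /= => ->.
have [c /andP[ac nb]] : exists c, a u c && ~~ bad c.
  apply: num_ex; move: lt; rewrite (numID (a u) bad).
  rewrite [num (fun w => _ && bad w)](_ : _ = num bad); first by lia.
  by apply: eq_num => c; rewrite /bad; case: (a u c).
have nf v : v \in s -> S v -> f v <> Some c.
  move=> vs Sv E; case/negP: nb; rewrite /bad ac /=; apply/existsP; exists v.
  by rewrite vs Sv E eqxx.
exists (fun v => if v == u then Some c else f v) => [v|v v']; rewrite !inE.
  by case: eqP => [-> //|_] /=; apply: f1.
case: eqP => [->|_]; case: eqP => [->|_] //=; last exact: f2.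
  by move=> _ vs _ Sv' E; case: (nf v').
by move=> vs _ Sv _ E; case: (nf v).
Qed.

End SDR.

Definition pcol (V : finType) (C : eqType) (g : rel V) (L : V -> V -> C -> bool)
    (col : V -> V -> option C) : Prop :=
  [/\ forall u v, g u v -> col u v = col v u,
      forall u v c, g u v -> col u v = Some c -> L u v c &
      forall u v w c, g u v -> g u w -> v != w -> col u v = Some c -> col u w <> Some c].

Section Star.
Variables (V C : finType) (g : rel V).
(* [S p u]: the edge [p u] is to be coloured by its endpoint [p] from the list
   [L p u]. *)
Variables (S : V -> V -> bool) (L : V -> V -> C -> bool) (col : V -> V -> option C).

Definition used u c := [exists w, g u w && (col u w == Some c)].
Definition avail p u c :=
  [&& L p u c, ~~ used p c & ~~ oapp (fun us : C -> bool => us c) false (nb g used p u)].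
Definition choice p : {ffun V -> option C} :=
  odflt [ffun=> None] [pick f | is_sdr (S p) (avail p) f].
Definition offer p : V -> option (option C) :=
  fun u => if S p u then Some (choice p u) else None.
Definition star u v : option C :=
  if offer u v is Some c then c else
  if nb g offer u v is Some o then odflt (col u v) (o u) else col u v.

Hypothesis g_sym : symmetric g.
Hypothesis Sg : forall p u, S p u -> g p u.
Hypothesis S_sdr : forall p u, S p u ->
  num (fun u' => S p u' && meets (avail p) u u') <= num (avail p u).

Lemma choiceP p : is_sdr (S p) (avail p) (choice p).
Proof.
rewrite /choice; case: pickP => [f //|/=] n.
by have [f sf] := sdr_exists (@S_sdr p); have := n f; rewrite sf.
Qed.

Hypothesis L_sym : forall u v, g u v -> L u v = L v u.
Hypothesis S_anti : forall p u, S p u -> ~~ S u p.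
Hypothesis S_new : forall p u, S p u -> col p u = None.
Hypothesis S_dis : forall p u p' c, S p u -> p' != p -> S p' u || S u p' ->
  L p u c -> L p' u c -> False.
Hypothesis col_ok : pcol g L col.

Lemma star_center p u : S p u ->
  exists2 c, star p u = Some c & avail p u c.
Proof.
move=> s; rewrite /star /offer s; have /andP[/forallP/(_ u)] := choiceP p.
by rewrite s /=; case: (choice p u) => //= c av _; exists c.
Qed.

Lemma star_leaf p u : S p u -> star u p = star p u.
Proof.
move=> s; rewrite /star /offer s (negbTE (S_anti s)) nbE ?s //.
by rewrite g_sym Sg.
Qed.

Lemma star_old u v : g u v -> ~~ S u v -> ~~ S v u -> star u v = col u v.
Proof. by move=> guv s1 s2; rewrite /star /offer (negbTE s1) nbE // (negbTE s2). Qed.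

Lemma usedP u v c : g u v -> col u v = Some c -> used u c.
Proof. by move=> guv E; apply/existsP; exists v; rewrite guv E eqxx. Qed.

Lemma star_new u v c : S u v || S v u -> star u v = Some c ->
  [/\ L u v c, ~~ used u c & ~~ used v c].
Proof.
case/orP => s; last rewrite (star_leaf s); have [c' -> /and3P[l n1]] := star_center s;
  rewrite nbE ?Sg //= => n2 [<-]; split=> //.
by rewrite -L_sym ?Sg.
Qed.

(** New colours avoid old ones through [used] at both endpoints. They differ within a star by the
    system of representatives, and between touching stars because [S_dis] makes the lists
    disjoint. *)
Lemma star_pcol : pcol g L star.
Proof.
have [c1 c2 c3] := col_ok; split.
- move=> u v guv; have gvu : g v u by rewrite g_sym.
  case: (boolP (S u v)) => s1; first by rewrite (star_leaf s1).
  case: (boolP (S v u)) => s2; first by rewrite (star_leaf s2).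
  by rewrite !star_old //; apply: c1.
- move=> u v c guv; case: (boolP (S u v || S v u)) => [s /(star_new s)[]//|].
  by rewrite negb_or => /andP[s1 s2]; rewrite star_old //; apply: c2.
- move=> u v w c guv guw vw Ev Ew.
  case: (boolP (S u v || S v u)) => sv; last first.
    move: (sv); rewrite negb_or => /andP[s1 s2]; move: Ev; rewrite star_old // => Ev.
    case: (boolP (S u w || S w u)) => sw.
      by have [_] := star_new sw Ew; rewrite (usedP guv Ev).
    move: sw; rewrite negb_or => /andP[s3 s4]; move: Ew; rewrite star_old //.
    exact: c3 Ev.
  have [Lv nu _] := star_new sv Ev.
  case: (boolP (S u w || S w u)) => sw; last first.
    move: (sw); rewrite negb_or => /andP[s3 s4]; move: Ew; rewrite star_old // => Ew.
    by move: nu; rewrite (usedP guw Ew).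
  have [Lw _ _] := star_new sw Ew.
  case: (boolP (S u v)) sv => [suv _|nsuv /= svu]; case: (boolP (S u w)) sw => [suw _|nsuw /= swu].
  + have /andP[_ /forallP/(_ v)/forallP/(_ w)] := choiceP u.
    move: Ev Ew; rewrite /star /offer suv suw /= => -> ->; rewrite eqxx /= => /eqP E.
    by rewrite E eqxx in vw.
  + by apply: (S_dis swu vw _ (c := c)); rewrite ?suv ?orbT // -L_sym // g_sym.
  + by apply: (S_dis svu (p' := w) _ _ (c := c)); rewrite ?suw ?orbT 1?eq_sym // -L_sym // g_sym.
  + by apply: (S_dis svu (p' := w) _ _ (c := c)); rewrite ?swu 1?eq_sym // -L_sym // g_sym.
Qed.

End Star.

Lemma star_local (V C : finType) (g g' : rel V) Q S S' (L L' : V -> V -> C -> bool) col col' :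
  agr Q S S' -> agr Q L L' -> agr Q col col' ->
  agr (ball Q g g' 3) (star g S L col) (star g' S' L' col').
Proof.
move=> aS aL ac.
have au : agr (ball Q g g' 1) (used g col) (used g' col').
  move=> v b; apply: functional_extensionality => c.
  by rewrite /used (agr_row b) (agr_base ac b).
have aav : agr (ball Q g g' 2) (avail g L col) (avail g' L' col').
  move=> v b; have b1 := ball_le (isT : 1 <= 2) b.
  apply: functional_extensionality => u; apply: functional_extensionality => c.
  by rewrite /avail (agr_nb au b) (au v b1) (agr_base aL b).
have ao : agr (ball Q g g' 2) (offer g S L col) (offer g' S' L' col').
  move=> v b; apply: functional_extensionality => u.
  by rewrite /offer /choice (aav v b) (agr_base aS b).
move=> v b; apply: functional_extensionality => u.
by rewrite /star (agr_nb ao b) (ao v (ball_le _ b)) // (agr_base ac b).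
Qed.

(** * List edge colouring of bipartite graphs with slack *)

Section Levels.
Variables (V : finType) (h : nat).
Notation Cc := 'I_(2 ^ h).

(* A state [(l, x)] of an edge restricts its list to the colours whose [l]
   leading bits are [x]. *)
Definition pf l (c : Cc) := c %/ 2 ^ (h - l).
Definition sz (t : nat * nat) (P : Cc -> bool) := num (fun c => P c && (pf t.1 c == t.2)).
(** The prefix [s] extends [t]. Two sets of colours given by prefixes are either nested in this way
    or disjoint. *)
Definition below (s t : nat * nat) := (t.1 <= s.1) && (s.2 %/ 2 ^ (s.1 - t.1) == t.2).
(** Beyond this list size [n], the orientation error [T] satisfies [8 * h * T <= (n / 2 + 2) + 8 * h
    * beta h <= n]. Twice the error is then at most [n / (4 * h)], the growth allowed per level. *)
Definition Mc := 4 + 16 * h * beta h.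

Local Notation W := (V * 'I_(2 ^ h).+1)%type.

Section Def.
Variables (M : rel V) (sd : V -> bool) (A : V -> V -> Cc -> bool).

Section Level.
Variables (j : nat) (st : V -> V -> nat * nat).

Definition cont u v := [&& M u v, (st u v).1 == j & Mc < sz (st u v) (A u v)].
(** Each node is split into one copy per prefix, so that the edges of all prefixes are oriented at
    once. The node simulates its copies. *)
Definition BW : rel W :=
  fun p q => [&& p.2 == q.2, cont p.1 q.1 & (st p.1 q.1).2 == p.2 :> nat].
(* The largest [b] with [4 h b < (h + j + 1) a], where [a] is the size of the list
   restricted to the first half of the colours. *)
Definition be u v : int :=
  ((((h + j.+1) * sz (j.+1, 2 * (st u v).2) (A u v) + (4 * h).-1) %/ (4 * h))%N%:Z - 1)%R.
Definition tol du dv := (du + dv) %/ (8 * h) + beta h.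
(** The endpoint [p] on the side [sd] is to own the edges of the first half, the other endpoint [q]
    those of the second. An edge then has [(load p - 1) + (dg q - load q - 1)] competitors in the
    first half, at most [be] iff [load p - load q <= be - dg q + 2]. Subtracting [tol] makes this
    hold without error for edges put into the first half and moves all error to the second. [du] is
    always the degree at the endpoint outside [sd]. *)
Definition eta u v du dv : int := (be u v - du%:Z + 2 - (tol du dv)%:Z)%R.
Definition cW (p q : W) : int :=
  oapp (fun dq => if sd p.1 then eta p.1 q.1 dq (dg BW p)
                  else (- eta p.1 q.1 (dg BW p) dq)%R) 0%R (nb BW (dg BW) p q).
Definition OW := orient h BW cW.
Definition red u v :=
  let o := OW (u, inord (st u v).2) (v, inord (st u v).2) in if sd u then o else ~~ o.
Definition level u v : nat * nat :=
  if cont u v then (j.+1, 2 * (st u v).2 + ~~ red u v) else st u v.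
End Level.

Definition levels := iteri h level (fun _ _ => (0, 0)).

(** Only edges with the same or a longer prefix compete; those with a shorter one are coloured
    later. *)
Definition cn (st : V -> V -> nat * nat) u v :=
  num (fun w => [&& M u w, w != v & below (st u w) (st u v)]).

Hypothesis h0 : 0 < h.
Hypothesis M_sym : symmetric M.
Hypothesis M_sd : forall u v, M u v -> sd u != sd v.
Hypothesis A_sym : forall u v, M u v -> A u v = A v u.
Hypothesis A_big : forall u v, M u v -> 4 * ((dg M u).-1 + (dg M v).-1) < num (A u v).

(** The last clause bounds the ratio of competitors to list size by [(h + l) / (4 * h)] at level
    [l]. It starts at 1/4, the slack assumed in [A_big], and never exceeds 1/2. *)
Definition sinv j (st : V -> V -> nat * nat) : Prop :=
  forall u v, M u v -> [/\ st u v = st v u,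
    (st u v).1 <= j, (st u v).2 < 2 ^ (st u v).1,
    (st u v).1 < j -> sz (st u v) (A u v) <= Mc &
    4 * h * (cn st u v + cn st v u) < (h + (st u v).1) * sz (st u v) (A u v)].

Lemma numW (F : W -> bool) x : (forall y, F y -> y.2 = x) -> num F = num (fun w => F (w, x)).
Proof.
move=> H; apply/eqP; rewrite eqn_leq; apply/andP; split.
  apply: (@num_inj _ _ _ _ fst) => [[a b] [a' b'] /H/= -> /H/= -> /= -> //|[a b] F1 /=].
  by rewrite -(H _ F1).
by apply: (@num_inj _ _ _ _ (fun w => (w, x))) => [a b _ _ [] //|a].
Qed.

Lemma sz_split l x (P : Cc -> bool) : l < h ->
  sz (l, x) P = sz (l.+1, 2 * x) P + sz (l.+1, 2 * x + 1) P.
Proof.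
move=> lh; rewrite /sz /= -numU_disj => [|c /andP[_ /eqP ->]]; last first.
  by rewrite negb_and; apply/orP; right; lia.
apply: eq_num => c; rewrite -andb_orr; congr (_ && _).
have -> : pf l c = pf l.+1 c %/ 2.
  by rewrite /pf -divnMA mulnC -expnS subnSK.
move: (pf l.+1 c) => p; lia.
Qed.

Lemma sz_le t P : sz t P <= num P.
Proof. by apply: num_sub => c /andP[]. Qed.

Lemma belowP s t : s.1 = t.1 -> below s t = (s == t).
Proof.
case: s t => [a b] [a' b'] /= ->.
by rewrite /below leqnn subnn expn0 divn1 xpair_eqE eqxx.
Qed.

Lemma num_Cc (P : Cc -> bool) : num P <= 2 ^ h.
Proof. by rewrite -[X in _ <= X]card_ord; apply: max_card. Qed.

Section Step.
Variables (j : nat) (st : V -> V -> nat * nat).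
Hypothesis jh : j < h.
Hypothesis inv : sinv j st.
Let B := BW j st.
Let O := OW j st.

Lemma cont_M u v : cont j st u v -> M u v.
Proof. by case/and3P. Qed.

Lemma cont_sym u v : cont j st u v = cont j st v u.
Proof.
rewrite /cont M_sym; case: (boolP (M v u)) => //= m.
by rewrite (A_sym m); have [-> _ _ _ _] := inv m.
Qed.

Lemma BW_sym : symmetric B.
Proof.
move=> [u x] [v y]; rewrite /B /BW /= eq_sym cont_sym; case: eqP => //= ->.
case: (boolP (cont j st v u)) => //= /cont_M m.
by have [-> _ _ _ _] := inv m.
Qed.

Lemma BW_irr : irreflexive B.
Proof.
move=> [u x]; rewrite /B /BW /=; apply/negP => /and3P[_ /cont_M /M_sd].
by rewrite eqxx.
Qed.

Lemma cont_pre u v : cont j st u v -> (inord (st u v).2 : 'I_(2 ^ h).+1) = (st u v).2 :> nat.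
Proof.
case/and3P => m /eqP l _; have [_ _ + _ _] := inv m; rewrite l => lt.
by rewrite inordK // ltnS ltnW //; apply: leq_trans lt _; rewrite leq_exp2l // ltnW.
Qed.

Lemma BW_cont u v : cont j st u v -> B (u, inord (st u v).2) (v, inord (st u v).2).
Proof. by move=> c; rewrite /B /BW /= eqxx c cont_pre /=. Qed.

Lemma dg_BW u v : cont j st u v ->
  dg B (u, inord (st u v).2) = num (fun w => cont j st u w && (st u w == st u v)).
Proof.
move=> c; rewrite /dg (@numW _ (inord (st u v).2)); last by move=> y /and3P[/eqP].
apply: eq_num => w; rewrite /B /BW /= eqxx cont_pre //=.
case: (boolP (cont j st u w)) => //= /and3P[_ /eqP E _]; case/and3P: c => _ /eqP E' _.
by case: (st u w) (st u v) E E' => [a b] [a' b'] /= -> ->; rewrite xpair_eqE eqxx.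
Qed.

Lemma dg_cn u v : cont j st u v -> dg B (u, inord (st u v).2) <= (cn st u v).+1.
Proof.
move=> c; rewrite dg_BW // (@numD1 _ _ v) ?c ?eqxx // ltnS; apply: num_sub => w.
case/andP => /andP[/and3P[-> /eqP E _] /eqP ->] ->; rewrite /= belowP //.
Qed.

Lemma dg_le p : dg B p <= 2 ^ h.
Proof.
case: p => u x; case: (posnP (dg B (u, x))) => [-> //|/num_ex[[v y]]].
rewrite /B /BW /= => /and3P[_ c /eqP E].
have -> : x = inord (st u v).2 by apply: ord_inj; rewrite cont_pre.
apply: leq_trans (dg_cn c) _; have [_ _ _ _ lt] := inv (cont_M c).
case/and3P: c => _ /eqP l _; move: lt; rewrite l.
have := sz_le (st u v) (A u v); have := num_Cc (A u v); move: (sz _ _) (num _) => a b; nia.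
Qed.

Lemma be_sym u v : M u v -> be j st u v = be j st v u.
Proof. by move=> m; rewrite /be A_sym //; have [-> _ _ _ _] := inv m. Qed.

Lemma cWE p q : B p q -> cW j st p q =
  if sd p.1 then eta j st p.1 q.1 (dg B q) (dg B p)
  else (- eta j st p.1 q.1 (dg B p) (dg B q))%R.
Proof. by move=> b; rewrite /cW nbE. Qed.

Lemma cW_anti p q : B p q -> cW j st q p = (- cW j st p q)%R.
Proof.
move=> b; have b' : B q p by rewrite BW_sym.
have m : M p.1 q.1 by case/and3P: b => _ /cont_M.
rewrite !cWE // /eta (be_sym m); have := M_sd m.
by case: (sd p.1); case: (sd q.1) => // _; rewrite ?GRing.opprK.
Qed.

Let ok := orient_ok h0 BW_sym BW_irr cW_anti dg_le.

Lemma OW_N p q : B p q -> O q p = ~~ O p q.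
Proof.
case: ok => w c _ b; have := c _ _ b; have := w p q; rewrite -!/(OW j st) -!/O.
by case: (O p q) => [/(_ isT)/andP[_ /negbTE ->]|_] //= ->.
Qed.

Lemma red_sym u v : cont j st u v -> red j st u v = red j st v u.
Proof.
move=> c; have m := cont_M c; have [E _ _ _ _] := inv m.
rewrite /red -E -/O (OW_N (BW_cont c)); have := M_sd m.
by case: (sd u); case: (sd v) => //= _; rewrite negbK.
Qed.

Lemma level_sym u v : M u v -> level j st u v = level j st v u.
Proof.
move=> m; rewrite /level (cont_sym v u); case: (boolP (cont j st u v)) => c; last by have [] := inv m.
by rewrite red_sym //; have [-> _ _ _ _] := inv m.
Qed.

Lemma load_OW u v : cont j st u v ->
  load O (u, inord (st u v).2) =
  num (fun w => [&& cont j st u w, st u w == st u v & O (u, inord (st u w).2) (w, inord (st u w).2)]).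
Proof.
move=> c; have [w _ _] := ok; rewrite /load (@numW _ (inord (st u v).2)); last first.
  by move=> y /w/andP[/and3P[/eqP]].
apply: eq_num => z; case: (boolP (cont j st u z && (st u z == st u v))) => [/andP[-> /eqP ->]|n].
  by rewrite eqxx.
rewrite andbA (negbTE n); apply/negP => /w/andP[/and3P[_ /= cz /eqP E] _].
case/negP: n; rewrite cz /=; case/and3P: (cz) => _ /eqP Ez _; case/and3P: (c) => _ /eqP Ev _.
move: E; rewrite cont_pre //; move: Ez Ev; case: (st u z) (st u v) => [a b] [a' b'] /= -> -> ->.
by rewrite eqxx.
Qed.

Lemma below_up u w t : M u w -> t.1 <= j -> below (level j st u w) t = below (st u w) t.
Proof.
move=> m tj; rewrite /level; case: (boolP (cont j st u w)) => // /and3P[_ /eqP E _].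
rewrite /below /= E tj (leqW tj) /= subSn // expnS divnMA.
by congr (_ %/ _ == _); case: (red _ _ _ _); lia.
Qed.

(** Edges that stopped earlier have shorter prefixes and drop out. What remains are the edges that
    [a] owns or those it does not, according to the side of [a] and the half chosen, without the
    edge itself. *)
Lemma cn_cont a b (p := (a, inord (st a b).2)) : cont j st a b ->
  cn (level j st) a b <= (if sd a == red j st a b then load O p else dg B p - load O p).-1.
Proof.
move=> c; set F := fun w => [&& cont j st a w, st a w == st a b & red j st a w == red j st a b].
have -> : (if sd a == red j st a b then load O p else dg B p - load O p) = num F.
  rewrite /p dg_BW // load_OW //; set G := fun w => cont j st a w && (st a w == st a b).
  pose H w := O (a, inord (st a w).2) (w, inord (st a w).2).
  have -> : num (fun w => [&& cont j st a w, st a w == st a b & H w]) = num (fun w => G w && H w).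
    by apply: eq_num => w; rewrite /G andbA.
  rewrite (numID G H) addKn -/(H b) /F.
  case: ifP => e; apply: eq_num => w; rewrite /G -andbA; congr (_ && _); congr (_ && _);
    move: e; rewrite /red -/O -!/(H _); case: (sd a); case: (H w); case: (H b) => //=.
rewrite (@numD1 _ F b) /=; last by rewrite /F c !eqxx.
apply: num_sub => w /and3P[m -> bl]; rewrite andbT /F.
have [_ lw _ _ _] := inv m; have Eb : level j st a b = (j.+1, 2 * (st a b).2 + ~~ red j st a b).
  by rewrite /level c.
have cw : cont j st a w.
  apply: contraLR bl => nc; rewrite Eb /below /level (negbTE nc) /=.
  by rewrite leqNgt ltnS lw.
move: bl; rewrite cw /= belowP ?Eb /level ?cw //= => /eqP[E].
case/and3P: cw => _ /eqP l1 _; case/and3P: c => _ /eqP l2 _.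
move: E l1 l2; case: (st a w) (st a b) => [? ?] [? ?] /=.
by case: (red _ _ _ _); case: (red _ _ _ _) => /= E -> ->; rewrite xpair_eqE !eqxx /=; lia.
Qed.

Lemma load_dg p : load O p <= dg B p.
Proof. by have [w _ _] := ok; apply: num_sub => y /w/andP[]. Qed.

Lemma load_lt p q : B p q -> ~~ O p q -> load O p < dg B p.
Proof.
have [w _ _] := ok; move=> b no; rewrite /dg (@numD1 _ _ q) // ltnS; apply: num_sub => y o.
have /andP[-> _] := w _ _ o; apply: contraNneq no => <- //.
Qed.

(** An edge in the second half: its competitors are at most all [c1 + c2] minus the [z + 1] assigned
    to the first half, plus the error [2 * T]. As [8 * h * T <= n], passing from [h + j] to
    [h + j.+1] pays for the error. *)
Lemma split_arith (n A0 A1 b du dv xu xv cu cv T c1 c2 : nat) (z : int) :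
  4 + 16 * h * b < n -> n = A0 + A1 -> 4 * h * (c1 + c2) < (h + j) * n ->
  du <= c1.+1 -> dv <= c2.+1 -> xu <= du -> xv <= dv ->
  8 * h * T <= du + dv + 8 * h * b ->
  (((h + j.+1) * A0)%N%:Z <= (4 * h)%N%:Z * (z + 1))%R ->
  (xu%:Z - xv%:Z <= 2 * T%:Z - z + du%:Z - 2)%R -> 0 < xu -> xv < dv ->
  cu <= xu.-1 -> cv <= (dv - xv).-1 ->
  4 * h * (cu + cv) < (h + j.+1) * A1.
Proof.
move=> nb nE l4 du1 dv1 xud xvd T1 b2 v xu0 xv0 cu1 cv1.
have e1 : ((cu + cv)%N%:Z <= (c1 + c2)%N%:Z - (z + 1) + 2 * T%:Z - 1)%R by lia.
have e2 : ((4 * h)%N%:Z * (cu + cv)%N%:Z <= (4 * h)%N%:Z * ((c1 + c2)%N%:Z - (z + 1) + 2 * T%:Z - 1))%R.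
  exact: Num.Theory.ler_wpM2l.
have e3 : 2 * (c1 + c2) <= n by move: l4 jh; clear; nia.
have e4 : 8 * h * T <= n by move: T1 nb du1 dv1 e3; clear; lia.
move: e2 b2 l4 e4; rewrite nE; clear; lia.
Qed.

Lemma sinv_cont u v : cont j st u v -> sd v ->
  4 * h * (cn (level j st) u v + cn (level j st) v u) <
    (h + j.+1) * sz (level j st u v) (A u v).
Proof.
move=> c sv; have m := cont_M c; have c' : cont j st v u by rewrite -cont_sym.
have [Es _ _ _ l4] := inv m; have /negbTE su : ~~ sd u by have := M_sd m; rewrite sv; case: (sd u).
have -> : level j st u v = (j.+1, 2 * (st u v).2 + ~~ red j st u v) by rewrite /level c.
have := cn_cont c; have := cn_cont c'; rewrite sv su -Es -(red_sym c).
move: (cn (level j st) u v) (cn (level j st) v u) => cu cv.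
set x := inord _; set n := sz (st u v) (A u v) in l4.
have : dg B (u, x) <= (cn st u v).+1 by apply: dg_cn.
have : dg B (v, x) <= (cn st v u).+1 by rewrite /x Es; apply: dg_cn.
have := load_dg (u, x); have := load_dg (v, x).
have [lj ln] : (st u v).1 = j /\ Mc < n by case/and3P: c => _ /eqP.
have nE : n = sz (j.+1, 2 * (st u v).2) (A u v) + sz (j.+1, 2 * (st u v).2 + 1) (A u v).
  by rewrite -sz_split // -lj /n; case: (st u v).
have Buv := BW_cont c; have Bvu : B (v, x) (u, x) by rewrite BW_sym.
have [wO cO vO] := ok; rewrite -/(OW j st) -/O in wO cO vO.
have h8 : 0 < 8 * h by lia.
have h4 : 0 < 4 * h by lia.
have tolP (du dv : nat) (z : int) : ((8 * h)%N%:Z * z <= (du + dv + 8 * h * beta h)%N%:Z)%R ->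
   (z <= (tol du dv)%:Z)%R.
  have := ltn_ceil (du + dv) h8; rewrite /tol; move: (_ %/ _) (beta h) => a b; nia.
have tol_le : 8 * h * tol (dg B (u, x)) (dg B (v, x)) <= dg B (u, x) + dg B (v, x) + 8 * h * beta h.
  by rewrite /tol mulnDr leq_add2r mulnC leq_trunc_div.
have tolC du dv : tol du dv = tol dv du by rewrite /tol (addnC du).
have [b1 b2] : ((4 * h)%N%:Z * be j st u v < ((h + j.+1) * sz (j.+1, 2 * (st u v).2) (A u v))%N%:Z)%R /\
   (((h + j.+1) * sz (j.+1, 2 * (st u v).2) (A u v))%N%:Z <= (4 * h)%N%:Z * (be j st u v + 1))%R.
  rewrite /be; move: (_ * sz _ _) => X; have := ltn_ceil (X + (4 * h).-1) h4.
  by have := leq_trunc_div (X + (4 * h).-1) (4 * h); move: (_ %/ _) => q; split; nia.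
have := vO (u, x) (v, x); have := vO (v, x) (u, x); rewrite !cWE //= sv su /eta -(be_sym m).
rewrite (OW_N Buv) -/x /red -/O su -/x.
move: (@load_lt (u, x) (v, x)) (@load_lt (v, x) (u, x)); rewrite (OW_N Buv) -/x => /(_ Buv) lt1 /(_ Bvu).
have pos1 : O (u, x) (v, x) -> 0 < load O (u, x) by apply: numP.
have pos2 : O (v, x) (u, x) -> 0 < load O (v, x) by apply: numP.
move: pos1 pos2 lt1 l4; rewrite (OW_N Buv) lj -/x; case: (O (u, x) (v, x)) => /= pos1 pos2 lt1 l4 lt2.
  (* The owner [u] lies outside [sd], so this is the second half, where the whole error falls. *)
  move=> _ /(_ isT)/tolP v1 du1 dv1 dl1 dl2 cv1 cu1.
  apply: (split_arith ln nE l4 dl2 dl1 dv1 du1 tol_le b2) => //.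
  - by move: v1; lia.
  - exact: pos1.
  - exact: lt2.
(* In the first half the shift in [eta] cancels the error, and the competitors number at most
   [be]. *)
move=> /(_ isT); rewrite (tolC (dg B (u, x))) => /tolP v1 _ du1 dv1 dl1 dl2 cv1 cu1.
have {}cu1 : ((cu + cv)%N%:Z <= be j st u v)%R.
  by have := lt1 isT; have := pos2 isT; move: v1; lia.
rewrite addn0 -ltz_nat; apply: Order.POrderTheory.le_lt_trans b1; rewrite PoszM.
by apply: Num.Theory.ler_wpM2l.
Qed.

Lemma sinv_level : sinv j.+1 (level j st).
Proof.
move=> u v m; have m' : M v u by rewrite M_sym.
have [Es l1 l2 l3 l4] := inv m.
case: (boolP (cont j st u v)) => c; last first.
  have E : level j st u v = st u v by rewrite /level (negbTE c).
  have E' : level j st v u = st u v by rewrite -level_sym.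
  rewrite !E !E'; split=> //; first exact: leqW.
    rewrite ltnS leq_eqVlt => /orP[/eqP lj|/l3 //].
    by move: c; rewrite /cont m lj eqxx /= -leqNgt.
  have eqc a b : M a b -> level j st a b = st u v -> st a b = st u v ->
      cn (level j st) a b = cn st a b.
    move=> mab L1 L2; apply: eq_num => w; rewrite L1 L2.
    case: (boolP (M a w)) => //= maw; rewrite below_up //.
  by rewrite !eqc.
have lE : level j st u v = (j.+1, 2 * (st u v).2 + ~~ red j st u v) by rewrite /level c.
split; rewrite ?lE ?ltnn //=; first by rewrite -lE; apply: level_sym.
  by rewrite expnS; move: l2; case/and3P: (c) => _ /eqP -> _; case: (red _ _ _ _) => /=; lia.
rewrite -lE; have [sv|sv] := boolP (sd v); first exact: sinv_cont.
rewrite addnC level_sym // A_sym //; apply: sinv_cont; first by rewrite -cont_sym.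
by have := M_sd m; rewrite (negbTE sv); case: (sd u).
Qed.

End Step.

Lemma sinv0 : sinv 0 (fun _ _ => (0, 0)).
Proof.
move=> u v m; split=> //; rewrite addn0 [4 * h]mulnC -mulnA ltn_pmul2l //.
have -> : sz (0, 0) (A u v) = num (A u v).
  by apply: eq_num => c; rewrite /= /pf subn0 divn_small // andbT.
apply: leq_ltn_trans (A_big m); rewrite leq_mul2l /=; apply: leq_add.
  by rewrite /dg (numD1 m) /=; apply: num_sub => w /and3P[-> ->].
have m' : M v u by rewrite M_sym.
by rewrite /dg (numD1 m') /=; apply: num_sub => w /and3P[-> ->].
Qed.

Lemma sinv_levels : sinv h levels.
Proof.
suff H i : i <= h -> sinv i (iteri i level (fun _ _ => (0, 0))) by apply: H.
elim: i => [|i IH] le; first exact: sinv0.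
exact/(sinv_level le)/IH/ltnW.
Qed.

End Def.

Lemma level_local (M M' : rel V) Q sd sd' A A' j st st' :
  agr Q sd sd' -> agr Q A A' -> agr Q st st' ->
  agr (ball Q M M' (oriT h).+2) (level M sd A j st) (level M' sd' A' j st').
Proof.
move=> asd aA ast.
have acont : agr (ball Q M M' 1) (cont M A j st) (cont M' A' j st').
  move=> v b; apply: functional_extensionality => w.
  by rewrite /cont (agr_row b) (agr_base aA b) (agr_base ast b).
have aB (p : W) : ball Q M M' 1 p.1 -> BW M A j st p = BW M' A' j st' p.
  move=> b; apply: functional_extensionality => q.
  by rewrite /BW (acont _ b) (agr_base ast b).
have subB (p q : W) : BW M A j st p q -> M p.1 q.1 by case/and3P => _ /and3P[].
have sim s (p : W) : ball Q M M' (1 + s) p.1 ->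
    ball (fun p : W => ball Q M M' 1 p.1) (BW M A j st) (BW M' A' j st') s p.
  by move=> /ballD; apply: (@ball_sim _ _ _ _ fst).
have adg : agr (fun p : W => ball Q M M' 1 p.1) (dg (BW M A j st)) (dg (BW M' A' j st')).
  by move=> p b; rewrite /dg (aB p b).
have acW : agr (fun p : W => ball Q M M' 2 p.1) (cW M sd A j st) (cW M' sd' A' j st').
  move=> p b; apply: functional_extensionality => q; rewrite /cW /eta /be.
  rewrite (agr_nb adg (sim 1 p b)) (agr_base asd b) (agr_base aA b) (agr_base ast b).
  by rewrite (adg p (ball_le _ b)).
move=> v b; apply: functional_extensionality => w; rewrite /level /red /OW.
rewrite (acont v (ball_le _ b)) // (agr_base ast b) (agr_base asd b).
have b2 x : ball (fun p : W => ball Q M M' 2 p.1) (BW M A j st) (BW M' A' j st') (oriT h) (v, x).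
  apply: (@ball_sim _ M M' _ fst _ _ (ball Q M M' 2)) => //.
    by move=> p bp; apply: aB; apply: ball_le bp.
  by apply/ballD; rewrite add2n.
by rewrite (orient_local acW (b2 _)).
Qed.

Lemma levels_local (M M' : rel V) Q sd sd' A A' :
  agr Q sd sd' -> agr Q A A' ->
  agr (ball Q M M' (h * (oriT h).+2)) (levels M sd A) (levels M' sd' A').
Proof.
move=> asd aA; apply: agr_iter => // i t T T' aT; apply: agrD.
by apply: level_local => //; apply: agr_base.
Qed.

(** * Colouring from the restricted lists *)

Section Finish.
Variables (M : rel V) (sd : V -> bool) (A : V -> V -> Cc -> bool).

Section Time.
Variable st : V -> V -> nat * nat.
Definition ri u v := rk (fun w => M u w && (st u w == st u v)) v.
(** The endpoint outside [sd] numbers its edges of equal state. Edges with the same state and time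
    therefore form disjoint stars centred in [sd]; edges with the same time and different states
    have the same level, hence disjoint lists. *)
Definition ix u v :=
  if sd u then oapp (fun r : V -> nat => r u) 0 (nb M ri u v) else ri u v.
Definition tm u v := (h - (st u v).1) * Mc + ix u v.
Definition AL u v c := A u v c && (pf (st u v).1 c == (st u v).2).
Definition fstep i (col : V -> V -> option Cc) :=
  star M (fun v u => [&& sd v, M v u & tm v u == i]) AL col.
End Time.

(* Edges whose lists were restricted most are coloured first. *)
Definition sl := iteri (h.+1 * Mc) (fstep (levels M sd A)) (fun _ _ => None).

Hypothesis h0 : 0 < h.
Hypothesis M_sym : symmetric M.
Hypothesis M_sd : forall u v, M u v -> sd u != sd v.
Hypothesis A_sym : forall u v, M u v -> A u v = A v u.
Hypothesis A_big : forall u v, M u v -> 4 * ((dg M u).-1 + (dg M v).-1) < num (A u v).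

Let st := levels M sd A.

Lemma inv_levels : sinv M A h st.
Proof. exact: sinv_levels. Qed.

Lemma szMc u v : M u v -> sz (st u v) (A u v) <= Mc.
Proof.
move=> /inv_levels[_ + _ + _]; rewrite leq_eqVlt => /orP[/eqP E _|lt]; last exact.
apply: (@leq_trans 1); last by rewrite /Mc.
have <- : num (fun _ : unit => true) = 1 by rewrite -card_unit; apply: eq_card.
apply: (@num_inj _ _ _ _ (fun=> tt)) => // c c' /andP[_ /eqP Ec] /andP[_ /eqP Ec'] _.
by move: Ec Ec'; rewrite /pf E subnn expn0 !divn1 => Ec Ec'; apply: ord_inj; rewrite Ec.
Qed.

Lemma stC u v : M u v -> st u v = st v u.
Proof. by case/inv_levels. Qed.

Lemma cn_lt u v : M u v -> cn M st u v + cn M st v u < sz (st u v) (A u v).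
Proof. by case/inv_levels => _ l1 _ _ l; nia. Qed.

Lemma ixU u v : M u v -> ~~ sd u -> ix st u v = ri st u v /\ ix st v u = ri st u v.
Proof.
move=> m su; rewrite /ix (negbTE su); have := M_sd m; rewrite (negbTE su) /=.
by case: (sd v) => // _; rewrite nbE // M_sym.
Qed.

Lemma ix_sym u v : M u v -> ix st u v = ix st v u.
Proof.
move=> m; have m' : M v u by rewrite M_sym.
case: (boolP (sd u)) => su; last by have [-> ->] := ixU m su.
by have [|-> ->] := ixU m'; first by have := M_sd m; rewrite su.
Qed.

Lemma ix_lt u v : M u v -> ix st u v < Mc.
Proof.
have H a b : M a b -> ri st a b < Mc.
  move=> m; apply: leq_trans (szMc m); apply: leq_ltn_trans (cn_lt m).
  apply: leq_trans (leq_addr _ _); rewrite -ltnS; apply: leq_trans (rk_lt _) _; first by rewrite m eqxx.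
  rewrite (@numD1 _ _ b) ?m ?eqxx // ltnS; apply: num_sub => w /andP[/andP[-> /eqP ->] ->].
  by rewrite belowP ?eqxx.
move=> m; have m' : M v u by rewrite M_sym.
case: (boolP (sd u)) => su; last by have [-> _] := ixU m su; apply: H.
by have [|_ ->] := ixU m'; [have := M_sd m; rewrite su | apply: H].
Qed.

Lemma tm_sym u v : M u v -> tm st u v = tm st v u.
Proof. by move=> m; rewrite /tm stC // ix_sym. Qed.

Lemma tm_inj u v u' v' : M u v -> M u' v' -> tm st u v = tm st u' v' ->
  (st u v).1 = (st u' v').1 /\ ix st u v = ix st u' v'.
Proof.
move=> m m' E; have := ix_lt m; have := ix_lt m'.
have [_ l1 _ _ _] := inv_levels m; have [_ l2 _ _ _] := inv_levels m'.
move: E; rewrite /tm; move: (ix _ _ _) (ix _ _ _) (Mc) => a b K E la lb.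
have E' : h - (st u v).1 = h - (st u' v').1 by nia.
by split; [lia | move: E; rewrite E'; lia].
Qed.

Lemma tm_lev u v u' v' : M u v -> M u' v' -> tm st u v <= tm st u' v' ->
  (st u' v').1 <= (st u v).1.
Proof.
move=> m m' E; have := ix_lt m; have := ix_lt m'.
have [_ l1 _ _ _] := inv_levels m; have [_ l2 _ _ _] := inv_levels m'.
move: E; rewrite /tm; move: (ix _ _ _) (ix _ _ _) (Mc) => a b K E la lb; nia.
Qed.

Lemma AL_sym u v : M u v -> AL st u v = AL st v u.
Proof. by move=> m; rewrite /AL stC // A_sym. Qed.

Lemma AL_below a b a' b' c : AL st a b c -> AL st a' b' c ->
  (st a' b').1 <= (st a b).1 -> (st a b).1 <= h -> below (st a b) (st a' b').
Proof.
case/andP => _ /eqP E1 /andP[_ /eqP E2] le leh.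
rewrite /below le /= -E1 -E2 /pf -divnMA -expnD.
have -> // : h - (st a b).1 + ((st a b).1 - (st a' b').1) = h - (st a' b').1 by lia.
Qed.

Definition finv i (col : V -> V -> option Cc) : Prop :=
  pcol M (AL st) col /\ forall u v, M u v -> isSome (col u v) = (tm st u v < i).

Lemma used_num (col : V -> V -> option Cc) p (P : Cc -> bool) (R : V -> bool) :
  (forall w c, M p w -> col p w = Some c -> P c -> R w) ->
  num (fun c => P c && used M col p c) <= num R.
Proof.
move=> H; pose g c := odflt p [pick w | M p w && (col p w == Some c)].
have gP c : used M col p c -> M p (g c) /\ col p (g c) = Some c.
  case/existsP => w Hw; rewrite /g; case: pickP => [z /andP[? /eqP ?] //|/(_ w)].
  by rewrite Hw.
apply: (@num_inj _ _ _ _ g) => [c c' /andP[_ /gP[_ E]] /andP[_ /gP[_ E']] Eg|c].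
  by apply: Some_inj; rewrite -E -E' Eg.
by case/andP => Pc /gP[m E]; apply: H E Pc.
Qed.

(** Any coloured neighbouring edge whose colour lies in the list of [p u], and any edge of the same
    star whose list meets it, has a prefix at least as long and thus [below]. All of them are
    counted by [cn], so [cn_lt] supplies the condition for distinct representatives. *)
Lemma finv_step i col : finv i col -> finv i.+1 (fstep st i col).
Proof.
case=> pc ic; have [c1 c2 c3] := pc; rewrite /fstep.
set S := fun v u => _.
have Sg p u : S p u -> M p u by case/and3P.
have S_anti p u : S p u -> ~~ S u p.
  by case/and3P => sp m _; have := M_sd m; rewrite /S sp; case: (sd u).
have S_new p u : S p u -> col p u = None.
  by case/and3P => _ m /eqP E; have := ic _ _ m; rewrite E ltnn; case: (col p u).
have S_dis p u p' c : S p u -> p' != p -> S p' u || S u p' -> AL st p u c -> AL st p' u c -> False.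
  case/and3P => sp m /eqP E ne /orP[/and3P[sp' m' /eqP E']|/and3P[su _ _]]; last first.
    by have := M_sd m; rewrite sp su.
  move=> a1 a2; have [El Ei] := tm_inj m m' (etrans E (esym E')).
  have Es : st p u = st p' u.
    apply/eqP; rewrite -belowP //; apply: AL_below a1 a2 _ _; first by rewrite El.
    by have [] := inv_levels m.
  have su : ~~ sd u by have := M_sd m; rewrite sp.
  have mu : M u p by rewrite M_sym. have mu' : M u p' by rewrite M_sym.
  move: Ei; have [_ ->] := ixU mu su; have [_ ->] := ixU mu' su.
  have F : (fun w => M u w && (st u w == st u p')) = (fun w => M u w && (st u w == st u p)).
    by apply: functional_extensionality => w; rewrite -(stC m) -(stC m') Es.
  rewrite /ri F => /rk_inj H; case/eqP: ne; apply/esym/H; rewrite ?mu ?mu' ?eqxx //.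
  by rewrite -(stC m) -(stC m') Es eqxx.
have S_sdr p u : S p u ->
    num (fun u' => S p u' && meets (avail M (AL st) col p) u u') <= num (avail M (AL st) col p u).
  move=> s; have m := Sg _ _ s; have mu : M u p by rewrite M_sym.
  case/and3P: (s) => sp _ /eqP E; have := cn_lt m.
  have -> : sz (st p u) (A p u) = num (AL st p u) by [].
  rewrite (numID (AL st p u) (avail M (AL st) col p u)).
  have -> : num (fun w => AL st p u w && avail M (AL st) col p u w) = num (avail M (AL st) col p u).
    by apply: eq_num => c; rewrite /avail; case: (AL st p u c).
  have le1 : num (fun c => AL st p u c && ~~ avail M (AL st) col p u c) <=
      num (fun c => AL st p u c && used M col p c) + num (fun c => AL st p u c && used M col u c).
    apply: leq_trans (numU _ _); apply: num_sub => c; rewrite /avail nbE //=.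
    by case: (AL st p u c) => //=; rewrite negb_and !negbK.
  have lev_le a b c : M a b -> col a b = Some c -> AL st p u c -> below (st a b) (st p u).
    move=> mab Ec al; apply: AL_below al _ _; first exact: c2 Ec.
      by apply: tm_lev => //; rewrite E; have := ic _ _ mab; rewrite Ec /= => /esym/ltnW.
    by have [] := inv_levels mab.
  have le2 : num (fun c => AL st p u c && used M col u c) <= cn M st u p.
    apply: used_num => w c mw Ec al; rewrite mw -(stC m) (lev_le _ _ _ mw Ec al) andbT.
    by apply: contraTneq isT => Ew; move: Ec; rewrite Ew -c1 // (S_new _ _ s).
  have le3 : num (fun c => AL st p u c && used M col p c) + num (fun u' => S p u' && meets (avail M (AL st) col p) u u')
      <= (cn M st p u).+1.
    rewrite (@numD1 _ (fun u' => S p u' && _) u); last by rewrite s /meets eqxx.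
    rewrite addnS ltnS.
    apply: (@leq_trans (num (fun w => [&& M p w, w != u, below (st p w) (st p u) & isSome (col p w)])
        + num (fun w => [&& M p w, w != u, below (st p w) (st p u) & ~~ isSome (col p w)]))); last first.
      rewrite /cn (numID (fun w => [&& M p w, w != u & below _ _]) (fun w => isSome (col p w))).
      by apply: leq_add; apply: num_sub => w /and4P[-> -> -> ->].
    apply: leq_add.
      apply: used_num => w c mw Ec al; rewrite mw (lev_le _ _ _ mw Ec al) Ec andbT.
      by apply: contraTneq isT => Ew; move: Ec; rewrite Ew (S_new _ _ s).
    apply: num_sub => w /andP[/andP[sw me] ne]; rewrite (Sg _ _ sw) ne (S_new _ _ sw) andbT /=.
    case/orP: me => [/eqP Ew|/existsP[c /andP[/and3P[a1 _ _] /and3P[a2 _ _]]]].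
      by rewrite Ew eqxx in ne.
    have mw := Sg _ _ sw; case/and3P: sw => _ _ /eqP Ew.
    have [El _] := tm_inj m mw (etrans E (esym Ew)).
    by apply: AL_below a2 a1 _ _; [rewrite El | have [] := inv_levels mw].
  by move: le1 le2 le3; lia.
split; first by apply: star_pcol => //; exact: AL_sym.
move=> u v m; have mu : M v u by rewrite M_sym.
rewrite ltnS leq_eqVlt; case: (boolP (S u v || S v u)) => [/orP[] s|].
- by have [c -> _] := star_center S_sdr s; case/and3P: s => _ _ ->.
- rewrite (@star_leaf _ _ M S (AL st) col M_sym Sg S_anti v u s); have [c -> _] := star_center S_sdr s.
  by case/and3P: s => _ _; rewrite tm_sym // => ->.
rewrite negb_or => /andP[s1 s2]; rewrite star_old // ic //.
suff /negbTE -> : tm st u v != i by [].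
apply/negP => /eqP E; move: s1 s2; rewrite /S m mu (tm_sym mu) E eqxx !andbT.
by have := M_sd m; case: (sd u); case: (sd v).
Qed.

Theorem sl_ok : pcol M A sl /\ forall u v, M u v -> isSome (sl u v).
Proof.
have H i : finv i (iteri i (fstep st) (fun _ _ => None)).
  by elim: i => [|i IH]; [split | exact: finv_step].
have [[c1 c2 c3] ic] := H (h.+1 * Mc); split.
  by split=> // u v c m /c2 => /(_ m)/andP[].
move=> u v m; rewrite ic // /tm; have [_ l1 _ _ _] := inv_levels m.
by have := ix_lt m; move: (ix _ _ _) (Mc) => a K; nia.
Qed.

End Finish.

Definition slT := h * (oriT h).+2 + 1 + 1 + h.+1 * Mc * 3.

Lemma sl_local (M M' : rel V) Q sd sd' A A' :
  agr Q sd sd' -> agr Q A A' -> agr (ball Q M M' slT) (sl M sd A) (sl M' sd' A').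
Proof.
move=> asd aA; have ast := levels_local (M := M) (M' := M') asd aA.
rewrite /slT; set t0 := h * _ in ast *.
have ari : agr (ball Q M M' (t0 + 1)) (ri M (levels M sd A)) (ri M' (levels M' sd' A')).
  apply: agrD => v b; apply: functional_extensionality => u.
  by rewrite /ri (agr_row b) (agr_base ast b).
have {}ast : agr (ball Q M M' (t0 + 1 + 1)) (levels M sd A) (levels M' sd' A').
  by apply: agr_le ast; lia.
have atm : agr (ball Q M M' (t0 + 1 + 1)) (tm M sd (levels M sd A)) (tm M' sd' (levels M' sd' A')).
  move=> v b; apply: functional_extensionality => u; rewrite /tm /ix (ast _ b) (agr_base asd b).
  by rewrite (agrD (agr_nb ari) b) (agr_le _ ari b) // leq_addr.
apply: agrD; apply: agr_iter => // i t T T' aT; apply: agrD; apply: star_local => //.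
  apply: agr_base => v b; apply: functional_extensionality => u.
  rewrite (atm _ b) (agr_base asd b); move: b; rewrite addn1 => -[_ -> _] //.
apply: agr_base => v b; apply: functional_extensionality => u.
by apply: functional_extensionality => c; rewrite /AL (ast _ b) (agr_base aA b).
Qed.

End Levels.

Lemma pb_Mc : pb 9 Mc.
Proof.
apply: pbD; first by apply: pb_le (pb_const 4).
exact: (pbM (pbM (pb_const 16) pb_id) pb_beta).
Qed.

Lemma pb_slT : pb 10 slT.
Proof.
apply: pbD; last exact: (pbM (pbM (pbS pb_id) pb_Mc) (pb_const 3)).
do 2![apply: pbD; last by apply: pb_le (pb_const 1)].
exact: (pbM pb_id (pbS (pbS pb_oriT))).
Qed.

(** * Colouring graphs of bounded degree *)

Section BoundedDegree.
Variables (V : finType) (h : nat).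
Notation Cc := 'I_(2 ^ h).
Implicit Type col : V -> V -> option Cc.

Section Def.
Variable H : rel V.

Definition LH u v (c : Cc) :=
  (0 < c) && oapp (fun dv => c < dg H u + dv) false (nb H (dg H) u v).

Section Bip.
Variable sd : V -> bool.

Definition Bs u v := H u v && (nb H sd u v == Some (~~ sd u)).
Definition ub col u v := Bs u v && ~~ isSome (col u v).
Definition ubn col u := num (ub col u).
(** The constant is [8 = 4 * 2]. In a class, four times the competitors number at most
    [(D - 2) / 2]. The edges in [Mi] still have uncoloured degrees summing to more than [D / 2],
    hence more available colours than that. The 4 is the slack needed by [sl], the 2 allows for
    degrees that halve during the phase. *)
Definition lab col u v := rk (ub col u) v %% 8.
Definition cls col u v :=
  let o := oapp (fun r : V -> nat => r u) 0 (nb H (lab col) u v) in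
  if sd u then o * 8 + lab col u v else lab col u v * 8 + o.
Definition Mi D (cl : V -> V -> nat) i col u v :=
  [&& ub col u v, cl u v == i
    & oapp (fun n => D < 2 * (ubn col u + n)) false (nb H (ubn col) u v)].
Definition cstep D cl i col u v :=
  if Mi D cl i col u v then sl (Mi D cl i col) sd (avail H LH col) u v else col u v.
Definition bphase D col := iteri 64 (cstep D (cls col)) col.
Definition bip col := iteri h (fun p => bphase (2 ^ (h - p))) col.
End Bip.

Definition bitn (x : V -> nat) i v := odd (x v %/ 2 ^ i).
Definition bcol b (x : V -> nat) :=
  iteri b (fun i => bip (bitn x i)) (fun _ _ => None).

Hypothesis h0 : 0 < h.
Hypothesis H_sym : symmetric H.
Hypothesis H_deg : forall u v, H u v -> dg H u + dg H v <= 2 ^ h.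

Definition ext col col' := forall u v, isSome (col u v) -> col' u v = col u v.

Lemma ext_trans c1 c2 c3 : ext c1 c2 -> ext c2 c3 -> ext c1 c3.
Proof. by move=> e1 e2 u v s; rewrite e2 e1. Qed.

Lemma LHE u v c : H u v -> LH u v c = (0 < c < dg H u + dg H v).
Proof. by move=> m; rewrite /LH nbE. Qed.

Lemma LH_sym u v : H u v -> LH u v = LH v u.
Proof.
move=> m; apply: functional_extensionality => c.
by rewrite !LHE ?[H v u]H_sym // [dg H u + _]addnC.
Qed.

Lemma LH_num u v : H u v -> num (LH u v) = (dg H u + dg H v).-1.
Proof.
move=> m; have le := H_deg m; set d := dg H u + dg H v in le *.
have d0 : 0 < d by rewrite addn_gt0 (numP m).
have -> : num (LH u v) = (num (fun c : Cc => c < d)).-1.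
  have z0 : 0 < 2 ^ h by rewrite expn_gt0.
  rewrite (@numD1 _ (fun c : Cc => c < d) (Ordinal z0) d0) succnK; apply: eq_num => c.
  by rewrite LHE // -/d lt0n andbC.
congr (_.-1); rewrite /num -sum1_card -[RHS]card_ord -sum1_card.
by rewrite [RHS](big_ord_widen (2 ^ h) (fun=> 1) le).
Qed.

Definition un col u := num (fun v => H u v && ~~ isSome (col u v)).

(** A list has one colour more than the edge has neighbours, and each coloured neighbour removes at
    most one. Partial colourings can therefore always be extended, and the slack refers to
    uncoloured edges only. *)
Lemma avail_num col u v : H u v -> ~~ isSome (col u v) ->
  un col u + un col v <= (num (avail H LH col u v)).+1.
Proof.
move=> m n; have m' : H v u by rewrite H_sym.
have us w : num (fun c => LH u v c && used H col w c) <= dg H w - un col w.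
  apply: leq_trans (@used_num _ h H col w _ (fun z => H w z && isSome (col w z)) _) _.
    by move=> z c -> ->.
  by rewrite /dg (numID (H w) (fun z => isSome (col w z))) /un addnK.
have le1 : num (LH u v) <= num (avail H LH col u v) +
    (num (fun c => LH u v c && used H col u c) + num (fun c => LH u v c && used H col v c)).
  rewrite (numID (LH u v) (avail H LH col u v)); apply: leq_add.
    by apply: num_sub => c /andP[].
  apply: leq_trans (numU _ _); apply: num_sub => c; rewrite /avail nbE //=.
  by case: (LH u v c) => //=; rewrite negb_and !negbK.
have unle w : un col w <= dg H w by apply: num_sub => z /andP[].
have := us u; have := us v; have := unle u; have := unle v; have := LH_num m.
have : 0 < dg H u by apply: numP m.
by lia.
Qed.

Lemma avail_sym col u v : H u v -> avail H LH col u v = avail H LH col v u.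
Proof.
move=> m; apply: functional_extensionality => c; rewrite /avail !nbE ?[H v u]H_sym //=.
by rewrite (LH_sym m) [~~ used H col u c && _]andbC.
Qed.

Lemma merge_pcol (M : rel V) col nc : (forall u v, M u v -> H u v && ~~ isSome (col u v)) ->
  symmetric M -> pcol H LH col -> pcol M (avail H LH col) nc ->
  (forall u v, M u v -> isSome (nc u v)) ->
  pcol H LH (fun u v => if M u v then nc u v else col u v).
Proof.
move=> MH Msym [c1 c2 c3] [n1 n2 n3] ns.
have notused u v w c : M u v -> nc u v = Some c -> H u w -> col u w <> Some c.
  move=> m Ec mw Ew; have := n2 _ _ _ m Ec; case/and3P => _ /negP + _; apply.
  by apply/existsP; exists w; rewrite mw Ew eqxx.
split.
- by move=> u v m; rewrite Msym; case: ifP => [mm|_]; [apply: n1; rewrite Msym | apply: c1].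
- move=> u v c m; case: ifP => [mm /n2|_]; last exact: c2.
  by move/(_ mm)/and3P => [].
- move=> u v w c m mw vw; case: ifP => mv; case: ifP => mw'.
  + exact: n3.
  + by move=> Ec; apply: notused mv Ec mw.
  + by move=> Ec Ew; apply: notused mw' Ew m Ec.
  + exact: c3.
Qed.

Section BipProofs.
Variable sd : V -> bool.

Lemma BsE u v : Bs sd u v = H u v && (sd v != sd u).
Proof. by rewrite /Bs /nb; case: (H u v) => //=; case: (sd u); case: (sd v). Qed.

Lemma Bs_sym u v : Bs sd u v = Bs sd v u.
Proof. by rewrite !BsE H_sym eq_sym. Qed.

Lemma ub_sym col u v : pcol H LH col -> ub sd col u v = ub sd col v u.
Proof.
case=> c1 _ _; rewrite /ub Bs_sym; case: (boolP (Bs sd v u)) => //.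
by rewrite BsE => /andP[m _]; rewrite (c1 _ _ m).
Qed.

Lemma ub_ext col col' u v : ext col col' -> ub sd col' u v -> ub sd col u v.
Proof.
move=> e; rewrite /ub => /andP[->] /=; apply: contra => s; by rewrite e.
Qed.

Lemma ubn_ext col col' u : ext col col' -> ubn sd col' u <= ubn sd col u.
Proof. by move=> e; apply: num_sub => v; apply: ub_ext. Qed.

Section Class.
Variables (D : nat) (col0 : V -> V -> option Cc).
Hypothesis pc0 : pcol H LH col0.
Hypothesis D0 : forall u v, ub sd col0 u v -> ubn sd col0 u + ubn sd col0 v <= D.
Let cl := cls sd col0.

Lemma clsE u v : ub sd col0 u v -> cl u v =
  if sd u then lab sd col0 v u * 8 + lab sd col0 u v else lab sd col0 u v * 8 + lab sd col0 v u.
Proof. by rewrite /cl /cls /ub BsE => /andP[/andP[m _] _]; rewrite nbE. Qed.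

Lemma lab8 col u v : lab sd col u v < 8.
Proof. by rewrite ltn_mod. Qed.

Lemma cls_sym u v : ub sd col0 u v -> cl u v = cl v u.
Proof.
move=> u0; rewrite !clsE // 1?ub_sym //; move: u0; rewrite /ub BsE.
by case: (sd u); case: (sd v); rewrite ?andbF.
Qed.

Lemma cls_lt u v : ub sd col0 u v -> cl u v < 64.
Proof.
by move=> u0; rewrite clsE //; have := lab8 col0 u v; have := lab8 col0 v u; case: (sd u); lia.
Qed.

Lemma cls_lab u v w : ub sd col0 u v -> ub sd col0 u w -> cl u v = cl u w ->
  lab sd col0 u v = lab sd col0 u w.
Proof.
move=> u1 u2; rewrite !clsE //; have := lab8 col0 u v; have := lab8 col0 v u.
by have := lab8 col0 u w; have := lab8 col0 w u; case: (sd u); lia.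
Qed.

Definition cinv i col : Prop :=
  [/\ pcol H LH col, ext col0 col &
      forall u v, ub sd col u v -> cl u v < i -> 2 * (ubn sd col u + ubn sd col v) <= D].

Lemma MiE i col u v : Mi sd D cl i col u v =
  [&& ub sd col u v, cl u v == i & D < 2 * (ubn sd col u + ubn sd col v)].
Proof. by rewrite /Mi /nb /ub /Bs; case: (H u v). Qed.

Lemma Mi_dg i col u v : ext col0 col -> Mi sd D cl i col u v ->
  8 * (dg (Mi sd D cl i col) u).-1 <= (ubn sd col0 u).-1.
Proof.
move=> e; rewrite MiE => /and3P[/(ub_ext e) uv /eqP cv _].
apply: leq_trans (rk_mod_num (ub sd col0 u) (lab sd col0 u v) (isT : 0 < 8)).
rewrite leq_mul2l /=; suff : dg (Mi sd D cl i col) u <= num (fun w => ub sd col0 u w && (lab sd col0 u w == lab sd col0 u v)).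
  by rewrite /lab; lia.
apply: num_sub => w; rewrite MiE => /and3P[/(ub_ext e) uw /eqP cw _].
by rewrite uw /=; apply/eqP/cls_lab => //; rewrite cw cv.
Qed.

Lemma cinv_step i col : cinv i col -> cinv i.+1 (cstep sd D cl i col).
Proof.
case=> pc e ci; set M := Mi sd D cl i col.
have Mub u v : M u v -> ub sd col u v by rewrite /M MiE => /andP[].
have Msym : symmetric M.
  move=> u v; rewrite /M !MiE ub_sym //; case: (boolP (ub sd col v u)) => //= b.
  by rewrite (cls_sym (u := u)) ?[ubn sd col u + _]addnC // ub_sym //; apply: ub_ext b.
have MH u v : M u v -> H u v && ~~ isSome (col u v).
  by move/Mub; rewrite /ub BsE => /andP[/andP[-> _] ->].
have [pn sn] : pcol M (avail H LH col) (sl M sd (avail H LH col)) /\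
    (forall u v, M u v -> isSome (sl M sd (avail H LH col) u v)).
  apply: sl_ok => //.
  - by move=> u v /Mub; rewrite /ub BsE eq_sym => /andP[/andP[]].
  - by move=> u v /MH/andP[m _]; apply: avail_sym.
  move=> u v m; have mu : M v u by rewrite Msym.
  have [mH nc] := andP (MH _ _ m).
  have := Mi_dg e m; have := Mi_dg e mu; have := avail_num mH nc.
  have u0 := ub_ext e (Mub _ _ m); have := D0 u0.
  have : 0 < ubn sd col0 u by apply: numP u0.
  have : 0 < ubn sd col0 v by apply: (numP (w := u)); rewrite -ub_sym.
  have ule w : ubn sd col w <= un col w.
    by apply: num_sub => z; rewrite /ub BsE => /andP[/andP[-> _] ->].
  have := ule u; have := ule v; move: m; rewrite {1}/M MiE => /and3P[_ _].
  by rewrite -/M; lia.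
have e' : ext col (cstep sd D cl i col).
  move=> u v s; rewrite /cstep -/M; case: ifP => // /MH/andP[_].
  by rewrite s.
split.
- exact: merge_pcol.
- exact: ext_trans e e'.
move=> u v b'; have b := ub_ext e' b'; rewrite ltnS leq_eqVlt => /orP[/eqP cE|lt]; last first.
  have := ci u v b lt; have := ubn_ext u e'; have := ubn_ext v e'; lia.
have : ~~ M u v.
  apply/negP => m; move: b'; rewrite /ub /cstep -/M m => /andP[_].
  by rewrite sn.
rewrite /M MiE b cE eqxx /= -leqNgt.
have := ubn_ext u e'; have := ubn_ext v e'; lia.
Qed.

Lemma bphase_ok (col := bphase sd D col0) :
  [/\ pcol H LH col, ext col0 col &
      forall u v, ub sd col u v -> 2 * (ubn sd col u + ubn sd col v) <= D].
Proof.
suff H' i : cinv i (iteri i (cstep sd D cl) col0).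
  rewrite /col /bphase -/cl; move: 64 cls_lt => k lt; have [p1 p2 p3] := H' k.
  by split=> // u v b; apply: p3 => //; apply: lt; apply: ub_ext p2 b.
by elim: i => [|i IH]; [split | exact: cinv_step].
Qed.
End Class.

Lemma bip_ok col0 (col := bip sd col0) : pcol H LH col0 ->
  [/\ pcol H LH col, ext col0 col & forall u v, ~~ ub sd col u v].
Proof.
move=> pc0.
suff H' i : i <= h -> [/\ pcol H LH (iteri i (fun p => bphase sd (2 ^ (h - p))) col0),
      ext col0 (iteri i (fun p => bphase sd (2 ^ (h - p))) col0) &
      forall u v, ub sd (iteri i (fun p => bphase sd (2 ^ (h - p))) col0) u v ->
       ubn sd (iteri i (fun p => bphase sd (2 ^ (h - p))) col0) u +
       ubn sd (iteri i (fun p => bphase sd (2 ^ (h - p))) col0) v <= 2 ^ (h - i)].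
  (* After [h] halvings the bound is 1, but an uncoloured edge contributes 1 at both endpoints. *)
  have [p1 p2 p3] := H' h (leqnn h); split=> // u v; apply/negP => b; have := p3 u v b.
  rewrite subnn expn0; have := numP b; rewrite ub_sym // in b; have := numP b.
  by rewrite -!/(ubn _ _ _) -/(bip _ _) -/col; lia.
elim: i => [|i IH] le.
  split=> //= u v; rewrite /ub BsE subn0 => /andP[/andP[m _] _]; apply: leq_trans (H_deg m).
  by apply: leq_add; apply: num_sub => w; rewrite /ub BsE => /andP[/andP[]].
have [p1 p2 p3] := IH (ltnW le); have [q1 q2 q3] := bphase_ok p1 p3.
split=> //=; first exact: ext_trans p2 q2.
by move=> u v /q3 le2; rewrite -(@leq_pmul2l 2) // -expnS subnSK.
Qed.

End BipProofs.

Theorem bcol_ok b (x : V -> nat) : (forall u v, H u v -> x u != x v) ->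
  (forall v, x v < 2 ^ b) ->
  pcol H LH (bcol b x) /\ forall u v, H u v -> isSome (bcol b x u v).
Proof.
move=> xH xb.
have H' i : pcol H LH (bcol i x) /\
    forall u v k, k < i -> H u v -> bitn x k u != bitn x k v -> isSome (bcol i x u v).
  elim: i => [|i [p1 p2]]; first by [].
  have [q1 q2 q3] := bip_ok (bitn x i) p1; split=> // u v k; rewrite ltnS leq_eqVlt.
  case/orP => [/eqP -> m ne|lt m ne]; last by rewrite /bcol /= q2; apply: p2 lt m ne.
  by have := q3 u v; rewrite /ub BsE m eq_sym ne /= negbK.
have [p1 p2] := H' b; split=> // u v m.
case: (boolP [exists k : 'I_b, bitn x k u != bitn x k v]) => [/existsP[k]|].
  by apply: p2.
rewrite negb_exists => /forallP all; case/eqP: (xH u v m).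
have : forall k, k < b -> bitn x k u = bitn x k v.
  by move=> k lt; apply/eqP; have := all (Ordinal lt); rewrite negbK.
move: (xb u) (xb v); rewrite /bitn; move: (x u) (x v); clear.
elim: b => [|b IH] y z; first by rewrite expn0 !ltnS !leqn0 => /eqP -> /eqP ->.
rewrite expnS => ly lz E; rewrite -(odd_double_half y) -(odd_double_half z).
have := E 0 isT; rewrite expn0 !divn1 => ->; congr (_ + _.*2); rewrite -!divn2.
apply: IH; try by lia.
by move=> k lt; have := E k.+1 lt; rewrite expnS !divnMA.
Qed.

End Def.

Definition cstepT := slT h + 4.
Definition bphaseT := 2 + 64 * cstepT.

Section Local.
Variables (H H' : rel V).

Lemma avail_local Q col col' : agr Q col col' ->
  agr (ball Q H H' 3) (avail H (LH H) col) (avail H' (LH H') col').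
Proof.
move=> ac; have ad : agr (ball Q H H' 1) (dg H) (dg H').
  by move=> v b; rewrite /dg (agr_row b).
have aL : agr (ball Q H H' 2) (LH H) (LH H').
  move=> v b; apply: functional_extensionality => u; apply: functional_extensionality => c.
  by rewrite /LH (agr_nb ad b) (ad _ (ball_le _ b)).
have au : agr (ball Q H H' 2) (used H col) (used H' col').
  move=> v b; apply: functional_extensionality => c.
  by case: (b) => -[_ E _] _ _; rewrite /used E (agr_base ac b).
move=> v b; apply: functional_extensionality => u; apply: functional_extensionality => c.
by rewrite /avail (agr_nb au b) (au v (ball_le _ b)) // (aL v (ball_le _ b)).
Qed.

Lemma ub_local Q sd sd' col col' : agr Q sd sd' -> agr Q col col' ->
  agr (ball Q H H' 1) (ub H sd col) (ub H' sd' col').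
Proof.
move=> asd ac v b; apply: functional_extensionality => u.
by rewrite /ub /Bs (agr_nb asd b) (agr_row b) (agr_base asd b) (agr_base ac b).
Qed.

Lemma cstep_local Q sd sd' D cl cl' i col col' :
  agr Q sd sd' -> agr Q cl cl' -> agr Q col col' ->
  agr (ball Q H H' cstepT) (cstep H sd D cl i col) (cstep H' sd' D cl' i col').
Proof.
move=> asd acl ac.
have aub := ub_local asd ac.
have an : agr (ball Q H H' 1) (ubn H sd col) (ubn H' sd' col').
  by move=> v b; rewrite /ubn aub.
have aM : agr (ball Q H H' 2) (Mi H sd D cl i col) (Mi H' sd' D cl' i col').
  move=> v b; apply: functional_extensionality => u.
  by rewrite /Mi (agr_nb an b) (an _ (ball_le _ b)) // (aub _ (ball_le _ b)) // (agr_base acl b).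
have aA := avail_local ac.
rewrite /cstepT addnC; move=> v b; apply: functional_extensionality => u.
rewrite /cstep (aM _ (ball_le _ b)) // (agr_base ac b).
have b' : ball (ball Q H H' 4) (Mi H sd D cl i col) (Mi H' sd' D cl' i col') (slT h) v.
  apply: (@ball_sim _ H H' _ id _ _ (ball Q H H' 4)); last by apply/ballD.
    by move=> z w /and3P[/andP[/andP[]]].
  by move=> z bz; apply: aM; apply: ball_le bz.
have asd4 : agr (ball Q H H' 4) sd sd' by apply: agr_base.
have aA4 : agr (ball Q H H' 4) (avail H (LH H) col) (avail H' (LH H') col') by apply: agr_le aA.
by rewrite (sl_local asd4 aA4 b').
Qed.

Lemma bphase_local Q sd sd' D col col' : agr Q sd sd' -> agr Q col col' ->
  agr (ball Q H H' bphaseT) (bphase H sd D col) (bphase H' sd' D col').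
Proof.
move=> asd ac; have aub := ub_local asd ac.
have al : agr (ball Q H H' 1) (lab H sd col) (lab H' sd' col').
  by move=> v b; apply: functional_extensionality => u; rewrite /lab aub.
have acl : agr (ball Q H H' 2) (cls H sd col) (cls H' sd' col').
  move=> v b; apply: functional_extensionality => u.
  by rewrite /cls (agr_nb al b) (al _ (ball_le _ b)) // (agr_base asd b).
apply: agrD; apply: agr_iter; last exact: agr_base.
move=> i t T T' aT; apply: agrD; apply: cstep_local => //; last exact: agr_base.
by do 2!apply: agr_base.
Qed.

Lemma bcol_local Q b x x' : agr Q x x' ->
  agr (ball Q H H' (b * (h * bphaseT))) (bcol H b x) (bcol H' b x').
Proof.
move=> ax; apply: agr_iter => // i t T T' aT; apply: agrD; apply: agr_iter => // p t' U U' aU.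
apply: agrD; apply: bphase_local => //; do 2!apply: agr_base.
by move=> v q; rewrite /bitn ax.
Qed.

End Local.
End BoundedDegree.

Lemma pb_bphaseT : pb 10 bphaseT.
Proof.
apply: pbD; first by apply: pb_le (pb_const 2).
apply: (pbM (pb_const 64)); apply: pbD pb_slT _; by apply: pb_le (pb_const 4).
Qed.

(** * Colour reduction *)

(* Nodes are polynomials over a field with [2 ^ j] elements; each node evaluates
   its polynomial at a point where it differs from all neighbouring ones. *)
Lemma linial (V : finType) (j k0 dmax : nat) :
  0 < j -> #|V| <= 2 ^ (j * k0) -> dmax * k0 < 2 ^ j ->
  exists lin : rel V -> V -> nat,
    [/\ forall H : rel V, symmetric H -> irreflexive H -> (forall v, dg H v <= dmax) ->
          forall u v, H u v -> lin H u != lin H v,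
        forall H v, lin H v < 2 ^ (2 * j) &
        forall (H H' : rel V) v, H v = H' v -> lin H v = lin H' v].
Proof.
move=> j0 cV dk; have [F _ cF] := PrimePowerField (isT : prime 2) j0.
have le : #|V| <= #|{ffun 'I_k0 -> F}| by rewrite card_ffun card_ord cF -expnM.
pose g v : {ffun 'I_k0 -> F} := enum_val (widen_ord le (enum_rank v)).
have g_inj : injective g.
  by move=> u v /enum_val_inj/(congr1 val) /= /ord_inj/enum_rank_inj.
pose P v : {poly F} := (\poly_(i < k0) (if insub i is Some o then g v o else 0))%R.
have P_inj : injective P.
  move=> u v E; apply: g_inj; apply/ffunP => o; have := congr1 (fun p : {poly F} => p`_o)%R E.
  by rewrite !coef_poly ltn_ord valK.
pose good (H : rel V) v p := [forall w, H v w ==> ((P w).[p] != (P v).[p])%R].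
pose pt (H : rel V) v : F := odflt 0%R [pick p | good H v p].
pose lin (H : rel V) v : nat := enum_rank (pt H v, ((P v).[pt H v])%R).
have ptP (H : rel V) v : irreflexive H -> dg H v <= dmax -> good H v (pt H v).
  move=> irr dH; rewrite /pt; case: pickP => //= none.
  (* If no point were good, the field would be covered by the roots of at most [dmax] nonzero
     differences, each with fewer than [k0] roots. *)
  suff : #|F| < 2 ^ j by rewrite cF ltnn.
  apply: leq_ltn_trans dk; apply: (@leq_trans (dg H v * k0)); last by rewrite leq_mul2r dH orbT.
  pose rt w p := H v w && ((P w).[p] == (P v).[p])%R.
  apply: (@leq_trans (\sum_w num (rt w))).
    rewrite -sum1_card; under [X in _ <= X]eq_bigr => w _ do rewrite num_sum.
    rewrite exchange_big /=; apply: leq_sum => p _.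
    have := none p; rewrite /good => /negbT; rewrite negb_forall => /existsP[w].
    rewrite negb_imply negbK => Hw; rewrite (bigD1 w) //= /rt Hw.
    by rewrite leq_addr.
  rewrite /dg num_sum big_distrl /=; apply: leq_sum => w _.
  case: (boolP (H v w)) => Hw; last by rewrite num0 // => p; rewrite /rt (negbTE Hw).
  rewrite mul1n; have nz : (P w - P v)%R != 0%R.
    by rewrite GRing.subr_eq0; apply: contraTneq Hw => /P_inj ->; rewrite irr.
  have := max_poly_roots nz (rs := enum [pred p | rt w p]).
  rewrite -cardE -/(num (rt w)) enum_uniq => lt; apply: ltnW; apply: leq_trans (lt _ isT) _.
    apply/allP => p; rewrite mem_enum inE /rt Hw /= /root !hornerE => /eqP ->.
    by rewrite GRing.subrr.
  apply: leq_trans (size_polyD _ _) _; rewrite geq_max size_polyN; apply/andP; split; exact: size_poly.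
exists lin; split.
- move=> H sym irr dH u v Huv; apply/negP => /eqP/ord_inj/enum_rank_inj[E1].
  rewrite E1; have := ptP H v irr (dH v) => /forallP/(_ u).
  by rewrite sym Huv /= => /eqP ne E; apply: ne.
- by move=> H v; apply: leq_trans (ltn_ord _) _; rewrite card_prod cF -expnD addnn mul2n.
- move=> H H' v E; have -> // : lin H v = lin H' v.
  have Ep : pt H v = pt H' v by rewrite /pt /good E.
  by rewrite /lin Ep.
Qed.

(** * Layers *)

Section Layers.
Variables (V : finType) (a K t : nat).

Section Def.
Variable e : rel V.

Definition dga (S : V -> bool) v := num (fun w => nb e S v w == Some true).
Definition hea S v w := nb e (fun w => S w && (K < dga S w)) v w == Some true.
Definition rem S v := (dga S v <= K) && (num (hea S v) <= 2 * a).
Definition nxt (S : V -> bool) v := S v && ~~ rem S v.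
(** Isolated nodes are left out from the start, since [V] will consist of all possible identifiers,
    most of them without a node. *)
Definition Sa i := iter i nxt (fun v => 0 < dg e v).

Definition info i v := (Sa i v, Sa i.+1 v, dga (Sa i) v <= K).
(* The edges of [E1] are those whose endpoints both have small degree when the
   first of them is removed; every other edge [u v] has exactly one endpoint [u]
   with [Pa u v], the one removed first. *)
Definition E1 u v := [exists i : 'I_t, oapp (fun y => let x := info i u in
  [&& x.1.1, y.1.1, ~~ (x.1.2 && y.1.2), x.2 & y.2]) false (nb e (info i) u v)].
Definition Pa u v := [exists i : 'I_t, oapp (fun y => let x := info i u in
  [&& x.1.1, ~~ x.1.2, y.1.1 & ~~ y.2]) false (nb e (info i) u v)].

Hypothesis e_sym : symmetric e.
Hypothesis dense : forall S : V -> bool,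
  \sum_(v | S v) num (fun w => e v w && S w) <= 2 * a * num S.

Lemma nb_true (S : V -> bool) v w : (nb e S v w == Some true) = e v w && S w.
Proof. by rewrite /nb; case: (e v w) => //=; case: (S w). Qed.

Lemma dgaE S v : dga S v = num (fun w => e v w && S w).
Proof. by apply: eq_num => w; rewrite nb_true. Qed.

Lemma heaE S v w : hea S v w = [&& e v w, S w & K < dga S w].
Proof. by rewrite /hea nb_true. Qed.

Lemma E1P u v : reflect (exists2 i, i < t & [&& e u v, Sa i u, Sa i v,
   ~~ (Sa i.+1 u && Sa i.+1 v), dga (Sa i) u <= K & dga (Sa i) v <= K]) (E1 u v).
Proof.
apply: (iffP existsP) => [[i]|[i lt]].
  by rewrite /nb; case: (e u v) => //= H; exists i.
by case/andP => euv H; exists (Ordinal lt); rewrite nbE.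
Qed.

Lemma PaP u v : reflect (exists2 i, i < t & [&& e u v, Sa i u,
   ~~ Sa i.+1 u, Sa i v & K < dga (Sa i) v]) (Pa u v).
Proof.
apply: (iffP existsP) => [[i]|[i lt]].
  by rewrite /nb; case: (e u v) => //=; rewrite -ltnNge => H; exists i.
by case/andP => euv H; exists (Ordinal lt); rewrite nbE //= -ltnNge.
Qed.

Lemma Sa_dec i k v : i <= k -> Sa k v -> Sa i v.
Proof. by move/subnKC <-; elim: (k - i) => [|d IH]; rewrite ?addn0 // addnS => /andP[/IH]. Qed.

Lemma Sa_rem i v : Sa i v -> ~~ Sa i.+1 v -> rem (Sa i) v.
Proof. by rewrite /Sa iterS {2}/nxt => -> /=; rewrite negbK. Qed.

Lemma sum_ge (S : V -> bool) (f : V -> nat) k : (forall v, S v -> k <= f v) ->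
  k * num S <= \sum_(v | S v) f v.
Proof.
move=> H; rewrite num_sum big_distrr /= [X in _ <= X]big_mkcond /=; apply: leq_sum => v _.
by case: (boolP (S v)) => [/H|_]; rewrite ?muln1 ?muln0.
Qed.

(** By density the nodes [Hi] of degree above [K] satisfy [K.+1 * num Hi <= 2 * a * num S]. Any
    other survivor has more than [2 * a] neighbours in [Hi]; counting these edges from both ends and
    using density on [X] and [Hi] together gives [num X <= num Hi]. *)
Lemma Sa_shrink i : num (Sa i.+1) * K.+1 <= 4 * a * num (Sa i).
Proof.
set S := Sa i; pose Hi v := S v && (K < dga S v); pose X v := nxt S v && ~~ Hi v.
have leH : K.+1 * num Hi <= 2 * a * num S.
  apply: leq_trans (dense S); apply: leq_trans (sum_ge (f := dga S) _) _; first by move=> v /andP[].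
  rewrite big_mkcond [X in _ <= X]big_mkcond; apply: leq_sum => v _.
  by rewrite /Hi dgaE; case: (S v) => //=; case: ifP.
pose Y v := X v || Hi v.
have leX : num X <= num Hi.
  have Yn : num Y <= num X + num Hi by apply: numU.
  have XH v : X v -> 2 * a < num (fun w => e v w && Hi w).
    case/andP => /andP[Sv nr] nH; move: nr; rewrite /rem negb_and -!ltnNge.
    case/orP => [lt|lt]; first by rewrite /Hi Sv lt in nH.
    by apply: leq_trans lt _; apply: num_sub => w; rewrite heaE.
  have : (2 * a).+1 * num X + (2 * a).+1 * num X <= \sum_(v | Y v) num (fun w => e v w && Y w).
    have e1 : (2 * a).+1 * num X <= \sum_(v | X v) num (fun w => e v w && Hi w) by apply: sum_ge XH.
    have e2 : \sum_(v | X v) num (fun w => e v w && Hi w) = \sum_(w | Hi w) num (fun v => e w v && X v).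
      under eq_bigr => v _ do rewrite num_sum; rewrite exchange_big /=.
      rewrite [RHS]big_mkcond; apply: eq_bigr => w _; rewrite num_sum.
      case: (boolP (Hi w)) => hw; last by rewrite big1 // => v _; rewrite andbF.
      rewrite big_mkcond; apply: eq_bigr => v _; rewrite e_sym andbT.
      by case: (X v); rewrite ?andbT ?andbF.
    have e3 := e1; rewrite e2 in e3; apply: leq_trans (leq_add e1 e3) _.
    rewrite big_mkcond [X in _ + X]big_mkcond -big_split [X in _ <= X]big_mkcond /=.
    apply: leq_sum => v _; rewrite /Y; case: (boolP (X v)) => [/andP[_ nH]|nX] /=.
      by rewrite (negbTE nH) addn0; apply: num_sub => w /andP[-> ->]; rewrite orbT.
    case: (boolP (Hi v)) => // _; rewrite add0n; apply: num_sub => w /andP[-> ->] //.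
  by have := dense Y; nia.
have : num (Sa i.+1) <= num X + num Hi.
  apply: leq_trans (numU _ _); apply: num_sub => v; rewrite {1}/Sa iterS -/(Sa i) -/S => n.
  by rewrite /X n /=; case: (Hi v).
by nia.
Qed.

Hypothesis Sa_end : forall v, ~~ Sa t v.

Lemma edge_split u v : e u v -> exists2 i, i < t & [&& Sa i u, Sa i v & ~~ (Sa i.+1 u && Sa i.+1 v)].
Proof.
move=> euv; have s0 : Sa 0 u && Sa 0 v.
  by rewrite /Sa /= (numP euv) /=; apply: (numP (w := u)); rewrite e_sym.
have st : ~~ (Sa t u && Sa t v) by rewrite negb_and Sa_end.
elim: t st => [|i IH]; first by rewrite s0.
case: (boolP (Sa i u && Sa i v)) => [/andP[su sv] n|n _]; first by exists i; rewrite // su sv.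
by have [k lt H] := IH n; exists k => //; apply: ltnW.
Qed.

Lemma E1_sym : symmetric E1.
Proof.
move=> u v; apply/E1P/E1P => -[i lt] /and5P[euv s1 s2 n /andP[d1 d2]]; exists i => //.
  by rewrite e_sym euv s1 s2 [Sa i.+1 v && _]andbC n d1 d2.
by rewrite e_sym euv s1 s2 [Sa i.+1 u && _]andbC n d1 d2.
Qed.

Lemma E1_e u v : E1 u v -> e u v.
Proof. by case/E1P => i _ /andP[]. Qed.

Lemma Pa_e u v : Pa u v -> e u v.
Proof. by case/PaP => i _ /andP[]. Qed.

Lemma Pa_next u v i : Sa i u -> ~~ Sa i.+1 u -> Sa i v -> K < dga (Sa i) v -> Sa i.+1 v.
Proof.
move=> su nu sv lt; apply/negPn/negP => nv; have := Sa_rem sv nv.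
by rewrite /rem leqNgt lt.
Qed.

Lemma edge_cases u v : e u v -> [|| E1 u v, Pa u v | Pa v u].
Proof.
move=> euv; have [i lt /and3P[su sv n]] := edge_split euv.
have H x y : e x y -> Sa i x -> Sa i y -> ~~ Sa i.+1 x -> E1 x y || Pa x y.
  move=> exy sx sy nx; have /andP[dx _] := Sa_rem sx nx.
  case: (leqP (dga (Sa i) y) K) => dy; apply/orP; [left; apply/E1P | right; apply/PaP]; exists i => //.
    by rewrite exy sx sy (negbTE nx) dx dy.
  by rewrite exy sx nx sy dy.
move: n; rewrite negb_and => /orP[n|n].
  by rewrite orbA H.
have evu : e v u by rewrite e_sym.
by have := H _ _ evu sv su n; rewrite E1_sym; case/orP => ->; rewrite ?orbT.
Qed.

Lemma Pa_only u v : Pa u v -> ~~ E1 u v && ~~ Pa v u.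
Proof.
case/PaP => i lt /and5P[euv su nu sv dv]; have sv' := Pa_next su nu sv dv.
apply/andP; split; apply/negP.
  case/E1P => k ltk /and5P[_ ku kv n /andP[d1 d2]].
  case: (ltngtP i k) => ik; first by rewrite (Sa_dec ik ku) in nu.
    by move: n; rewrite (Sa_dec ik su) (Sa_dec ik sv).
  by move: d2; rewrite -ik leqNgt dv.
case/PaP => k ltk /and5P[_ kv nkv ku du].
case: (ltngtP i k) => ik; first by rewrite (Sa_dec ik ku) in nu.
  by move: nkv; rewrite (Sa_dec ik sv).
by move: nkv; rewrite -ik sv'.
Qed.

Lemma Pa_out u : num (Pa u) <= 2 * a.
Proof.
case: (posnP (num (Pa u))) => [-> //|/num_ex[v /PaP[i lt /and5P[_ su nu _ _]]]].
have /andP[_ le] := Sa_rem su nu; apply: leq_trans le; apply: num_sub => w.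
case/PaP => k ltk /and5P[euw ku nku kw dw]; rewrite heaE euw.
have -> : i = k; last by rewrite kw dw.
case: (ltngtP i k) => // ik; first by rewrite (Sa_dec ik ku) in nu.
by rewrite (Sa_dec ik su) in nku.
Qed.

(** At the first time [i] that an edge of [E1] at [v] qualifies, the far ends of all edges of [E1]
    at [v] are still active. They are therefore counted by [dga (Sa i) v], which is at most [K]. *)
Lemma E1_deg v : dg E1 v <= K.
Proof.
case: (boolP [exists i : 'I_t, [exists w, [&& e v w, Sa i v, Sa i w & (dga (Sa i) v <= K)]
    && ~~ (Sa i.+1 v && Sa i.+1 w) && (dga (Sa i) w <= K)]]) => [/existsP[i0 ex0]|]; last first.
  rewrite negb_exists => /forallP none; rewrite /dg num0 // => w; apply/negP => /E1P[i lt].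
  case/and5P => evw s1 s2 n /andP[d1 d2]; have := none (Ordinal lt); rewrite negb_exists.
  by move/forallP/(_ w); rewrite /= evw s1 s2 d1 d2 n.
pose p i := [exists w, [&& e v w, Sa i v, Sa i w & (dga (Sa i) v <= K)]
    && ~~ (Sa i.+1 v && Sa i.+1 w) && (dga (Sa i) w <= K)].
have exp : exists i, p i by exists i0.
case: (ex_minnP exp) => i /existsP[w0 /andP[/andP[/and4P[_ _ _ le] _] _]] mn.
apply: leq_trans le; rewrite dgaE; apply: num_sub => w /E1P[k lt /and5P[evw s1 s2 n /andP[d1 d2]]].
rewrite evw (Sa_dec _ s2) //; apply: mn; apply/existsP; exists w.
by rewrite evw s1 s2 d1 d2 n.
Qed.

Definition ly u := num (fun i : 'I_t => Sa i u).

Lemma Pa_ly u v : Pa u v -> ly u < ly v.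
Proof.
case/PaP => i lt /and5P[euv su nu sv dv]; have sv' := Pa_next su nu sv dv.
have lt' : i.+1 < t.
  by rewrite ltn_neqAle lt andbT; apply: contraTneq sv' => ->.
rewrite [X in _ < X](@numD1 _ _ (Ordinal lt')) // ltnS; apply: num_sub => k sk.
have ki : k <= i by rewrite leqNgt; apply: contra nu => ik; apply: Sa_dec sk.
by rewrite (Sa_dec ki) //=; apply: contraTneq ki => ->; rewrite /= ltnn.
Qed.

Lemma ly_le u : ly u <= t.
Proof. by rewrite -[X in _ <= X]card_ord; apply: max_card. Qed.

(* The out-edges of each node, indexed by rank, split the edges outside [E1] into
   forests; [par s j] is the depth parity in the [j]-th of them. *)
Definition pstep (q : V -> nat -> bool) u j :=
  [exists v, [&& Pa u v, rk (Pa u) v == j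
               & oapp (fun p : nat -> bool => ~~ p j) false (nb e q u v)]].
Definition par s : V -> nat -> bool := iter s pstep (fun _ _ => false).

Lemma parS s u v : Pa u v -> par s.+1 u (rk (Pa u) v) = ~~ par s v (rk (Pa u) v).
Proof.
move=> p; apply/existsP/idP => [[w /and3P[pw /eqP E]]|n].
  by rewrite nbE ?Pa_e //= (rk_inj pw p E).
by exists v; rewrite p eqxx nbE ?Pa_e.
Qed.

Lemma par_nil s u j : (forall v, Pa u v -> rk (Pa u) v != j) -> par s u j = false.
Proof.
case: s => // s n; apply/negbTE; rewrite negb_exists; apply/forallP => v.
by apply/negP => /and3P[/n/negbTE ->].
Qed.

(** By [Pa_ly] parents stay active strictly longer, so [u] has depth at most [t - ly u] in every
    forest, and its parity is settled after that many steps. *)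
Lemma par_stable s u j : t - ly u <= s -> par s u j = par s.+1 u j.
Proof.
elim: s u => [|s IH] u le; case: (boolP [exists v, Pa u v && (rk (Pa u) v == j)]) => [/existsP[v /andP[p /eqP E]]|].
- by have := Pa_ly p; have := ly_le v; lia.
- by rewrite negb_exists => /forallP n; rewrite !par_nil // => v p; have := n v; rewrite p.
- have := parS s p; have := parS s.+1 p; rewrite E => -> ->; rewrite IH //.
  by have := Pa_ly p; have := ly_le v; lia.
- by rewrite negb_exists => /forallP n; rewrite !par_nil // => v p; have := n v; rewrite p.
Qed.

Lemma par_alt u v : Pa u v -> par t u (rk (Pa u) v) = ~~ par t v (rk (Pa u) v).
Proof. by move=> p; rewrite par_stable ?leq_subr // parS. Qed.

End Def.

Section Local.
Variables (e f : rel V).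

Lemma dga_local Q S S' : agr Q S S' -> agr (ball Q e f 1) (dga e S) (dga f S').
Proof. by move=> aS v b; rewrite /dga (agr_nb aS b). Qed.

Lemma Sa_local Q i : agr (ball Q e f (1 + i * 2)) (Sa e i) (Sa f i).
Proof.
elim: i => [|i IH]; first by move=> v b; rewrite /Sa /= /dg (agr_row b).
rewrite mulSn addnCA addnC; apply: agrD.
have ad := dga_local IH; set Q' := ball Q e f _ in IH ad *.
have aw : agr (ball Q' e f 1) (fun w => Sa e i w && (K < dga e (Sa e i) w))
                             (fun w => Sa f i w && (K < dga f (Sa f i) w)).
  by move=> v b; rewrite (agr_base IH b) ad.
move=> v b; rewrite /Sa !iterS -/(Sa e i) -/(Sa f i) /nxt /rem /hea.
by rewrite (agr_base IH b) (ad _ (ball_le _ b)) // (agr_nb aw b).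
Qed.

Definition lT := t * 2 + 4 + 1.

Lemma info_local Q i : i < t -> agr (ball Q e f (t * 2 + 4)) (info e i) (info f i).
Proof.
move=> lt v b; rewrite /info.
have b0 k : k <= i.+1 -> ball Q e f (1 + k * 2) v by move=> le; apply: ball_le b; lia.
rewrite (Sa_local (b0 i _)) // (Sa_local (b0 i.+1 _)) //; congr (_, _, _ <= _).
by apply: (agrD (dga_local (Sa_local (Q := Q) (i := i)))); apply: ball_le b; lia.
Qed.

Lemma E1_local Q : agr (ball Q e f lT) (E1 e) (E1 f).
Proof.
rewrite /lT => v b; apply: functional_extensionality => u.
rewrite /E1; apply: eq_existsb => i; have ai := info_local (Q := Q) (ltn_ord i).
by rewrite (agrD (agr_nb ai) b) (ai _ (ball_le _ b)) // leq_addr.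
Qed.

Lemma Pa_local Q : agr (ball Q e f lT) (Pa e) (Pa f).
Proof.
rewrite /lT => v b; apply: functional_extensionality => u.
rewrite /Pa; apply: eq_existsb => i; have ai := info_local (Q := Q) (ltn_ord i).
by rewrite (agrD (agr_nb ai) b) (ai _ (ball_le _ b)) // leq_addr.
Qed.

Lemma par_local Q s : agr (ball Q e f (lT + s)) (par e s) (par f s).
Proof.
elim: s => [|s IH]; first by [].
rewrite [lT + _]addnS -[(lT + s).+1]addn1; apply: agrD => v b; apply: functional_extensionality => j.
have aP : agr (ball Q e f (lT + s)) (Pa e) (Pa f) by apply: agr_le (@Pa_local Q); rewrite leq_addr.
by rewrite /par !iterS -/(par e s) -/(par f s) /pstep (agr_nb IH b) (agr_base aP b).
Qed.

End Local.
End Layers.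

(** * Colouring graphs of bounded arboricity *)

Section Main.
Variables (V : finType) (a K t h h2 b : nat) (lin : rel V -> V -> nat).

Section Def.
Variable e : rel V.
Local Notation F1 := (E1 a K t e).
Local Notation Pu := (Pa a K t e).
Local Notation pa := (par a K t e t).

Definition col0 u v : option 'I_(2 ^ h2) :=
  if F1 u v then obind (fun c : 'I_(2 ^ h) => insub (val c)) (bcol h F1 b (lin F1) u v) else None.
(** The step [i] encodes a forest, [i./2], and the depth parity [odd i] of the centres. This gives
    [4 * a] steps for [2 * a] forests. *)
Definition Sx i p u :=
  oapp (fun r : V -> bool => r p && (rk r p == i./2)) false (nb e Pu p u) && (pa p i./2 == odd i).
Definition mstep i := star e (Sx i) (LH e) (C := 'I_(2 ^ h2)).
Definition mcol := iteri (4 * a) mstep col0.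

Hypothesis e_sym : symmetric e.
Hypothesis Sa_end : forall v, ~~ Sa a K e t v.
Hypothesis h0 : 0 < h.
Hypothesis Kh : K + K <= 2 ^ h.
Hypothesis Vh : #|V| + #|V| <= 2 ^ h2.
Hypothesis lin_ok : forall u v, F1 u v -> lin F1 u != lin F1 v.
Hypothesis lin_lt : forall v, lin F1 v < 2 ^ b.

Lemma e_deg u v : e u v -> dg e u + dg e v <= 2 ^ h2.
Proof. by move=> _; apply: leq_trans Vh; apply: leq_add; apply: max_card. Qed.

Definition slot u p := 2 * rk (Pu u) p + pa p (rk (Pu u) p).

Lemma SxE i p u : Sx i p u = Pu u p && (slot u p == i).
Proof.
rewrite /Sx /slot /nb; case: (boolP (e p u)) => epu; last first.
  by case: (boolP (Pu u p)) => // /Pa_e; rewrite e_sym (negbTE epu).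
rewrite /= -andbA; congr (_ && _); case: eqP => [->|ne].
  apply/eqP/eqP => [->|E]; first by rewrite mul2n addnC odd_double_half.
  by have := congr1 odd E; rewrite oddD oddM /= oddb.
apply/esym/negbTE/eqP => E; apply: ne; rewrite -E.
by rewrite mul2n addnC half_bit_double.
Qed.

Lemma F1_dg u v : F1 u v -> dg F1 u + dg F1 v <= 2 ^ h.
Proof. by move=> _; apply: leq_trans Kh; apply: leq_add; apply: E1_deg. Qed.

Lemma col0_ok : pcol e (LH e) col0 /\ forall u v, e u v -> isSome (col0 u v) = F1 u v.
Proof.
have [[c1 c2 c3] sm] := bcol_ok h0 (E1_sym _ _ _ e_sym) F1_dg lin_ok lin_lt.
have dle v : dg F1 v <= dg e v by apply: num_sub => w /E1_e.
have val0 u v c : col0 u v = Some c -> F1 u v /\ exists2 c' : 'I_(2 ^ h), bcol h F1 b (lin F1) u v = Some c' & val c' = val c.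
  rewrite /col0; case: ifP => // f; case: (bcol _ _ _ _ u v) => //= c'.
  by case: insubP => // x _ E [<-]; split=> //; exists c'.
split.
  split.
  - by move=> u v euv; rewrite /col0 (E1_sym a K t e_sym) -/(F1 v u); case: ifP => // f; rewrite (c1 _ _ f).
  - move=> u v c euv /val0[f [c' E Ec]]; rewrite LHE // -Ec; have := c2 _ _ _ f E.
    rewrite LHE // => /andP[-> lt]; apply: leq_trans lt _; exact: leq_add.
  - move=> u v w c euv euw vw /val0[f [c' E Ec]] /val0[f' [c'' E' Ec']].
    apply: (c3 u v w c' f f' vw E); rewrite E'; congr Some; apply: ord_inj; rewrite /= in Ec Ec' *.
    by rewrite Ec Ec'.
move=> u v euv; rewrite /col0; case: ifP => // f.
have := sm u v f; case E: (bcol _ _ _ _ u v) => [c|] //= _.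
have := c2 _ _ _ f E; rewrite LHE // => /andP[_ lt].
have lt2 : val c < 2 ^ h2.
  by apply: leq_trans lt _; apply: leq_trans (leq_add (dle u) (dle v)) (e_deg euv).
by case: insubP => //; rewrite lt2.
Qed.

Definition minv i (col : V -> V -> option 'I_(2 ^ h2)) : Prop :=
  [/\ pcol e (LH e) col, forall u v, F1 u v -> isSome (col u v) &
      forall u p, Pu u p -> isSome (col u p) = (slot u p < i)].

Lemma minv0 : minv 0 col0.
Proof.
have [p1 p2] := col0_ok; split=> //.
  by move=> u v f; rewrite p2 // (E1_e f).
move=> u p Pup; rewrite p2 ?(Pa_e Pup) // ltn0.
by apply/negbTE; case/andP: (Pa_only Pup).
Qed.

Lemma minv_step i col : minv i col -> minv i.+1 (mstep i col).
Proof.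
case=> pc cF cP; have [c1 c2 c3] := pc.
have Pe p u : Sx i p u -> e p u by rewrite SxE => /andP[/Pa_e]; rewrite e_sym.
have anti p u : Sx i p u -> ~~ Sx i u p.
  rewrite !SxE => /andP[/Pa_only/andP[_ n] _]; by rewrite (negbTE n).
have new p u : Sx i p u -> col p u = None.
  move=> s; rewrite c1 ?Pe //; move: s; rewrite SxE => /andP[Pup /eqP E].
  by have := cP _ _ Pup; rewrite E ltnn; case: (col u p).
(* The stars are disjoint: a node has one parent per forest, and a child has the opposite parity, so
   it is no centre in the same step. *)
have dis p u p' (c : 'I_(2 ^ h2)) : Sx i p u -> p' != p -> Sx i p' u || Sx i u p' ->
    LH e p u c -> LH e p' u c -> False.
  rewrite !SxE => /andP[Pp /eqP Ep] ne.
  have rp : rk (Pu u) p = i./2.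
    by rewrite -Ep /slot mul2n addnC half_bit_double.
  have bp : pa p i./2 = odd i by rewrite -rp -[in RHS]Ep /slot oddD oddM /= oddb.
  case/orP => /andP[Pp' /eqP Ep'].
    have rp' : rk (Pu u) p' = i./2.
      by rewrite -Ep' /slot mul2n addnC half_bit_double.
    by case/eqP: ne; apply: (rk_inj Pp' Pp); rewrite rp rp'.
  have rp' : rk (Pu p') u = i./2.
    by rewrite -Ep' /slot mul2n addnC half_bit_double.
  have bp' : pa u i./2 = odd i by rewrite -rp' -[in RHS]Ep' /slot oddD oddM /= oddb.
  by have := par_alt Sa_end Pp; rewrite rp bp bp'; case: (odd i).
(* By [avail_num] an uncoloured edge has at least [un p + un u - 1] colours, hence at least [un p],
   which bounds the size of the star. *)
have sdr p u : Sx i p u -> num (fun u' => Sx i p u' && meets (avail e (LH e) col p) u u')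
    <= num (avail e (LH e) col p u).
  move=> s; have epu := Pe _ _ s; have nn : ~~ isSome (col p u) by rewrite (new _ _ s).
  have h20 : 0 < h2.
    have : 0 < #|V| by apply/card_gt0P; exists p.
    by move: Vh; case: (posnP h2) => // ->; lia.
  have := avail_num h20 e_sym e_deg epu nn.
  have : 0 < un e col u.
    by apply: (numP (w := p)); rewrite e_sym epu -c1 // nn.
  have : num (fun u' => Sx i p u' && meets (avail e (LH e) col p) u u') <= un e col p.
    by apply: num_sub => w /andP[sw _]; rewrite (Pe _ _ sw) (new _ _ sw).
  lia.
have Lsym u v : e u v -> LH e u v = LH e v u :> ('I_(2 ^ h2) -> bool) by apply: LH_sym.
split.
- by rewrite /mstep; apply: star_pcol.
- move=> u v f; have euv := E1_e f; have evu : e v u by rewrite e_sym.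
  rewrite /mstep star_old ?cF //; rewrite SxE; apply/negP => /andP[/Pa_only/andP[n _] _].
    by rewrite E1_sym // f in n.
  by rewrite f in n.
move=> u p Pup; have eup := Pa_e Pup; rewrite ltnS leq_eqVlt.
case: (boolP (Sx i p u)) => s.
  rewrite /mstep (@star_leaf _ _ e (Sx i) (LH e) col e_sym Pe anti p u s).
  by have [c -> _] := star_center sdr s; move: s; rewrite SxE => /andP[_ ->].
have ns : ~~ Sx i u p.
  by rewrite SxE negb_and; case/andP: (Pa_only Pup) => _ ->.
rewrite /mstep star_old // cP //.
by move: s; rewrite SxE Pup /= => /negbTE ->.
Qed.

Theorem mcol_ok : pcol e (LH e) mcol /\ forall u v, e u v -> isSome (mcol u v).
Proof.
have H i : minv i (iteri i mstep col0).
  by elim: i => [|i IH]; [exact: minv0 | exact: minv_step].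
have [p1 p2 p3] := H (4 * a); split=> // u v euv; have [c1 _ _] := p1.
have sl u' v' : Pu u' v' -> slot u' v' < 4 * a.
  move=> P; have := rk_lt P; have := Pa_out a K t e u'; rewrite /slot.
  by case: (pa _ _); lia.
case/or3P: (edge_cases e_sym Sa_end euv) => [/p2 //|P|P]; first by rewrite p3 ?sl.
by rewrite /mcol c1 // p3 ?sl.
Qed.

End Def.

Hypothesis lin_loc : forall (H H' : rel V) v, H v = H' v -> lin H v = lin H' v.

Definition mT := lT t + 1 + b * (h * bphaseT h) + (t + 1) + (4 * a * 3 + 3).

Theorem mcol_local (e f : rel V) : agr (ball (fun=> True) e f mT) (mcol e) (mcol f).
Proof.
set Q : V -> Prop := fun=> True.
have aE := @E1_local V a K t e f Q; have aP := @Pa_local V a K t e f Q.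
have app := @par_local V a K t e f Q t.
have ab : agr (ball Q e f (lT t + 1 + b * (h * bphaseT h)))
   (bcol h (E1 a K t e) b (lin (E1 a K t e)) : V -> V -> option 'I_(2 ^ h))
   (bcol h (E1 a K t f) b (lin (E1 a K t f))).
  move=> v /ballD bv.
  have alin : agr (ball Q e f (lT t + 1)) (lin (E1 a K t e)) (lin (E1 a K t f)).
    by move=> u bu; apply: lin_loc; apply: aE; apply: ball_le bu; lia.
  apply: (bcol_local alin).
  apply: (@ball_sim _ e f _ id _ _ (ball Q e f (lT t + 1))) => //; first by move=> z w /E1_e.
  by move=> z bz; apply: aE; apply: ball_le bz; apply: leq_addr.
rewrite /mT; apply: agrD; set Q' := ball Q e f _.
have wk (X : Type) s (I J : V -> X) : agr (ball Q e f s) I J ->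
    s <= lT t + 1 + b * (h * bphaseT h) + (t + 1) -> agr Q' I J.
  by move=> H le; apply: agr_le le H.
have a0 : agr Q' (col0 e) (col0 f).
  move=> v q; apply: functional_extensionality => u.
  by rewrite /col0 (wk _ _ _ _ ab _ v q) ?(wk _ _ _ _ aE _ v q) //; lia.
have aS i : agr Q' (Sx e i) (Sx f i).
  move=> v q; apply: functional_extensionality => u; rewrite /Sx.
  rewrite (wk _ _ _ _ (agrD (agr_nb aP)) _ v q); last by lia.
  by rewrite (wk _ _ _ _ app _ v q) //; lia.
have aL : agr (ball Q' e f 2) (LH e : V -> V -> 'I_(2 ^ h2) -> bool) (LH f).
  move=> v bv; have ad : agr (ball Q' e f 1) (dg e) (dg f) by move=> z bz; rewrite /dg (agr_row bz).
  apply: functional_extensionality => u; apply: functional_extensionality => c.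
  by rewrite /LH (agr_nb ad bv) (ad _ (ball_le _ bv)).

rewrite addnC -[3 + _]/(2 + 1 + _) -addnA; apply: agrD.
apply: (@agr_le _ _ _ _ _ (4 * a * 3)); first by lia.
apply: agr_iter; last exact: agr_base.
move=> i s T T' aT; apply: agrD; apply: star_local => //; do 2!apply: agr_base => //.
Qed.

End Main.

(** * Density of graphs of bounded arboricity *)

Section Forest.
Variables (T : finType) (f : rel T).
Hypothesis f_sym : symmetric f.
Hypothesis f_irr : irreflexive f.
Hypothesis f_acy : acyclic f.

Definition sdeg (S : T -> bool) v := num (fun w => f v w && S w).

(** With all degrees in [S] at least 2, a path could always be prolonged to a new node: returning to
    an old one would close a cycle. *)
Lemma low_degree (S : T -> bool) v0 : S v0 -> exists2 v, S v & sdeg S v <= 1.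
Proof.
move=> S0; case: (boolP [exists v, S v && (sdeg S v <= 1)]) => [/existsP[v /andP[]]|].
  by exists v.
rewrite negb_exists => /forallP H.
have two v : S v -> 1 < sdeg S v by move=> Sv; have := H v; rewrite Sv /= -ltnNge.
have ext x p : S x -> path f x p -> uniq (x :: p) ->
    exists2 y, S y & f x y && (y \notin x :: p).
  move=> Sx pp up.
  have [y Sy /andP[fxy ny]] : exists2 y, S y & f x y && (y != head x p).
    have := two x Sx; rewrite /sdeg => lt; have [y0 /andP[fy0 Sy0]] := num_ex (ltnW lt).
    case: (eqVneq y0 (head x p)) => [E|ne]; last by exists y0; rewrite ?fy0.
    move: lt; rewrite (@numD1 _ _ y0) ?fy0 // ltnS => /num_ex[y /andP[/andP[fy Sy] ne]].
    by exists y => //; rewrite fy -E.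
  exists y => //; rewrite fxy inE negb_or /=; apply/andP; split.
    by apply: contraTneq fxy => ->; rewrite f_irr.
  apply/negP => yp; case/splitPr: yp pp up ny => p1 p2 pp up ny.
  have := f_acy (x :: rcons p1 y); apply/negP; rewrite negbK.
  have E : p1 ++ y :: p2 = rcons p1 y ++ p2 by rewrite cat_rcons.
  rewrite E in pp up; apply/and3P; split.
  - rewrite /cycle rcons_path last_rcons f_sym fxy andbT.
    by move: pp; rewrite cat_path => /andP[].
  - by move: up; rewrite -cat_cons cat_uniq => /and3P[].
  by case: p1 ny {pp up E} => [|z p1] /=; rewrite ?eqxx // size_rcons.
have long k : exists x p, [/\ S x, path f x p, uniq (x :: p) & size p = k].
  elim: k => [|k [x [p [Sx pp up sp]]]]; first by exists v0, [::].
  have [y Sy /andP[fxy yn]] := ext x p Sx pp up.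
  exists y, (x :: p); split=> //=; last by rewrite sp.
    by rewrite f_sym fxy.
  by rewrite yn; move: up => /= ->.
have [x [p [_ _ up sp]]] := long #|T|.
have := max_card (mem (x :: p)); have /card_uniqP -> := up.
by rewrite /= sp ltnn.
Qed.

Lemma forest_density (S : T -> bool) : \sum_(v | S v) sdeg S v <= 2 * num S.
Proof.
move: {2}(num S) (erefl (num S)) => k; elim: k S => [|k IH] S E.
  rewrite big1 // => v Sv; by have := numP Sv; rewrite E.
have [v0 S0] : exists v, S v by apply: num_ex; rewrite E.
have [v Sv dv] := low_degree S0.
pose S' w := S w && (w != v).
have E' : num S' = k by move: E; rewrite (numD1 Sv) => -[].
rewrite (bigD1 v) //= E mulnS.
have -> : \sum_(w | S w && (w != v)) sdeg S w = \sum_(w | S' w) (sdeg S' w + f w v).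
  apply: eq_bigr => w _; rewrite /sdeg (numID _ (eq_op^~ v)) addnC; congr (_ + _).
    by apply: eq_num => z; rewrite /S' andbA.
  case: (boolP (f w v)) => fwv.
    rewrite (@numD1 _ _ v) ?fwv ?Sv ?eqxx // num0 // => z.
    by rewrite -andbA andbN andbF.
  by rewrite num0 // => z; apply/negP => /andP[/andP[fz _] /eqP E2]; rewrite -E2 fz in fwv.
rewrite big_split /=.
have -> : \sum_(w | S' w) f w v = sdeg S' v.
  by rewrite /sdeg num_sum big_mkcond; apply: eq_bigr => w _; rewrite f_sym; case: (S' w); rewrite ?andbT ?andbF.
have : sdeg S' v <= sdeg S v by apply: num_sub => w /andP[-> /andP[->]].
by have := IH S' E'; rewrite E'; lia.
Qed.

End Forest.

Lemma arboricity_density (T : finType) (e : rel T) (a : nat) (S : T -> bool) :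
  simple_graph e -> arboricity_le e a ->
  \sum_(v | S v) num (fun w => e v w && S w) <= 2 * a * num S.
Proof.
move=> [sym irr] [f [fe acy]].
pose g i : rel T := [rel x y | e x y && (f x y == i)].
have -> : \sum_(v | S v) num (fun w => e v w && S w) = \sum_(i < a) \sum_(v | S v) sdeg (g i) S v.
  rewrite exchange_big /=; apply: eq_bigr => v _; rewrite /sdeg num_sum.
  under [RHS]eq_bigr => i _ do rewrite num_sum.
  rewrite exchange_big /=; apply: eq_bigr => w _.
  case: (boolP (e v w)) => evw; last by rewrite big1 // => i _; rewrite /g /= (negbTE evw).
  have [_ lt] := fe v w evw; rewrite (bigD1 (Ordinal lt)) //= /g /= evw eqxx /= big1 ?addn0 // => i ne.
  rewrite eq_sym; have -> : (i == f v w :> nat) = false; last by [].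
  by apply/negbTE; apply: contra ne => /eqP E; apply/eqP/ord_inj.
apply: leq_trans (_ : \sum_(i < a) 2 * num S <= _); last first.
  by rewrite sum_nat_const card_ord mulnA (mulnC a).
apply: leq_sum => i _; apply: forest_density.
- by move=> x y; rewrite /g /= sym; case: (boolP (e y x)) => //= eyx; have [-> _] := fe _ _ eyx.
- by move=> x; rewrite /g /= irr.
- exact: acy.
Qed.

(** * Choice of the parameters *)

Lemma pb_shift d F : pb d F -> pb d (fun L => F (2 * L + 3)).
Proof.
move=> [C H]; exists (C * 5 ^ d) => L L0; apply: leq_trans (H _ _) _; first by rewrite addn3.
rewrite -mulnA -expnMn leq_mul2l; apply/orP; right; case: d {H} => // d.
by rewrite leq_exp2r //; lia.
Qed.

Definition coreT c L :=
  lT (L ^ 12).+1 + 1 + 2 * (15 * L + c + 3) * ((2 * L + 3) * bphaseT (2 * L + 3))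
  + ((L ^ 12).+1 + 1) + 3.

Lemma pb_coreT c : pb 12 (coreT c).
Proof.
have p12 : pb 12 (fun L => (L ^ 12).+1).
  by apply: pbS; exists 1 => L _; rewrite mul1n.
have pc k : pb 12 (fun=> k) by apply: pb_le (pb_const k).
have p1 k : pb 1 (fun=> k) by apply: pb_le (pb_const k).
do 2![apply: pbD; last by [apply: pbD | exact: pc]]; apply: pbD.
  apply: pbD; last exact: pc.
  do 2![apply: pbD; last exact: pc]; exact: (pbM p12 (pb_const 2)).
apply: (@pbM 1 11); last first.
  apply: (@pbM 1 10 (fun L => 2 * L + 3)); last exact: pb_shift pb_bphaseT.
  by apply: pbD (p1 3); apply: (pbM (pb_const 2) pb_id).
apply: (@pbM 0 1 (fun=> 2) _ (pb_const 2)).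
by do 2![apply: pbD; last exact: p1]; apply: (pbM (pb_const 15) pb_id).
Qed.

Section Core.
Variables (c n a L : nat).
Hypotheses (L0 : 0 < L) (nL : n <= 2 ^ (L ^ 13)) (aL : a <= 2 ^ L).
Let V : finType := 'I_(n ^ c).+1.
Let K := 2 ^ (2 * L + 2).

(** The value of [K] makes [4 * a / K] at most [2 ^ (- L)]. After [L ^ 12] steps at most one active
    node remains, and one more step removes it. *)
Lemma Sa_empty (e : rel V) : symmetric e ->
  (forall S : V -> bool, \sum_(v | S v) num (fun w => e v w && S w) <= 2 * a * num S) ->
  num (fun v => 0 < dg e v) <= n ->
  forall v, ~~ Sa a K e (L ^ 12).+1 v.
Proof.
move=> sym dense le0.
have KE : K = 4 * 2 ^ L * 2 ^ L by rewrite /K -[4]/(2 ^ 2) -!expnD; congr (2 ^ _); lia.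
have P0 : 0 < 2 ^ L by rewrite expn_gt0.
have H i : num (Sa a K e i) * 2 ^ (L * i) <= n.
  elim: i => [|i IH]; first by rewrite muln0 muln1.
  apply: leq_trans IH; rewrite mulnS expnD mulnA leq_mul2r; apply/orP; right.
  rewrite -(@leq_pmul2l (4 * 2 ^ L)) ?muln_gt0 //.
  have := Sa_shrink K sym dense i; rewrite KE; move: aL; move: (2 ^ L) (num _) (num _) => p x y; nia.
have := H (L ^ 12).+1; rewrite mulnS -expnS expnD => lt v; apply/negP => Sv.
have x0 := numP Sv; move: lt; move: (num _) x0 => x x0.
have : 1 < 2 ^ L by rewrite -[1](expn0 2) ltn_exp2l.
have : 0 < 2 ^ L ^ 13 by rewrite expn_gt0.
move: nL; move: (2 ^ L ^ 13) (2 ^ L) => p q np p0 q1 lt.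
have : p < q * p by rewrite ltn_Pmull.
have : q * p <= x * (q * p) by rewrite leq_pmull.
lia.
Qed.

Lemma core : exists F : rel V -> V -> V -> nat,
  (forall e f v, ball (fun=> True) e f (coreT c L + 12 * a) v -> F e v = F f v) /\
  (forall e : rel V, symmetric e -> irreflexive e ->
    (forall S : V -> bool, \sum_(v | S v) num (fun w => e v w && S w) <= 2 * a * num S) ->
    num (fun v => 0 < dg e v) <= n ->
    (forall u v, e u v -> F e u v = F e v u /\ 0 < F e u v < dg e u + dg e v) /\
    (forall u v w, e u v -> e u w -> v != w -> F e u v <> F e u w)).
Proof.
(* [k0] bits suffice for an identifier, and [K * k0 <= 2 ^ (2 * L + 2 + (13 * L + c)) < 2 ^ j]. *)
pose j := 15 * L + c + 3; pose k0 := c * L ^ 13 + 1.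
have j0 : 0 < j by rewrite /j; lia.
have cV : #|V| <= 2 ^ (j * k0).
  rewrite card_ord; apply: (@leq_trans (2 ^ k0)); last by rewrite leq_exp2l // leq_pmull.
  rewrite /k0 addn1 expnS mul2n -addnn -add1n; apply: leq_add; first by rewrite expn_gt0.
  by rewrite mulnC expnM; case: (c) => // c'; rewrite leq_exp2r.
have dk : K * k0 < 2 ^ j.
  have lek : k0 <= 2 ^ (13 * L + c).
    rewrite /k0 expnD mulnC.
    have : L ^ 13 <= 2 ^ (13 * L) by rewrite mulnC expnM leq_exp2r // ltnW // ltn_expl.
    have : c < 2 ^ c by apply: ltn_expl.
    have : 0 < 2 ^ (13 * L) by rewrite expn_gt0.
    by move: (2 ^ c) (2 ^ (13 * L)) (L ^ 13) => x y z; nia.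
  apply: leq_ltn_trans (_ : 2 ^ (2 * L + 2 + (13 * L + c)) < _).
    by rewrite expnD leq_mul2l lek orbT.
  by rewrite ltn_exp2l // /j; lia.
have [lin [lin1 lin2 lin3]] := linial j0 cV dk.
(* [h] satisfies [2 ^ h = 2 * K]. The palette size given by [h2] only has to hold all colours; the
   number of rounds does not depend on it. *)
pose t := (L ^ 12).+1; pose h := 2 * L + 3; pose h2 := 2 * #|V|; pose b := 2 * j.
pose F (e : rel V) u v : nat := oapp val 0 (mcol a K t h h2 b lin e u v).
exists F; split.
  move=> e f v bv; apply: functional_extensionality => u; rewrite /F.
  rewrite (@mcol_local V a K t h h2 b lin lin3 e f v) //; apply: ball_le bv.
  by rewrite /mT /coreT -/j -/t -/h -/b; lia.
move=> e sym irr dense le0; have Sa_end := Sa_empty sym dense le0.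
have h0 : 0 < h by rewrite /h; lia.
have Kh : K + K <= 2 ^ h by rewrite addnn -mul2n -expnS leq_exp2l // /h; lia.
have Vh : #|V| + #|V| <= 2 ^ h2 by rewrite addnn -mul2n ltnW // ltn_expl.
have l1 u v : E1 a K t e u v -> lin (E1 a K t e) u != lin (E1 a K t e) v.
  apply: lin1; [exact: E1_sym| | exact: E1_deg].
  by move=> x; apply/negbTE/negP => f; have := E1_e f; rewrite irr.
have l2 v : lin (E1 a K t e) v < 2 ^ b by apply: lin2.
have [[c1 c2 c3] sm] := mcol_ok sym Sa_end h0 Kh Vh l1 l2.
split.
  move=> u v euv; split; first by rewrite /F (c1 _ _ euv).
  rewrite /F; have := sm u v euv; case E: (mcol _ _ _ _ _ _ _ _ u v) => [x|] // _.
  by have := c2 _ _ _ euv E; rewrite LHE.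
move=> u v w euv euw vw; rewrite /F.
have := sm u v euv; case E: (mcol _ _ _ _ _ _ _ _ u v) => [x|] // _.
have := sm u w euw; case E': (mcol _ _ _ _ _ _ _ _ u w) => [y|] // _ /= /ord_inj Exy.
by apply: (c3 u v w x euv euw vw E); rewrite E' Exy.
Qed.

End Core.

(** * Logarithms *)

Delimit Scope R_scope with Re.

Lemma INR_expn p q : INR (p ^ q) = (INR p ^ q)%Re.
Proof. by elim: q => //= q IH; rewrite expnS -[RHS]/(_ * _)%Re -IH -mult_INR. Qed.

Lemma leq_INR p q : p <= q -> (INR p <= INR q)%Re.
Proof. by move=> le; apply: le_INR; apply/leP. Qed.

Lemma root13 k : 0 < k -> Rpower (INR k ^ 13) (INR 1 / INR 13) = INR k.
Proof.
move=> k0; have p : (0 < INR k)%Re by apply: lt_0_INR; apply/ltP.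
rewrite -Rpower_pow // Rpower_mult.
have -> : (INR 13 * (INR 1 / INR 13) = 1)%Re by simpl; field.
exact: Rpower_1.
Qed.

Section Log.
Variables (n L : nat).
Hypotheses (n2 : 1 < n) (L0 : 0 < L) (nL : n <= 2 ^ (L ^ 13)) (Ln : 2 ^ (L.-1 ^ 13) < n).

Let ln2 : (0 < ln (INR 2))%Re.
Proof. by rewrite -ln_1; apply: ln_increasing; simpl; lra. Qed.

Lemma ln_expn2 k : ln (INR (2 ^ k)) = (INR k * ln (INR 2))%Re.
Proof.
rewrite INR_expn -Rpower_pow; last by simpl; lra.
by rewrite /Rpower ln_exp.
Qed.

Lemma ln_leq p q : 0 < p -> p <= q -> (ln (INR p) <= ln (INR q))%Re.
Proof.
move=> p0; rewrite leq_eqVlt => /orP[/eqP ->|lt]; first lra.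
apply: Rlt_le; apply: ln_increasing; first by apply: lt_0_INR; apply/ltP.
by apply: lt_INR; apply/ltP.
Qed.

Lemma log2_le : (log2 (INR n) <= INR L ^ 13)%Re.
Proof.
have H := ln_leq (ltnW n2) nL; rewrite ln_expn2 INR_expn in H.
rewrite /log2; apply: (Rmult_le_reg_r (ln (INR 2))) => //.
by rewrite /Rdiv Rmult_assoc Rinv_l ?Rmult_1_r //; lra.
Qed.

Lemma log2_ge p : 0 < p -> 2 ^ p <= n -> (INR p <= log2 (INR n))%Re.
Proof.
move=> p0 le; have H := ln_leq (expn_gt0 2 p) le.
rewrite ln_expn2 in H; rewrite /log2; apply: (Rmult_le_reg_r (ln (INR 2))) => //.
by rewrite /Rdiv Rmult_assoc Rinv_l ?Rmult_1_r //; lra.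
Qed.

Lemma log2_ge1 : (1 <= log2 (INR n))%Re.
Proof. by have := @log2_ge 1 isT n2; simpl. Qed.

Let z := logpow n 1 13.

Lemma z_ge1 : (1 <= z)%Re.
Proof.
rewrite /z /logpow -(Rpower_O (log2 (INR n))); last by have := log2_ge1; lra.
apply: Rle_Rpower; first exact: log2_ge1.
by simpl; lra.
Qed.

Lemma z_le : (z <= INR L)%Re.
Proof.
rewrite -(root13 L0); apply: Rle_Rpower_l; first by simpl; lra.
split; last exact: log2_le.
by have := log2_ge1; lra.
Qed.

Lemma z_ge : (INR L.-1 <= z)%Re.
Proof.
case: (posnP L.-1) => [->|p0]; first by have := z_ge1; simpl; lra.
rewrite -(root13 p0); apply: Rle_Rpower_l; first by simpl; lra.
have p1 : 0 < L.-1 ^ 13 by rewrite expn_gt0 p0.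
split; first by rewrite -INR_expn; apply: lt_0_INR; apply/ltP.
by rewrite -INR_expn; apply: log2_ge => //; apply: ltnW.
Qed.

Lemma logpow_pow : logpow n 12 13 = (z ^ 12)%Re.
Proof.
have zp : (0 < z)%Re by have := z_ge1; lra.
rewrite -Rpower_pow // /z /logpow Rpower_mult; congr (Rpower _ _).
by simpl; field.
Qed.

Lemma logpow_ge1 : (1 <= logpow n 12 13)%Re.
Proof. by rewrite logpow_pow -(pow1 12); apply: pow_incr; have := z_ge1; lra. Qed.

(** Minimality of [L] gives [L - 1 <= z], and [1 <= z], so [L <= 2 * z]. *)
Lemma L12_le : (INR (L ^ 12) <= INR (2 ^ 12) * logpow n 12 13)%Re.
Proof.
rewrite logpow_pow !INR_expn -Rpow_mult_distr; apply: pow_incr; split; first exact: pos_INR.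
have := z_ge; have := z_ge1; rewrite -{2}(prednK L0) S_INR; simpl; lra.
Qed.

Lemma a_le a : (INR a <= Rpower (INR 2) (logpow n 1 13))%Re -> a <= 2 ^ L.
Proof.
move=> le; apply/leP; apply: INR_le; rewrite INR_expn -Rpower_pow; last by simpl; lra.
apply: Rle_trans le _; apply: Rle_Rpower; first by simpl; lra.
exact: z_le.
Qed.

End Log.

Lemma Ln_ex n : exists L, n <= 2 ^ (L ^ 13).
Proof.
exists n; apply: leq_trans (ltnW (ltn_expl n (isT : 1 < 2))) _.
by rewrite leq_exp2l //; case: n => // n; rewrite -[X in X <= _]expn1 leq_pexp2l.
Qed.

Definition Ln n := ex_minn (Ln_ex n).

Lemma LnP n : 1 < n -> [/\ 0 < Ln n, n <= 2 ^ (Ln n ^ 13) & 2 ^ ((Ln n).-1 ^ 13) < n].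
Proof.
move=> n2; rewrite /Ln; case: ex_minnP => L nL mn.
have L0 : 0 < L by case: L nL {mn} => //; rewrite exp0n // expn0 leqNgt n2.
split=> //; rewrite ltnNge; apply/negP => /mn; lia.
Qed.

(** * Views *)

Lemma map_eq_imp (X Y Z Z' : Type) (f : X -> Z) (g : Y -> Z) (f' : X -> Z') (g' : Y -> Z') s s' :
  (forall x y, f x = g y -> f' x = g' y) -> map f s = map g s' -> map f' s = map g' s'.
Proof.
by move=> H; elim: s s' => [|x s IH] [|y s'] //= [/H -> /IH ->].
Qed.

Lemma map_eq_mem (X Y : eqType) (Z : Type) (f : X -> Z) (g : Y -> Z) s s' x :
  map f s = map g s' -> x \in s -> exists2 y, y \in s' & f x = g y.
Proof.
elim: s s' => [|x' s IH] [|y s'] //= [E /IH H]; rewrite inE => /predU1P[->|/H[z zs Ez]].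
  by exists y; rewrite ?mem_head.
by exists z; rewrite ?inE ?zs ?orbT.
Qed.

Lemma view_id (T T' : finType) (e : rel T) (e' : rel T') id id' r u u' :
  local_view e id r u = local_view e' id' r u' -> id u = id' u'.
Proof. by case: r => [|r] /= []. Qed.

Lemma view_pred (T T' : finType) (e : rel T) (e' : rel T') id id' r u u' :
  local_view e id r.+1 u = local_view e' id' r.+1 u' ->
  local_view e id r u = local_view e' id' r u'.
Proof.
elim: r u u' => [|r IH] u u'; first by case=> E _; rewrite /= E.
by case=> Eid Em; rewrite /= Eid; congr VNode; apply: map_eq_imp Em.
Qed.

Section IdGraph.
Variables (n c : nat).
Local Notation V := 'I_(n ^ c).+1.

Section Def.
Variables (T : finType) (e : rel T) (id : T -> nat).
Definition iv (u : T) : V := inord (id u).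
Definition ge : rel V := fun x y => [exists u, exists v, [&& e u v, iv u == x & iv v == y]].

Hypotheses (cT : #|T| = n) (ids : valid_ids c id).

Lemma ivE u : iv u = id u :> nat.
Proof. by case: ids => _ /(_ u)/andP[_]; rewrite cT /iv => le; rewrite inordK. Qed.

Lemma iv_inj : injective iv.
Proof. by move=> u v /(congr1 val); rewrite /= !ivE; case: ids => H _ /H. Qed.

Lemma geP x y : reflect (exists u v, [/\ e u v, iv u = x & iv v = y]) (ge x y).
Proof.
apply: (iffP existsP) => [[u /existsP[v /and3P[euv /eqP Ex /eqP Ey]]]|[u [v [euv Ex Ey]]]].
  by exists u, v.
by exists u; apply/existsP; exists v; rewrite euv Ex Ey !eqxx.
Qed.

Lemma ge_iv u v : ge (iv u) (iv v) = e u v.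
Proof.
apply/geP/idP => [[u' [v' [euv /iv_inj <- /iv_inj <-]]] //|euv].
by exists u, v.
Qed.

Lemma ge_out u y : ge (iv u) y -> exists2 v, e u v & iv v = y.
Proof. by case/geP => u' [v [euv /iv_inj <- <-]]; exists v. Qed.

Lemma num_ge u (P : V -> bool) : num (fun y => ge (iv u) y && P y) = num (fun v => e u v && P (iv v)).
Proof.
apply/eqP; rewrite eqn_leq; apply/andP; split; last first.
  apply: (@num_inj _ _ _ _ iv) => [x y _ _ /iv_inj //|v /andP[euv Pv]].
  by rewrite ge_iv euv.
pose g y := odflt u [pick v | iv v == y].
have gP v : g (iv v) = v.
  by rewrite /g; case: pickP => [w /eqP/iv_inj //|/(_ v)]; rewrite eqxx.
apply: (@num_inj _ _ _ _ g) => [x y /andP[/ge_out[v _ <-] _] /andP[/ge_out[w _ <-] _]|y].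
  by rewrite !gP => ->.
by case/andP => /ge_out[v euv <-]; rewrite gP euv.
Qed.

Lemma dg_ge u : dg ge (iv u) = deg e u.
Proof.
have := num_ge u (fun=> true); rewrite /dg /deg => E.
by rewrite (eq_num (Q := fun y => ge (iv u) y && true)) ?E => [|y]; rewrite ?andbT //; apply: eq_card => v; rewrite !inE andbT.
Qed.

Lemma sum_ge_le (F : V -> nat) : (forall x, (forall u, iv u <> x) -> F x = 0) ->
  \sum_x F x <= \sum_u F (iv u).
Proof.
move=> F0; have -> : \sum_u F (iv u) = \sum_u \sum_x (if iv u == x then F x else 0).
  apply: eq_bigr => u _; rewrite (bigD1 (iv u)) //= eqxx big1 ?addn0 // => x ne.
  by rewrite eq_sym (negbTE ne).
rewrite exchange_big /=; apply: leq_sum => x _.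
case: (boolP [exists u, iv u == x]) => [/existsP[u ux]|].
  by rewrite (bigD1 u) //= ux leq_addr.
by rewrite negb_exists => /forallP H; rewrite F0 // => u Eu; have := H u; rewrite Eu eqxx.
Qed.

Lemma ge_dense a : simple_graph e -> arboricity_le e a -> forall S : V -> bool,
  \sum_(x | S x) num (fun y => ge x y && S y) <= 2 * a * num S.
Proof.
move=> sg ar S; apply: (@leq_trans (2 * a * num (fun u => S (iv u)))); last first.
  rewrite leq_mul2l; apply/orP; right.
  by apply: (@num_inj _ _ _ _ iv) => [x y _ _ /iv_inj|].
apply: leq_trans (arboricity_density (fun u => S (iv u)) sg ar).
rewrite big_mkcond [X in _ <= X]big_mkcond /=.
apply: leq_trans (sum_ge_le _) _.
  move=> x nx; case: ifP => // _; apply: num0 => y; apply/negP => /andP[/geP[u [v [_ Ex _]]] _].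
  exact: nx Ex.
by apply: leq_sum => u _; rewrite num_ge.
Qed.

Lemma ge_num : num (fun x => 0 < dg ge x) <= n.
Proof.
rewrite -[X in _ <= X]cT num_sum; apply: leq_trans (sum_ge_le _) _.
  move=> x nx; case: posnP => // /num_ex[y /geP[u [v [_ Ex _]]]]; by case: (nx u).
by rewrite -sum1_card; apply: leq_sum => u _; case: (0 < _).
Qed.

End Def.

(** A view is a tree, but unique identifiers tell which of its vertices are the same node. Matching
    children of equal views have equal identifiers, so the rows of the two identifier graphs
    agree. *)
Lemma view_ball (T T' : finType) (e : rel T) (e' : rel T') id id' r u u' :
  #|T| = n -> #|T'| = n -> valid_ids c id -> valid_ids c id' ->
  local_view e id r u = local_view e' id' r u' ->
  ball (fun=> True) (ge e id) (ge e' id') r (iv id u).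
Proof.
move=> cT cT' v1 v2; elim: r u u' => [//|r IH] u u' E.
have Eid := view_id E; have Eiv : iv id u = iv id' u' by rewrite /iv Eid.
have Er := view_pred E; split; first exact: IH Er.
  apply: functional_extensionality => y; rewrite {2}Eiv; case: E => _ Em.
  apply/idP/idP => /ge_out.
    case=> // v ev <-; have := map_eq_mem (x := v) Em.
    rewrite mem_sort mem_filter mem_enum ev => /(_ isT)[w].
    rewrite mem_sort mem_filter => /andP[ew _] /view_id Ew.
    by rewrite [iv id v]/iv Ew -/(iv id' w) ge_iv.
  case=> // v ev <-; have := map_eq_mem (x := v) (esym Em).
  rewrite mem_sort mem_filter mem_enum ev => /(_ isT)[w].
  rewrite mem_sort mem_filter => /andP[ew _] /view_id Ew.
  by rewrite [iv id' v]/iv Ew -/(iv id w) ge_iv.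
move=> y /(ge_out cT v1)[v ev <-]; case: E => _ Em; have := map_eq_mem (x := v) Em.
rewrite mem_sort mem_filter mem_enum ev => /(_ isT)[w].
by rewrite mem_sort mem_filter => /andP[ew _] /IH.
Qed.

End IdGraph.

(** * From the colouring function to an algorithm on views *)

Lemma local_algorithm c n a L r : 0 < L -> n <= 2 ^ (L ^ 13) -> a <= 2 ^ L ->
  coreT c L + 12 * a <= r ->
  exists A : view -> nat -> nat, forall (T : finType) (e : rel T) (id : T -> nat),
    #|T| = n -> simple_graph e -> arboricity_le e a -> valid_ids c id ->
    valid_ed1_coloring e (fun u v => A (local_view e id r u) (id v)).
Proof.
move=> L0 nL aL le; have [F [Floc Fok]] := core c L0 nL aL.
have [A AP] : exists A : view -> nat -> nat, forall (T : finType) (e : rel T) (id : T -> nat) u v,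
    #|T| = n -> valid_ids c id ->
    A (local_view e id r u) (id v) = F (@ge n c _ e id) (@iv n c _ id u) (@iv n c _ id v).
  (* The output is read off any instance in which the view [w] occurs; by locality all such
     instances give the same row of [F]. Views that never occur get a dummy value. *)
  have ex (w : view) : exists g : nat -> nat, forall (T : finType) (e : rel T) (id : T -> nat) u v,
      #|T| = n -> valid_ids c id -> local_view e id r u = w ->
      g (id v) = F (@ge n c _ e id) (@iv n c _ id u) (@iv n c _ id v).
    case: (classic (exists (T : finType) (e : rel T) (id : T -> nat) u,
      [/\ #|T| = n, valid_ids c id & local_view e id r u = w])); last first.
      move=> none; exists (fun=> 0) => T e id u v cT vi E; case: none.
      by exists T, e, id, u.
    move=> [T [e [id [u [cT vi E]]]]]; exists (fun i => F (@ge n c _ e id) (@iv n c _ id u) (inord i)).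
    move=> T' e' id' u' v' cT' vi' E'; have Ev := etrans E (esym E').
    have Eiv : @iv n c _ id u = @iv n c _ id' u' by rewrite /iv (view_id Ev).
    rewrite -Eiv; suff -> : F (@ge n c _ e id) (@iv n c _ id u) = F (@ge n c _ e' id') (@iv n c _ id u) by [].
    by apply: Floc; apply: (ball_le le); apply: (view_ball cT cT' vi vi' Ev).
  exists (fun w => proj1_sig (constructive_indefinite_description _ (ex w))) => T e id u v cT vi.
  by case: constructive_indefinite_description => g /= H; apply: H.
exists A => T e id cT sg ar vi; have [sym irr] := sg.
have gsym : symmetric (@ge n c _ e id).
  by move=> x y; apply/geP/geP => -[u [v [euv Ex Ey]]]; exists v, u; rewrite sym.
have girr : irreflexive (@ge n c _ e id).
  move=> x; apply/negbTE/negP => /geP[u [v [euv <- /(iv_inj cT vi) E]]].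
  by rewrite E irr in euv.
have [f1 f2] := Fok _ gsym girr (@ge_dense n c T e id cT vi a sg ar) (@ge_num n c T e id cT).
split.
  move=> u v euv; rewrite !AP //; have guv : @ge n c _ e id (@iv n c _ id u) (@iv n c _ id v) by rewrite ge_iv.
  have [E /andP[p q]] := f1 _ _ guv; split; first exact: E.
  by move: p q; rewrite !dg_ge //; lia.
move=> u v w euv euw vw; rewrite !AP //; apply: f2; rewrite ?ge_iv //.
by apply: contra vw => /eqP/(iv_inj cT vi) ->.
Qed.

Lemma arboricity_tree (T : finType) (e : rel T) : acyclic e -> arboricity_le e 1.
Proof.
move=> ac; exists (fun _ _ => 0); split=> // -[|//] _ s.
have := ac s; apply: contra => /and3P[cy -> ->]; rewrite !andbT.
by apply: sub_cycle cy => x y /= /andP[].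
Qed.

(* For every ID-range exponent c: an algorithm A (node output = function of
   n and its R n-round view; it maps a neighbour's ID to the colour of the
   connecting edge) with R n = O(log^{12/13} n) for trees, and one with
   R n a = O(a + log^{12/13} n) for arboricity <= a <= 2^{log^{1/13} n}. *)
Theorem theorem1p3 :
  forall c : nat, 1 <= c ->
  (exists (Rt : nat -> nat) (A : nat -> view -> nat -> nat) (C : R),
     (forall n : nat, 2 <= n ->
        Rle (INR (Rt n)) (Rmult C (logpow n 12 13))) /\
     (forall (T : finType) (e : rel T) (id : T -> nat),
        simple_graph e -> is_tree e -> valid_ids c id ->
        valid_ed1_coloring e
          (fun u v => A #|T| (local_view e id (Rt #|T|) u) (id v)))) /\
  (exists (Ra : nat -> nat -> nat) (A : nat -> nat -> view -> nat -> nat) (C : R),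
     (forall n a : nat, 2 <= n ->
        Rle (INR a) (Rpower (INR 2) (logpow n 1 13)) ->
        Rle (INR (Ra n a)) (Rmult C (Rplus (INR a) (logpow n 12 13)))) /\
     (forall (T : finType) (e : rel T) (id : T -> nat) (a : nat),
        simple_graph e -> arboricity_le e a ->
        Rle (INR a) (Rpower (INR 2) (logpow #|T| 1 13)) ->
        valid_ids c id ->
        valid_ed1_coloring e
          (fun u v => A #|T| a (local_view e id (Ra #|T| a) u) (id v)))).
Proof.
move=> c c1; have [C0 HC] := pb_coreT c.
(* [C0] bounds [coreT] relative to [L ^ 12]; the 12 is 4 stars per unit of [a], with 3 rounds
   each. *)
pose C := C0 + 12; pose Ra n a := C * (a + Ln n ^ 12).
have [A AP] : exists A : nat -> nat -> view -> nat -> nat,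
    forall (T : finType) (e : rel T) (id : T -> nat) (a : nat),
      simple_graph e -> arboricity_le e a ->
      Rle (INR a) (Rpower (INR 2) (logpow #|T| 1 13)) -> valid_ids c id ->
      valid_ed1_coloring e (fun u v => A #|T| a (local_view e id (Ra #|T| a) u) (id v)).
  have ex n a : exists A : view -> nat -> nat, forall (T : finType) (e : rel T) (id : T -> nat),
      #|T| = n -> simple_graph e -> arboricity_le e a ->
      Rle (INR a) (Rpower (INR 2) (logpow n 1 13)) -> valid_ids c id ->
      valid_ed1_coloring e (fun u v => A (local_view e id (Ra n a) u) (id v)).
    case: (leqP n 1) => n1.
      (* With at most one node there is no edge, and any output is valid. *)
      exists (fun _ _ => 0) => T e id cT [_ irr] _ _ _.
      have no u v : e u v -> False.
        have /fintype_le1P H : #|T| <= 1 by rewrite cT.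
        by rewrite (H u v) irr.
      by split=> [u v /no | u v w /no].
    have [L0 nL Lm] := LnP n1.
    case: (classic (Rle (INR a) (Rpower (INR 2) (logpow n 1 13)))) => [ha|nha]; last first.
      by exists (fun _ _ => 0) => T e id _ _ _ /nha.
    have aL := a_le n1 L0 nL ha.
    have [|A AP] := @local_algorithm c n a (Ln n) (Ra n a) L0 nL aL.
      by have := HC _ L0; rewrite /Ra /C; nia.
    by exists A => T e id cT sg ar _ vi; apply: AP.
  exists (fun n a => proj1_sig (constructive_indefinite_description _ (ex n a))) => T e id a.
  by case: constructive_indefinite_description => A /= H; apply: H.
have Cp : (0 <= INR C)%Re by apply: pos_INR.
have bound n a : 2 <= n ->
    Rle (INR (Ra n a)) (Rmult (INR C * INR (2 ^ 12))%Re (Rplus (INR a) (logpow n 12 13))).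
  move=> n2; have [L0 nL Lm] := LnP n2.
  have -> : INR (Ra n a) = (INR C * (INR a + INR (Ln n ^ 12)))%Re.
    by rewrite -plus_INR -mult_INR.
  rewrite Rmult_assoc; apply: Rmult_le_compat_l => //.
  rewrite [(INR (2 ^ 12) * _)%Re]Rmult_plus_distr_l; apply: Rplus_le_compat.
    rewrite -[X in Rle X _]Rmult_1_l; apply: Rmult_le_compat_r; first exact: pos_INR.
    by rewrite -[1%Re]/(INR 1); apply: leq_INR; rewrite expn_gt0.
  exact: L12_le.
split; last first.
  exists Ra, A, (INR C * INR (2 ^ 12))%Re; split=> // n a n2 _; exact: bound.
(* A tree is the case [a = 1]; the factor 2 absorbs this summand because the power of the logarithm
   is at least 1. *)
exists (fun n => Ra n 1), (fun n => A n 1), (2 * (INR C * INR (2 ^ 12)))%Re; split.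
  move=> n n2; apply: Rle_trans (bound n 1 n2) _.
  have lg := logpow_ge1 n2.
  have p : (0 <= INR C * INR (2 ^ 12))%Re by apply: Rmult_le_pos => //; apply: pos_INR.
  rewrite -[INR 1]/1%Re; move: (INR C * _)%Re (logpow n 12 13) p lg => P l p lg.
  by have := Rmult_le_compat_l P _ _ p lg; lra.
move=> T e id sg [_ ac] vi; apply: AP => //; first exact: arboricity_tree.
rewrite -[INR 1]/1%Re -(Rpower_O (INR 2)); last by simpl; lra.
apply: Rle_Rpower; first by simpl; lra.
by apply: Rlt_le; apply: exp_pos.
Qed.
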